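(* Let $0<p<1$, $\alpha>0$, and $\beta\in\mathbb{N}\cup(1/p-1,\infty)$. There is a constant $C$ (independent of $f$ and $n$) such that for every $f$ with $f,f^{(\alpha)}\in L_1(\mathbb{T})$ and every $n\in\mathbb{N}$, $$E_n(f)_p\leq\frac{C}{n^{\alpha+\frac1p-1}}\left(\int_0^{1/n}\frac{\omega_\beta(f^{(\alpha)},t)_p^p}{t^{2-p}}\,dt\right)^{1/p}.$$
   Context: $\mathbb{T}\cong[0,2\pi)$; $L_p(\mathbb{T})$, $0<p<\infty$, is the space of measurable complex $2\pi$-periodic functions with $\|f\|_p=\left(\frac1{2\pi}\int_{\mathbb{T}}|f(x)|^p\,dx\right)^{1/p}<\infty$. $\mathbb{N}$ is the set of positive integers. $\mathcal{T}_n$ is the set of trigonometric polynomials of order at most $n$, and $E_n(f)_p=\inf_{T\in\mathcal{T}_n}\|f-T\|_p$. For $\alpha>0$, $\Delta_\delta^\alpha f(x)=\sum_{\nu=0}^\infty\binom{\alpha}{\nu}(-1)^\nu f(x-\nu\delta)$, where $\binom{\alpha}{\nu}=\frac{\alpha(\alpha-1)\dots(\alpha-\nu+1)}{\nu!}$ for $\nu\ge1$ and $\binom{\alpha}{0}=1$; the modulus of smoothness of order $\alpha$ is $\omega_\alpha(f,h)_p=\sup_{|\delta|<h}\|\Delta_\delta^\alpha f\|_p$. For $f\in L_1(\mathbb{T})$ and $\alpha\in\mathbb{R}$ the Weyl derivative $f^{(\alpha)}$ (fractional integral if $\alpha<0$) is given by $f^{(\alpha)}(x)\sim\sum_{k\in\mathbb{Z}\setminus\{0\}}(ik)^\alpha\widehat{f}_k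 e^{ikx}$, where $(ik)^\alpha=|k|^\alpha e^{i\frac{\alpha\pi}{2}\operatorname{sign}k}$ and $\widehat f_k=\frac1{2\pi}\int_0^{2\pi}f(x)e^{-ikx}dx$; $f^{(\alpha)}\in L_1(\mathbb{T})$ means that this series is the Fourier series of a function in $L_1(\mathbb{T})$, denoted $f^{(\alpha)}$. *)

(* Defs.v *)
From HB Require Import structures.
From mathcomp Require Import all_boot all_order all_algebra.
From mathcomp Require Import all_classical all_reals all_analysis.
From mathcomp.real_closed Require Import complex.

Set Implicit Arguments.
Unset Strict Implicit.
Unset Printing Implicit Defensive.

Import Order.TTheory GRing.Theory Num.Theory.
Import numFieldNormedType.Exports.

Local Open Scope classical_set_scope.
Local Open Scope ring_scope.
Local Open Scope complex_scope.

(* Functions on the circle are functions on the line that are 2pi-periodic;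
   integrals over the circle are taken over this fundamental domain. *)
Definition circle (R : realType) : set R := `[0, 2 * pi[%classic.
Arguments circle R : clear implicits.

Definition periodic2pi (R : realType) (f : R -> R[i]) : Prop :=
  forall x, f (x + 2 * pi) = f x.

(* R[i] carries no sigma-algebra in the library *)
Definition cmeasurable (R : realType) (f : R -> R[i]) : Prop :=
  measurable_fun [set: R] (fun x => complex.Re (f x)) /\
  measurable_fun [set: R] (fun x => complex.Im (f x)).

(* [Normc.normc] is the real-valued modulus; [`|z|] would lie in R[i]. *)
Definition pnorm (R : realType) (p : R) (f : R -> R[i]) : \bar R :=
  ((((2 * pi)^-1)%:E *
    \int[lebesgue_measure]_(x in circle R) (Normc.normc (f x) `^ p)%:E)
   `^ p^-1)%E.

Definition Lp (R : realType) (p : R) : set (R -> R[i]) :=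
  [set f | [/\ cmeasurable f, periodic2pi f & (pnorm p f < +oo)%E]].

Definition expi (R : realType) (t : R) : R[i] := cos t +i* sin t.

Definition trigpoly (R : realType) (n : nat) : set (R -> R[i]) :=
  [set T | exists c : 'I_(2 * n).+1 -> R[i],
     T = fun x => \sum_(j < (2 * n).+1) c j * expi ((j%:R - n%:R) * x)].

Definition best_approx (R : realType) (n : nat) (p : R) (f : R -> R[i]) :
  \bar R := ereal_inf [set pnorm p (f \- T) | T in @trigpoly R n].

Definition gbinom (R : realType) (a : R) (v : nat) : R :=
  (\prod_(j < v) (a - j%:R)) / (v`!)%:R.

(* Sum of a complex series, taken componentwise. *)
Definition cseries (R : realType) (u : nat -> R[i]) : R[i] :=
  limn (series (fun v => complex.Re (u v))) +i*
  limn (series (fun v => complex.Im (u v))).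

(* For f in L_1 and a > 0 the series converges absolutely for almost every x,
   so the default value of [limn] elsewhere does not affect [pnorm]. *)
Definition fdiff (R : realType) (a d : R) (f : R -> R[i]) (x : R) : R[i] :=
  cseries (fun v => (gbinom a v * (-1) ^+ v)%:C * f (x - v%:R * d)).

Definition modulus (R : realType) (a p : R) (f : R -> R[i]) (h : R) : \bar R :=
  ereal_sup [set pnorm p (fdiff a d f) | d in [set d : R | `|d| < h]].

Definition cintegral (R : realType) (D : set R) (f : R -> R[i]) : R[i] :=
  Rintegral lebesgue_measure D (fun x => complex.Re (f x)) +i*
  Rintegral lebesgue_measure D (fun x => complex.Im (f x)).

Definition fourier (R : realType) (f : R -> R[i]) (k : int) : R[i] :=
  ((2 * pi)^-1)%:C *
  cintegral (circle R) (fun x => f x * expi (- (k%:~R * x))).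

(* (ik)^a, for k <> 0 *)
Definition ik_pow (R : realType) (a : R) (k : int) : R[i] :=
  (`|k%:~R| `^ a)%:C * expi (a * pi / 2 * (sgz k)%:~R).

(* The function g is f^(a): the Fourier coefficients of g are those of the
   defining series, whose zeroth term is absent. A g in L_1 with this property
   is unique up to a null set. *)
Definition weyl_derivative (R : realType) (a : R) (f g : R -> R[i]) : Prop :=
  fourier g 0 = 0 /\
  forall k : int, k != 0 -> fourier g k = ik_pow a k * fourier f k.

(* Main.v *)
Require Import Defs.
From HB Require Import structures.
From mathcomp Require Import all_boot all_order all_algebra.
From mathcomp Require Import all_classical all_reals all_analysis.
From mathcomp.real_closed Require Import complex.
From mathcomp Require Import measurable_realfun.
From mathcomp Require Import ring lra zify.

Set Implicit Arguments.
Unset Strict Implicit.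
Unset Printing Implicit Defensive.

Import Order.TTheory GRing.Theory Num.Theory.
Import numFieldNormedType.Exports.

Local Open Scope classical_set_scope.
Local Open Scope ring_scope.

(** For N = 2^k let V_N f be a smooth de la Vallee-Poussin mean of f, whose
    multiplier is a cutoff equal to 1 on [-N/2, N/2] and vanishing off [-N, N].
    As V_N f -> f in L_1, hence in L_p, the error f - V_N f is the sum of the
    dyadic blocks V_{2M} f - V_M f over M = N, 2N, 4N, ...

    Since g = f^(alpha), each block equals M^(-alpha) A * (D^r g), where D is the
    symmetric second difference with step h = 2 pi / (32 M) and the trigonometric
    kernel A has a smooth symbol at scale M, which absorbs both |j|^(-alpha) and
    the division by (2 - 2 cos (j h))^r.  Repeated summation by parts makes A decay
    fast, so the L_p quasinorm of A is of the expected order M^(1 - 1/p).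

    For p < 1 a convolution is not bounded by norms of its factors.  It is
    therefore replaced by quadrature sums over the grids of step 2 pi / 2^l, for
    which |x + y|^p <= |x|^p + |y|^p is affordable.  Passing from one grid to the
    next produces an alternating sum, which equals half the alternating sum of the
    backward difference of the summand; iterating, the differences fall on A, which
    is smooth at scale M, or on g.  This bounds the block by
    sum_l 2^(l (1 - p)) ||Delta^(2r)_(2 pi / 2^l) g||_p^p.

    The integer difference of large order m = 2r is dominated by the fractional one
    of order beta because (1 - T)^m = (1 - T)^(m - beta) (1 - T)^beta and the
    coefficients of (1 - T)^(m - beta) are p-summable.  The resulting dyadic sum is
    a lower sum of the integral in the theorem. *)

(** * Smooth functions and trigonometric kernels *)

(** In the code [N] is the frequency scale and [M] the order of decay of a kernel. A grid samples a
    function that is only measurable, so no single grid controls a norm. Every estimate therefore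
    carries a free offset [lam]; integrated over one period, the power sum on n nodes becomes n
    times the integral of |G|^p. The step 2 pi / 2^l divides the period: alternating sums close up
    cyclically, and orbits under translation are finite, so fractional difference series converge at
    every point.

    The coarsest grid sees G itself, not a difference of it. This is why D^r is factored out of the
    block beforehand: G = D^r g is already a difference of g at the scale of the block.

    On level l the kernel gains (N 2^-l)^(m p) from its m differences, against the weight 2^(l (1 -
    p)) of the grid; m p >= 2 makes the product geometric.

    Only finitely many derivatives are used, so cutoffs are built from truncated powers. The factor
    32 = 2^5 exceeds 2 pi, keeps 2 - 2 cos (j h) away from zero on the block, and places the dyadic
    lower sum inside (0, 1/n). The work is done on real and imaginary parts, where (ij)^alpha acts
    as a phase shift; hence the phase [th] of the kernels. *)

Section Smooth.
Variable R : realType.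
Implicit Types (U : set R) (f g : R -> R) (n : nat).

(** C^n regularity on an open set, encoded by a chain of witnesses for the derivatives. Closure
    properties then follow by induction, with no iterated derivative to compute. *)
Fixpoint smooth_on U n f : Prop :=
  if n is n'.+1 then
    exists f', (forall x, U x -> is_derive x 1 f (f' x)) /\ smooth_on U n' f'
  else forall x, U x -> {for x, continuous f}.

Lemma is_derive_continuous f (x d : R) :
  is_derive x 1 f d -> {for x, continuous f}.
Proof. by move=> [df _]; apply/differentiable_continuous/derivable1_diffP. Qed.

Lemma smooth_onS U n f : smooth_on U n.+1 f -> smooth_on U n f.
Proof.
elim: n f => [|n IH] f [f' [df sf]].
  by move=> x Ux; exact: is_derive_continuous (df x Ux).
by exists f'; split=> //; exact: IH.
Qed.

Lemma smooth_on_leq U m n f : (m <= n)%N -> smooth_on U n f -> smooth_on U m f.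
Proof.
move=> mn; rewrite -(subnKC mn); elim: (n - m)%N => [|k IH]; first by rewrite addn0.
by rewrite addnS => /smooth_onS.
Qed.

Lemma smooth_on_subset U V n f : U `<=` V -> smooth_on V n f -> smooth_on U n f.
Proof.
move=> UV; elim: n f => [|n IH] f /=; first by move=> h x /UV; exact: h.
by move=> [f' [df sf]]; exists f'; split; [move=> x /UV; exact: df|exact: IH].
Qed.

Lemma smooth_on_eq U n f g : open U -> (forall x, U x -> f x = g x) ->
  smooth_on U n f -> smooth_on U n g.
Proof.
move=> oU fg; have near_fg x : U x -> \near x, f x = g x.
  by move=> Ux; apply: filterS (open_nbhs_nbhs (conj oU Ux)).
case: n => [|n] /=.
  move=> cf x Ux; rewrite /prop_for /continuous_at -fg//.
  apply: cvg_trans (cf x Ux); apply: near_eq_cvg; exact: near_fg.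
move=> [f' [df sf]]; exists f'; split=> // x Ux.
exact: near_eq_is_derive (near_fg x Ux) (df x Ux).
Qed.

Lemma smooth_on_cst U n (c : R) : smooth_on U n (fun=> c).
Proof.
elim: n c => [|n IH] c /=; first by move=> x _; exact: cvg_cst.
by exists (fun=> 0); split=> // x _; exact: is_derive_cst.
Qed.

Lemma smooth_on_add U n f g : smooth_on U n f -> smooth_on U n g ->
  smooth_on U n (fun x => f x + g x).
Proof.
elim: n f g => [|n IH] f g /=.
  by move=> cf cg x Ux; apply: continuousD; [exact: cf|exact: cg].
move=> [f' [df sf]] [g' [dg sg]]; exists (fun x => f' x + g' x).
by split; [move=> x Ux; apply: is_deriveD; [exact: df|exact: dg]|exact: IH].
Qed.

Lemma smooth_on_mul U n f g : smooth_on U n f -> smooth_on U n g ->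
  smooth_on U n (fun x => f x * g x).
Proof.
elim: n f g => [|n IH] f g.
  by move=> cf cg x Ux; apply: continuousM; [exact: cf|exact: cg].
move=> sf sg; have [f' [df sf']] := sf; have [g' [dg sg']] := sg.
exists (fun x => f x * g' x + g x * f' x); split.
  by move=> x Ux; apply: is_deriveM; [exact: df|exact: dg].
by apply: smooth_on_add; apply: IH => //; exact: smooth_onS.
Qed.

Lemma smooth_on_scale U n (c : R) f :
  smooth_on U n f -> smooth_on U n (fun x => c * f x).
Proof. by move=> sf; apply: smooth_on_mul => //; exact: smooth_on_cst. Qed.

Lemma smooth_on_exp U n k f : smooth_on U n f -> smooth_on U n (fun x => f x ^+ k).
Proof.
move=> sf; elim: k => [|k IH]; first exact: smooth_on_cst.
rewrite (_ : (fun x => _) = fun x => f x * f x ^+ k).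
  exact: smooth_on_mul.
by apply/funext => x; rewrite exprS.
Qed.

Lemma smooth_on_comp U n f g : smooth_on setT n f -> smooth_on U n g ->
  smooth_on U n (fun x => f (g x)).
Proof.
elim: n f g => [|n IH] f g.
  by move=> cf cg x Ux; apply: continuous_comp; [exact: cg|exact: cf].
move=> [f' [df sf]] sg; have [g' [dg sg']] := sg.
exists (fun x => f' (g x) * g' x); split.
  by move=> x Ux; apply: is_derive1_comp; [exact: df|exact: dg].
by apply: smooth_on_mul => //; apply: IH => //; exact: smooth_onS.
Qed.

Lemma smooth_on_id U n : smooth_on U n id.
Proof.
case: n => [|n] /=; first by move=> x _; exact: cvg_id.
by exists (fun=> 1); split=> [x _|]; [exact: is_derive_id|exact: smooth_on_cst].
Qed.

Lemma smooth_on_affine U n (a b : R) : smooth_on U n (fun x => a * x + b).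
Proof.
apply: smooth_on_add; last exact: smooth_on_cst.
by apply: smooth_on_scale; exact: smooth_on_id.
Qed.

Lemma smooth_on_inv U n f : (forall x, U x -> f x != 0) ->
  smooth_on U n f -> smooth_on U n (fun x => (f x)^-1).
Proof.
move=> f0; elim: n => [|n IH].
  by move=> cf x Ux; apply: cvgV; [exact: f0|exact: cf].
move=> sf; have [f' [df sf']] := sf.
exists (fun x => - f' x * (f x)^-1 ^+ 2); split.
  move=> x Ux; have := df x Ux => dfx.
  have := is_deriveV (f0 x Ux) dfx.
  move/is_derive_eq; apply.
  by rewrite -exprVn scaleNr mulNr; congr (- _); rewrite mulrC.
apply: smooth_on_mul; last by apply/smooth_on_exp/IH; exact: smooth_onS.
rewrite (_ : (fun x => _) = fun x => -1 * f' x).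
  exact: smooth_on_scale.
by apply/funext => x; rewrite mulN1r.
Qed.

Lemma smooth_on_powR n (a : R) : smooth_on [set x | 0 < x] n (fun x => x `^ a).
Proof.
elim: n a => [|n IH] a /=.
  by move=> x /= x0; exact: is_derive_continuous (is_derive1_powR a x0).
exists (fun x => a * x `^ (a - 1)); split; last by apply: smooth_on_scale; exact: IH.
by move=> x /= x0; exact: is_derive1_powR.
Qed.

Lemma is_derive_cosD (t x : R) : is_derive x 1 (fun x : R => cos (x + t)) (cos (x + (t + pi / 2))).
Proof.
have h : is_derive x 1 (fun x : R => x + t) (1 + 0).
  exact: is_deriveD.
have := @is_derive1_comp _ cos (fun x => x + t) _ _ _ (is_derive_cos (x + t)) h.
by move/is_derive_eq; apply; rewrite addr0 mulr1 addrA cosDpihalf.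
Qed.

Lemma smooth_cosD n (t : R) : smooth_on setT n (fun x => cos (x + t)).
Proof.
elim: n t => [|n IH] t /=.
  by move=> x _; exact: is_derive_continuous (is_derive_cosD t x).
by exists (fun x => cos (x + (t + pi / 2))); split=> // x _; exact: is_derive_cosD.
Qed.

(** The open interval and the complement of the support cover the line, and [f] vanishes on the
    second set. This allows symbols containing a power of x or a quotient that is singular at 0. *)
Lemma smooth_on_extend0 n f (a b c d : R) : a < b -> c < d ->
  (forall x, ~ (b <= x <= c) -> f x = 0) ->
  smooth_on [set x | a < x < d] n f -> smooth_on setT n f.
Proof.
move=> ab cd; have oU : open [set x : R | a < x < d].
  rewrite (_ : [set x | _] = [set` `]a, d[]); first exact: interval_open.
  by apply/seteqP; split=> x /=; rewrite in_itv.
have oK : open [set x : R | ~ (b <= x <= c)].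
  rewrite -[X in open X]setCK openC (_ : ~` _ = [set` `[b, c]]).
    exact: interval_closed.
  apply/seteqP; split=> x /=; rewrite in_itv/=; first by move/contrapT.
  by move=> h; apply.
have cover x : ~ (b <= x <= c) \/ a < x < d.
  have [/andP[h1 h2]|h] := pselect (b <= x <= c); last by left.
  by right; rewrite (lt_le_trans ab)//= (le_lt_trans h2).
have near0 h x : (forall x, ~ (b <= x <= c) -> h x = 0) -> ~ (b <= x <= c) ->
    \near x, cst 0 x = h x :> R.
  move=> h0 Kx; apply: filterS (open_nbhs_nbhs (conj oK Kx)) => y Ky.
  by rewrite h0.
elim: n f => [|n IH] f f0 /=.
  move=> cf x _; have [Kx|Ux] := cover x; last exact: cf.
  rewrite /prop_for /continuous_at (_ : nbhs (f x) = nbhs (0 : R)) ?f0//.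
  apply: cvg_trans (near_eq_cvg (near0 f x f0 Kx)) _.
  exact: cvg_cst.
move=> [f' [df sf]].
(* The given derivative is meaningful on ]a, d[ only; it is cut off to 0 outside the support, which
   changes nothing where both descriptions apply. *)
pose f'' (x : R) := if b <= x <= c then f' x else 0.
have f''E x : a < x < d -> f' x = f'' x.
  move=> Ux; rewrite /f''; case: ifPn => // /negP Kx.
  have [_ <-] := df x Ux; rewrite -(near_eq_derive _ (near0 f x f0 Kx)).
  by have [] := is_derive_cst (0 : R) x (1 : R).
have df'' (x : R) : is_derive x 1 f (f'' x).
  have [Kx|Ux] := cover x; last by rewrite -f''E//; exact: df.
  apply: near_eq_is_derive (near0 f x f0 Kx) _.
  by rewrite /f'' ifF; [exact: is_derive_cst|exact/negP].
exists f''; split=> //; apply: IH.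
  by move=> x /negP Kx; rewrite /f'' (negbTE Kx).
exact: smooth_on_eq sf.
Qed.

End Smooth.

(** * Finite differences controlled by derivatives *)

Section FiniteDifferences.
Variable R : realType.
Implicit Types (f w : R -> R) (d : R) (n : nat).

Definition fwd d f : R -> R := fun x => f (x + d) - f x.

Definition diff2 d f : R -> R := fun x => 2 * f x - f (x + d) - f (x - d).

(** Only the last derivative of the chain is bounded. The bound is a weight rather than a constant,
    so that the decay of a kernel survives differencing. *)
Fixpoint derive_bounded n w f : Prop :=
  if n is n'.+1 then
    exists f', (forall x : R, is_derive x 1 f (f' x)) /\ derive_bounded n' w f'
  else forall x, `|f x| <= w x.

(** Mean value theorem; [K] is the price of moving the weight from the intermediate point back to
    x. *)
Lemma derive_bounded_fwd n f w d K : 0 <= d ->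
  (forall x s, 0 <= s <= d -> w (x + s) <= K * w x) ->
  derive_bounded n.+1 w f -> derive_bounded n (fun x => d * K * w x) (fwd d f).
Proof.
move=> d0 wK; elim: n f => [|n IH] f [f' [df bf]] /=.
  move=> x; have xd : x <= x + d by rewrite lerDl.
  have [|c] := MVT_segment xd (fun y _ => df y).
    by apply: continuous_subspaceT => y; exact: is_derive_continuous (df y).
  rewrite in_itv/= => /andP[xc cxd]; rewrite /fwd => ->.
  rewrite [x + d]addrC addrK normrM (ger0_norm d0) mulrC -mulrA ler_wpM2l//.
  rewrite (le_trans (bf c))// -(subrK x c) addrC wK// subr_ge0 xc/=.
  by rewrite lerBlDl.
exists (fwd d f'); split; last exact: IH.
move=> x.
have h : is_derive x 1 (fun x : R => x + d) (1 + 0) by exact: is_deriveD.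
have h1 := @is_derive1_comp _ f (fun x => x + d) _ _ _ (df (x + d)) h.
rewrite addr0 mulr1 in h1.
exact: is_deriveB h1 (df x).
Qed.

Lemma iter_fwd_le n f w d K : 0 <= d -> 0 <= K ->
  (forall x s, 0 <= s <= d -> w (x + s) <= K * w x) ->
  derive_bounded n w f -> forall x, `|iter n (fwd d) f x| <= (d * K) ^+ n * w x.
Proof.
move=> d0 K0; elim: n f w => [|n IH] f w wK; first by move=> bf x; rewrite mul1r; exact: bf.
move=> bf x; rewrite iterSr exprSr -mulrA.
apply: (IH _ (fun x => d * K * w x)); last exact: derive_bounded_fwd.
by move=> y s hs; rewrite mulrCA ler_wpM2l ?mulr_ge0// wK.
Qed.

Lemma derive_bounded_oppshift n f B d :
  derive_bounded n (fun=> B) f -> derive_bounded n (fun=> B) (fun x => - f (x - d)).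
Proof.
elim: n f => [|n IH] f /=; first by move=> bf x; rewrite normrN.
move=> [f' [df bf]]; exists (fun x => - f' (x - d)); split; last exact: IH.
move=> x.
have h : is_derive x 1 (fun x : R => x - d) (1 + 0) by exact: is_deriveD.
have h1 := @is_derive1_comp _ f (fun x => x - d) _ _ _ (df (x - d)) h.
rewrite addr0 mulr1 in h1.
exact: is_deriveN h1.
Qed.

(** A symmetric second difference is minus a translated double forward difference, so each one
    consumes two derivatives and gains d^2. *)
Lemma iter_diff2_le n f B d : 0 <= d ->
  derive_bounded (n.*2) (fun=> B) f -> forall x, `|iter n (diff2 d) f x| <= d ^+ n.*2 * B.
Proof.
move=> d0; elim: n f B => [|n IH] f B; first by move=> bf x; rewrite mul1r; exact: bf.
rewrite doubleS => bf x; rewrite iterSr.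
have := IH (diff2 d f) (d * (d * B)).
rewrite exprSr exprSr -!mulrA; apply.
have -> : diff2 d f = fun x => - (fwd d (fwd d f)) (x - d).
  by apply/funext => y; rewrite /diff2 /fwd subrK; ring.
apply: derive_bounded_oppshift.
have w1 (c : R) : forall x s : R, 0 <= s <= d -> c <= 1 * c by move=> *; rewrite mul1r.
have h1 := @derive_bounded_fwd _ _ (fun=> B) _ _ d0 (w1 B) bf; rewrite mulr1 in h1.
by have := @derive_bounded_fwd _ _ (fun=> d * B) _ _ d0 (w1 _) h1; rewrite mulr1.
Qed.

(** The complement of the interval is open, so all derivatives vanish there too; on the interval the
    extreme value theorem applies. *)
Lemma smooth_support_bounded n f (a b : R) : a <= b ->
  (forall x, ~ (a <= x <= b) -> f x = 0) -> smooth_on setT n f ->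
  exists2 B, 0 < B & derive_bounded n (fun=> B) f.
Proof.
move=> ab; elim: n f => [|n IH] f f0 /=.
  move=> cf; have cf' : {within `[a, b], continuous (fun x => `|f x|)}.
    apply: continuous_subspaceT => x; apply: continuous_comp; first exact: cf.
    exact: norm_continuous.
  have [c _ cmax] := EVT_max ab cf'.
  exists (`|f c| + 1); first by rewrite ltr_wpDl.
  move=> x; have [xab|xab] := pselect (a <= x <= b); last first.
    by rewrite f0// normr0 addr_ge0.
  by rewrite (le_trans (cmax x _))// ?in_itv// lerDl.
move=> [f' [df sf]]; suff /IH/(_ sf) [B B0 bB] : forall x, ~ (a <= x <= b) -> f' x = 0.
  by exists B => //; exists f'; split=> // x; exact: df.
have oK : open [set x : R | ~ (a <= x <= b)].
  rewrite -[X in open X]setCK openC (_ : ~` _ = [set` `[a, b]]).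
    exact: interval_closed.
  apply/seteqP; split=> x /=; rewrite in_itv/=; first by move/contrapT.
  by move=> h; apply.
move=> x Kx; have [_ <-] := df x I.
have near0 : \near x, cst 0 x = f x.
  by apply: filterS (open_nbhs_nbhs (conj oK Kx)) => y Ky; rewrite f0.
by rewrite -(near_eq_derive _ near0); have [] := is_derive_cst (0 : R) x (1 : R).
Qed.

End FiniteDifferences.

(** * Cosine kernels with a sampled symbol, and their decay *)

Section TrigKernel.
Variable R : realType.
Implicit Types (b : R -> R) (M N : nat) (th x : R).

(** The sum of b(j/N) cos(j x + th) over |j| <= (M + 3) N, indexed by i = j + (M + 3) N. Symbols are
    supported in [-2, 2] and each of up to [M] second differences of step 1/N widens the support by
    1/N, so this window always suffices. *)
Definition trig_kernel M b N th x : R :=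
  \sum_(0 <= i < (((M + 3) * N).*2).+1)
    b ((i%:R - ((M + 3) * N)%:R) / N%:R) * cos ((i%:R - ((M + 3) * N)%:R) * x + th).

(** Summation by parts: multiplication by 2 - 2 cos x shifts the frequency by one in both
    directions, which moves the second difference onto the symbol. The symbol vanishes at the ends
    of the window, so no boundary term appears. *)
Lemma trig_kernel_diff2 M b N th x : (0 < N)%N ->
  (forall y, (M + 3)%:R <= `|y| -> b y = 0) ->
  (2 - 2 * cos x) * trig_kernel M b N th x =
  trig_kernel M (diff2 N%:R^-1 b) N th x.
Proof.
move=> N0 b0; rewrite /trig_kernel; set L := ((M + 3) * N)%N.
have N0' : N%:R != 0 :> R by rewrite pnatr_eq0 -lt0n.
have LN : L%:R / N%:R = (M + 3)%:R :> R by rewrite natrM mulfK.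
pose e (t : R) := cos (t * x + th).
pose F i := b ((i%:R - L%:R) / N%:R - N%:R^-1) * e (i%:R - L%:R).
pose G i := b ((i%:R - L%:R) / N%:R) * e (i%:R - L%:R - 1).
(* Reindexing by one is a telescoping difference of the two end terms, both of which vanish. *)
have sum0 (H : nat -> R) : H L.*2.+1 = 0 -> H 0%N = 0 ->
    \sum_(0 <= i < L.*2.+1) H i.+1 = \sum_(0 <= i < L.*2.+1) H i.
  move=> h1 h2; apply/eqP; rewrite -subr_eq0 -sumrB telescope_sumr//.
  by rewrite h1 h2 subrr.
have Ltop : L.*2.+1%:R - L%:R = L%:R + 1 :> R.
  by rewrite -addn1 natrD -addnn natrD; ring.
have F0 : \sum_(0 <= i < L.*2.+1) F i.+1 = \sum_(0 <= i < L.*2.+1) F i.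
  apply: sum0; rewrite /F b0 ?mul0r//.
    by rewrite Ltop mulrDl mul1r addrK LN ler_norm.
  rewrite sub0r mulNr LN -opprD normrN ger0_norm ?addr_ge0 ?invr_ge0//.
  by rewrite lerDl invr_ge0.
have G0 : \sum_(0 <= i < L.*2.+1) G i.+1 = \sum_(0 <= i < L.*2.+1) G i.
  apply: sum0; rewrite /G b0 ?mul0r//.
    rewrite Ltop mulrDl mul1r LN.
    by rewrite ger0_norm ?addr_ge0 ?invr_ge0// lerDl invr_ge0.
  by rewrite sub0r mulNr LN normrN ler_norm.
transitivity (\sum_(0 <= i < L.*2.+1) (2 * (b ((i%:R - L%:R) / N%:R) * e (i%:R - L%:R))
   - F i.+1 - G i)).
  rewrite mulr_sumr; apply: eq_bigr => i _.
  rewrite /F /G /e -[i.+1]addn1 natrD.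
  rewrite (_ : (i%:R + 1%:R - L%:R) / N%:R - N%:R^-1 = (i%:R - L%:R) / N%:R); last by field.
  set t := i%:R - L%:R; rewrite (_ : i%:R + 1%:R - L%:R = t + 1); last by rewrite /t; ring.
  rewrite (_ : (t + 1) * x + th = (t * x + th) + x); last by ring.
  rewrite (_ : (t - 1) * x + th = (t * x + th) - x); last by ring.
  by rewrite (cosD (t * x + th)) (cosB (t * x + th)); ring.
rewrite !sumrB F0 -G0 -!sumrB; apply: eq_bigr => i _.
rewrite /F /G /e /diff2 -[i.+1]addn1 natrD.
rewrite (_ : (i%:R + 1%:R - L%:R) / N%:R = (i%:R - L%:R) / N%:R + N%:R^-1); last by field.
rewrite (_ : i%:R + 1%:R - L%:R - 1 = i%:R - L%:R); last by ring.
by ring.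
Qed.

Lemma trig_kernel_le M b N th x B : (0 < N)%N ->
  (forall y, `|b y| <= B) -> `|trig_kernel M b N th x| <= (2 * (M + 3) + 1)%:R * N%:R * B.
Proof.
move=> N0 bB; rewrite (le_trans (ler_norm_sum _ _ _))//.
have B0 : 0 <= B by exact: le_trans (bB 0).
apply: (@le_trans _ _ (\sum_(0 <= i < (((M + 3) * N).*2).+1) B)).
  apply: ler_sum => i _; rewrite normrM -[leRHS]mulr1.
  by rewrite ler_pM// ?cos_max.
rewrite big_const_nat iter_addr_0 subn0 -[leLHS]mulr_natl ler_wpM2r// -natrM ler_nat.
by nia.
Qed.

Lemma expr_onep_le M (t : R) : 0 <= t -> (1 + t) ^+ M <= 2 ^+ M * (1 + t ^+ M).
Proof.
move=> t0; have [t1|t1] := leP t 1.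
  apply: (@le_trans _ _ (2 ^+ M)).
    by apply: lerXn2r; rewrite ?nnegrE; lra.
  by rewrite ler_peMr ?exprn_ge0// lerDl exprn_ge0.
apply: (@le_trans _ _ (2 ^+ M * t ^+ M)).
  by rewrite -exprMn; apply: lerXn2r; rewrite ?nnegrE; lra.
by rewrite ler_wpM2l ?exprn_ge0// lerDr.
Qed.

Lemma two_sub_cos_ge0 x : 0 <= 2 - 2 * cos x.
Proof. by have := cos_le1 x; lra. Qed.

(** M summations by parts turn (2 - 2 cos x)^M times the kernel into the kernel of an M-fold second
    difference, of size N^(-2M) relative to the trivial bound O(N). The two bounds together give the
    quotient. *)
Lemma trig_kernel_decay M b : smooth_on setT M.*2 b ->
  (forall y, ~ (-2 <= y <= 2) -> b y = 0) ->
  exists2 C, 0 < C & forall N th x, (0 < N)%N ->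
    `|trig_kernel M b N th x| <=
      C * (N%:R / (1 + N%:R ^+ 2 * (2 - 2 * cos x)) ^+ M).
Proof.
move=> sb b0; have le22 : -2 <= 2 :> R by lra.
have [B B_gt0 bB] := smooth_support_bounded le22 b0 sb.
have [B' B'_gt0 bB'] := smooth_support_bounded le22 b0 (smooth_on_leq (leq0n _) sb).
(* Each second difference enlarges the support by 1/N on both sides. *)
have supp i N y : (0 < N)%N -> 2 + i%:R / N%:R < `|y| -> iter i (diff2 N%:R^-1) b y = 0.
  move=> N0; elim: i y => [|i IH] y /=.
    rewrite mul0r addr0 => hy; apply: b0 => /andP[h1 h2].
    by move: hy; rewrite ltNge ler_norml h1 h2.
  rewrite -(natr1 i) mulrDl mul1r addrA => hy.
  have N1 : 0 < N%:R^-1 :> R by rewrite invr_gt0 ltr0n.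
  have h1 : `|y| <= `|y - N%:R^-1| + N%:R^-1.
    by rewrite -{1}(subrK N%:R^-1 y) (le_trans (ler_normD _ _))// lerD2l gtr0_norm.
  have h2 : `|y| <= `|y + N%:R^-1| + N%:R^-1.
    by rewrite -{1}(addrK N%:R^-1 y) (le_trans (ler_normB _ _))// lerD2l gtr0_norm.
  rewrite /diff2 (IH y) ?(IH (y + _)) ?(IH (y - _)) ?mulr0 ?subr0//; lra.
have iterE i N th x : (0 < N)%N -> (i <= M)%N ->
    (2 - 2 * cos x) ^+ i * trig_kernel M b N th x =
    trig_kernel M (iter i (diff2 N%:R^-1) b) N th x.
  move=> N0; elim: i => [|i IH] iM; first by rewrite mul1r.
  rewrite exprS -mulrA IH ?(ltnW iM)//= trig_kernel_diff2// => y hy.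
  apply: supp => //; rewrite (lt_le_trans _ hy)// natrD addrC.
  suff : i%:R / N%:R <= M%:R :> R by lra.
  rewrite ler_pdivrMr ?ltr0n// -natrM ler_nat; nia.
pose c : R := (2 * (M + 3) + 1)%:R.
have c0 : 0 < c by rewrite ltr0n; lia.
exists (2 ^+ M * (c * B' + c * B)).
  by rewrite mulr_gt0 ?exprn_gt0// addr_gt0// mulr_gt0.
move=> N th x N0; have N0' : 0 < N%:R :> R by rewrite ltr0n.
set t := 2 - 2 * cos x; have t0 : 0 <= t := two_sub_cos_ge0 x.
have u0 : 0 <= N%:R ^+ 2 * t by rewrite mulr_ge0 ?exprn_ge0// ltW.
rewrite mulrA ler_pdivlMr ?exprn_gt0//; last by rewrite ltr_pwDl.
have h1 : `|trig_kernel M b N th x| <= c * B' * N%:R.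
  by rewrite (mulrAC c); exact: trig_kernel_le.
have h2 : `|trig_kernel M b N th x| * (N%:R ^+ 2 * t) ^+ M <= c * B * N%:R.
  have -> : `|trig_kernel M b N th x| * (N%:R ^+ 2 * t) ^+ M =
      N%:R ^+ M.*2 * `|t ^+ M * trig_kernel M b N th x|.
    by rewrite normrM (ger0_norm (exprn_ge0 _ t0)) exprMn -exprM mul2n; ring.
  rewrite iterE//.
  have hb := @trig_kernel_le M (iter M (diff2 N%:R^-1) b) N th x (N%:R^-1 ^+ M.*2 * B) N0.
  apply: le_trans (ler_wpM2l _ (hb _)) _; first by rewrite exprn_ge0// ltW.
    by apply: iter_diff2_le => //; rewrite invr_ge0 ltW.
  by rewrite -/c exprVn mulrCA [_ ^+ _ * _]mulrA divff ?mul1r ?expf_neq0 ?gt_eqF// mulrAC.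
apply: le_trans (ler_wpM2l _ (expr_onep_le M u0)) _ => //.
set u := N%:R ^+ 2 * t in h2 u0 *.
rewrite [leLHS](_ : _ = 2 ^+ M * (`|trig_kernel M b N th x| +
  `|trig_kernel M b N th x| * u ^+ M)); last by ring.
by rewrite -mulrA ler_wpM2l ?exprn_ge0// mulrDl lerD.
Qed.

End TrigKernel.

(** * Integration over the circle *)

Section CircleIntegral.
Variable R : realType.
Notation mu := (@lebesgue_measure R).
Notation tau := (2 * pi : R).
Implicit Types (u v w : R -> R) (p : R).

Lemma tau_gt0 : 0 < tau. Proof. by rewrite mulr_gt0 ?pi_gt0. Qed.
Hint Resolve tau_gt0 : core.

Lemma measurable_circle : measurable (circle R).
Proof. exact: measurable_itv. Qed.
Hint Resolve measurable_circle : core.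

Lemma mu_circle : mu (circle R) = tau%:E.
Proof. by rewrite /circle lebesgue_measure_itv/= lte_fin tau_gt0 oppr0 adde0. Qed.

Lemma measurable_shift (a : R) : measurable_fun setT (fun x : R => x + a).
Proof. by apply: measurable_funD => //; exact: measurable_cst. Qed.

Lemma eq_integral_dom (D D' : set R) (h : R -> \bar R) : D = D' ->
  (\int[mu]_(x in D) h x = \int[mu]_(x in D') h x)%E.
Proof. by move=> ->. Qed.

(** The image of Lebesgue measure under a translation agrees with it on half-open intervals, hence
    equals it by uniqueness. *)
Lemma ge0_integral_shift (a : R) (D : set R) (h : R -> \bar R) :
  measurable D -> measurable_fun setT h -> (forall x, (0 <= h x)%E) ->
  (\int[mu]_(x in (fun x => (x + a)%R) @^-1` D) h (x + a)%R = \int[mu]_(x in D) h x)%E.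
Proof.
move=> mD mh h0.
have mphi : measurable_fun setT ((fun x => x + a) : measurableTypeR R -> measurableTypeR R).
  exact: measurable_shift.
rewrite -(@ge0_integral_pushforward _ _ _ _ _ _ mphi mu D h)//; last first.
  exact: measurable_funS mh.
apply: eq_measure_integral => /= A mA _; apply/esym/lebesgue_measure_unique => //.
move=> _ [[b c]] _ <-; rewrite /pushforward/=.
rewrite [X in _ = mu X](_ : _ = `](b - a), (c - a)]%classic); last first.
  by apply/seteqP; split=> x /=; rewrite !in_itv/= ltrBlDr lerBrDr.
rewrite !lebesgue_measure_itv/= !lte_fin ltrD2r; case: ifP => // _.
by rewrite -!EFinB; congr EFin; ring.
Qed.

Definition is_periodic (T : Type) (h : R -> T) := forall x, h (x + tau) = h x.

Lemma is_periodic_nat (T : Type) (h : R -> T) (k : nat) x :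
  is_periodic h -> h (x + k%:R * tau) = h x.
Proof.
move=> ph; elim: k => [|k IH]; first by rewrite mul0r addr0.
by rewrite -[k.+1%:R]natr1 mulrDl mul1r addrA ph.
Qed.

Lemma is_periodic_int (T : Type) (h : R -> T) (k : int) x :
  is_periodic h -> h (x + k%:~R * tau) = h x.
Proof.
move=> ph; case: k => k; first exact: is_periodic_nat.
by rewrite -(is_periodic_nat k.+1 _ ph) NegzE mulrNz mulNr subrK.
Qed.

Lemma is_periodic_shift (T : Type) (h : R -> T) a :
  is_periodic h -> is_periodic (fun x => h (x + a)).
Proof. by move=> ph x; rewrite addrAC ph. Qed.

(** The shift is reduced modulo the period. The translated fundamental domain then overhangs the
    original one by an interval, which periodicity moves back by one period. *)
Lemma circle_integral_shift (h : R -> \bar R) (a : R) :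
  measurable_fun setT h -> (forall x, (0 <= h x)%E) -> is_periodic h ->
  (\int[mu]_(x in circle R) h (x + a)%R = \int[mu]_(x in circle R) h x)%E.
Proof.
move=> mh h0 ph.
pose k := Num.floor (a / tau); pose a' := a - k%:~R * tau.
have a'0 : 0 <= a'.
  by rewrite subr_ge0 -ler_pdivlMr// floor_le.
have a'1 : a' < tau.
  by rewrite ltrBlDr -[X in X + _]mul1r -mulrDl -ltr_pdivrMr// addrC -intrD1 floorD1_gt.
transitivity (\int[mu]_(x in circle R) h (x + a')%R)%E.
  apply: eq_integral => x _.
  by rewrite -(is_periodic_int k (x + a') ph) /a' -addrA subrK.
have E1 : (\int[mu]_(x in circle R) h (x + a')%R =
           \int[mu]_(x in `[a', (a' + tau)%R[) h x)%E.
  rewrite -[RHS](@ge0_integral_shift a')//; apply: eq_integral_dom.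
  by rewrite /circle; apply/seteqP; split=> x /=; rewrite !in_itv/=; lra.
have mitv (c d : R) : measurable_fun `[c, d[ h by exact: measurable_funS mh.
have splitE (c d e : R) : c <= d -> d <= e ->
    (\int[mu]_(x in `[c, e[) h x = \int[mu]_(x in `[c, d[) h x + \int[mu]_(x in `[d, e[) h x)%E.
  move=> cd de; rewrite -ge0_integral_setU//.
  - by apply: eq_integral_dom; apply/seteqP; split=> x /=; rewrite !in_itv/=; lra.
  - exact: measurable_funS mh.
  - by apply/disj_setPS => x [] /=; rewrite !in_itv/=; lra.
rewrite E1 (splitE a' tau)//; [|lra|lra].
rewrite [RHS](splitE 0 a')//; last lra.
rewrite addeC; congr (_ + _)%E.
rewrite -[LHS](@ge0_integral_shift tau)//.
under eq_integral do rewrite ph.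
by apply: eq_integral_dom; apply/seteqP; split=> x /=; rewrite !in_itv/=; lra.
Qed.

End CircleIntegral.

(** * Powers with exponent at most one *)

Section PowerSubadditivity.
Variable R : realType.

(** A ratio in [0, 1] is at most its p-th power; apply this to a / (a + b) and b / (a + b) and
    add. *)
Lemma powR_subadditive (p a b : R) : 0 < p -> p <= 1 -> 0 <= a -> 0 <= b ->
  (a + b) `^ p <= a `^ p + b `^ p.
Proof.
move=> p0 p1 a0 b0; have [s0|s0] := eqVneq (a + b) 0.
  by rewrite s0 powR0 ?gt_eqF// addr_ge0 ?powR_ge0.
have s_gt0 : 0 < a + b by rewrite lt_neqAle eq_sym s0 addr_ge0.
have h x : 0 <= x -> x <= a + b -> x / (a + b) * (a + b) `^ p <= x `^ p.
  move=> x0 xs; have [->|xn0] := eqVneq x 0; first by rewrite !mul0r powR_ge0.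
  rewrite [leRHS](_ : _ = (x / (a + b)) `^ p * (a + b) `^ p); last first.
    have h0 : 0 <= x / (a + b) by rewrite divr_ge0// ltW.
    by rewrite -(powRM p h0 (ltW s_gt0)) divfK.
  rewrite ler_wpM2r ?powR_ge0//.
  apply: ger1_powR => //; rewrite divr_gt0//= ?ler_pdivrMr ?mul1r//.
  by rewrite lt_neqAle eq_sym xn0.
apply: (@le_trans _ _ (a / (a + b) * (a + b) `^ p + b / (a + b) * (a + b) `^ p)).
  by rewrite -mulrDl -mulrDl divff// mul1r.
by rewrite lerD// h// ?lerDl ?lerDr.
Qed.

(** Beyond [e] one has t^(p - 1) <= e^(p - 1). With [e] free, smallness in L_1 becomes smallness in
    L_p without Hoelder's inequality. *)
Lemma powR_le_eps (p e t : R) : 0 < p -> p <= 1 -> 0 < e -> 0 <= t ->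
  t `^ p <= e `^ p + e `^ (p - 1) * t.
Proof.
move=> p0 p1 e0 t0; have [te|et] := leP t e.
  apply: (@le_trans _ _ (e `^ p)); last by rewrite lerDl mulr_ge0 ?powR_ge0.
  by apply: ge0_ler_powR; rewrite ?nnegrE//; exact: ltW.
apply: (@le_trans _ _ (e `^ (p - 1) * t)); last by rewrite lerDr powR_ge0.
have t_gt0 : 0 < t by exact: lt_trans et.
rewrite -(mulr_powRB1 t0 p0) mulrC ler_wpM2r//.
rewrite -[p - 1]opprB !powRN lef_pV2 ?posrE ?powR_gt0//.
by apply: ge0_ler_powR; rewrite ?nnegrE ?subr_ge0//; exact: ltW.
Qed.

Lemma le_powRl (p a b : R) : 0 <= p -> 0 <= a -> a <= b -> a `^ p <= b `^ p.
Proof.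
by move=> p0 a0 ab; apply: ge0_ler_powR; rewrite ?nnegrE//; exact: le_trans ab.
Qed.

End PowerSubadditivity.

(** * Integrals of p-th powers over the circle, and continuity of translation *)

Section CircleNorm.
Variable R : realType.
Notation mu := (@lebesgue_measure R).
Notation tau := (2 * pi : R).
Implicit Types (u v w : R -> R) (p : R).

Let tau_gt0 : 0 < tau := tau_gt0 R.
Hint Resolve tau_gt0 : core.
Let mC : measurable (circle R) := @measurable_circle R.
Hint Resolve mC : core.

(** The p-th power of the quasinorm, without normalisation. For p <= 1 this quantity, unlike the
    quasinorm itself, satisfies the triangle inequality. *)
Definition Np p u : \bar R := (\int[mu]_(x in circle R) (`|u x| `^ p)%:E)%E.

Lemma measurable_powR_norm p u (D : set R) : measurable_fun setT u ->
  measurable_fun D (fun x => (`|u x| `^ p)%:E).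
Proof.
move=> mu_; apply: measurable_funTS; apply/measurable_EFinP.
apply: (measurableT_comp (measurable_powR p)).
exact: measurableT_comp.
Qed.

Lemma Np_ge0 p u : (0 <= Np p u)%E.
Proof. by apply: integral_ge0 => x _; rewrite lee_fin powR_ge0. Qed.

Lemma eq_Np p u v : u =1 v -> Np p u = Np p v.
Proof. by move=> uv; apply: eq_integral => x _; rewrite uv. Qed.

Lemma le_Np p u v : 0 <= p -> measurable_fun setT u -> measurable_fun setT v ->
  (forall x, `|u x| <= `|v x|) -> (Np p u <= Np p v)%E.
Proof.
move=> p0 mu_ mv uv; apply: ge0_le_integral => //; try exact: measurable_powR_norm.
- by move=> x _; rewrite lee_fin le_powRl.
Qed.

Lemma NpD p u v : 0 < p -> p <= 1 -> measurable_fun setT u -> measurable_fun setT v ->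
  (Np p (fun x => u x + v x)%R <= Np p u + Np p v)%E.
Proof.
move=> p0 p1 mu_ mv; rewrite /Np -ge0_integralD//;
  try (by move=> x _; rewrite lee_fin powR_ge0); try exact: measurable_powR_norm.
apply: ge0_le_integral => //.
- by apply: measurable_powR_norm; exact: measurable_funD.
- by apply: emeasurable_funD; exact: measurable_powR_norm.
- move=> x _; rewrite -EFinD lee_fin.
  apply: le_trans (powR_subadditive p0 p1 (normr_ge0 _) (normr_ge0 _)).
  by apply: ge0_ler_powR; rewrite ?nnegrE ?addr_ge0 ?ler_normD//; exact: ltW.
Qed.

Lemma NpZ p (c : R) u : measurable_fun setT u ->
  Np p (fun x => c * u x) = ((`|c| `^ p)%:E * Np p u)%E.
Proof.
move=> mu_; rewrite /Np -ge0_integralZl//.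
- by apply: eq_integral => x _; rewrite normrM powRM// EFinM.
- exact: measurable_powR_norm.
Qed.

Lemma NpN p u : Np p (fun x => - u x) = Np p u.
Proof. by apply: eq_integral => x _; rewrite normrN. Qed.

Lemma Np_sum p (I : Type) (r : seq I) (u : I -> R -> R) : 0 < p -> p <= 1 ->
  (forall i, measurable_fun setT (u i)) ->
  (Np p (fun x => \sum_(i <- r) u i x)%R <= \sum_(i <- r) Np p (u i))%E.
Proof.
move=> p0 p1 mu_; elim: r => [|i r IH].
  rewrite big_nil /Np integral0_eq// => x _.
  by rewrite big_nil normr0 powR0// gt_eqF.
rewrite big_cons (eq_Np p (v := fun x => u i x + \sum_(j <- r) u j x)).
  apply: le_trans (NpD p0 p1 _ _) _ => //; first exact: measurable_sum.
  exact: leeD.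
by move=> x; rewrite big_cons.
Qed.

Lemma Np_shift p u a : measurable_fun setT u -> is_periodic u ->
  Np p (fun x => u (x + a)) = Np p u.
Proof.
move=> mu_ pu; rewrite /Np.
apply: (@circle_integral_shift _ (fun x => (`|u x| `^ p)%:E)).
- exact: measurable_powR_norm.
- by move=> x; rewrite lee_fin powR_ge0.
- by move=> x; rewrite pu.
Qed.

Lemma integral_circle_cst (c : R) : (\int[mu]_(x in circle R) c%:E)%E = (c * tau)%:E.
Proof. by rewrite EFinM -mu_circle; exact: (integral_cst mu mC c%:E). Qed.

Lemma Np_le_eps p u e : 0 < p -> p <= 1 -> 0 < e -> measurable_fun setT u ->
  (Np p u <= (e `^ p * tau)%:E + (e `^ (p - 1))%:E * Np 1 u)%E.
Proof.
move=> p0 p1 e0 mu_; rewrite -integral_circle_cst -ge0_integralZl//;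
  try (by move=> x _; rewrite lee_fin powR_ge0); try exact: measurable_powR_norm;
  try (by rewrite lee_fin powR_ge0).
rewrite -ge0_integralD//; try (by move=> x _; rewrite lee_fin ?mulr_ge0 ?powR_ge0).
- apply: ge0_le_integral => //.
  + exact: measurable_powR_norm.
  + apply: emeasurable_funD => //; apply: measurable_funeM; exact: measurable_powR_norm.
  + by move=> x _; rewrite -EFinM -EFinD lee_fin powRr1// powR_le_eps.
- by apply: measurable_funeM; exact: measurable_powR_norm.
Qed.

Lemma Np1E u : Np 1 u = (\int[mu]_(x in circle R) `|(u x)%:E|)%E.
Proof. by apply: eq_integral => x _; rewrite powRr1. Qed.

Lemma circle_integrableP u : measurable_fun setT u ->
  mu.-integrable (circle R) (EFin \o u) <-> (Np 1 u < +oo)%E.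
Proof.
move=> mu_; rewrite Np1E; split; first by move=> /integrableP[].
by move=> h; apply/integrableP; split => //; apply/measurable_EFinP; exact: measurable_funTS.
Qed.

Lemma continuous_uniform_translation (c : R -> R) (a b e : R) : continuous c -> 0 < e ->
  exists2 d, 0 < d & forall s x, 0 <= s <= d -> a <= x <= b -> `|c (x + s) - c x| < e.
Proof.
move=> cc e0.
have cov := (compact_near_coveringP `[a, b]%classic).1 (@segment_compact R a b).
have H x : `[a, b]%classic x ->
    \forall x' \near x & s \near nbhs (0 : R), `|c (x' + s) - c x'| < e.
  move=> _.
  have cz : (fun z : R * R => c (z.1 + z.2) - c z.1) @ (x, (0 : R)) --> c (x + 0) - c x.
    apply: cvgB.
      apply: continuous_comp; last exact: cc.
      by apply: cvgD; [exact: cvg_fst|exact: cvg_snd].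
    by apply: continuous_comp; [exact: cvg_fst|exact: cc].
  rewrite addr0 subrr in cz.
  have [[A B]/= AB hAB] := (cvgr0Pnorm_lt _).1 cz e e0.
  by exists (A, B) => // z; exact: hAB.
have := cov _ (nbhs (0 : R)) (fun s x => `|c (x + s) - c x| < e) _ H.
move=> /(_ _)/nbhs_ballP[d /= d0 hd].
exists (d / 2); first by rewrite divr_gt0.
move=> s x /andP[s0 sd] xab; apply: (hd s _ x); last by rewrite /= in_itv.
by rewrite /ball/= sub0r normrN ger0_norm// (le_lt_trans sd)// gtr_pMr// invf_lt1// ltr1n.
Qed.

(** Periodicity of [h] is not assumed, because the continuous approximants used below need not be
    periodic; a doubled interval absorbs all shifts by at most one period. *)
Lemma integral_translate_le (h : R -> R) s : 0 <= s <= tau -> measurable_fun setT h ->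
  (\int[mu]_(x in circle R) `|(h (x + s)%R)%:E| <=
   \int[mu]_(x in `[0%R, (2 * tau)%R]) `|(h x)%:E|)%E.
Proof.
move=> hs mh.
have mn : measurable_fun setT (fun x => `|(h x)%:E|%E).
  by apply: measurableT_comp => //; exact/measurable_EFinP.
rewrite (@eq_integral_dom _ _ ((fun x => x + s) @^-1` `[s, (s + tau)[%classic)); last first.
  by rewrite /circle; apply/seteqP; split=> x /=; rewrite !in_itv/=; lra.
rewrite (@ge0_integral_shift _ s _ (fun x => `|(h x)%:E|%E))//.
apply: ge0_subset_integral => //; first exact: measurable_funS mn.
by move=> x /=; rewrite !in_itv/=; lra.
Qed.

Lemma integral_double_circle (u : R -> R) : measurable_fun setT u -> is_periodic u ->
  (\int[mu]_(x in `[0%R, (2 * tau)%R]) `|(u x)%:E| = Np 1 u + Np 1 u)%E.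
Proof.
move=> mu_ pu.
have mn D : measurable_fun D (fun x => `|(u x)%:E|%E).
  by apply: measurable_funTS; apply: measurableT_comp => //; exact/measurable_EFinP.
rewrite -(@integral_itv_bndo_bndc _ (BLeft 0) (2 * tau) (fun x => `|(u x)%:E|%E))//.
rewrite (@eq_integral_dom _ _ (circle R `|` `[tau, (2 * tau)[%classic)); last first.
  by rewrite /circle; apply/seteqP; split=> x /=; rewrite !in_itv/=; lra.
rewrite ge0_integral_setU//; last first.
  by apply/disj_setPS => x [] /=; rewrite /circle /= !in_itv/=; lra.
  exact: mn.
rewrite Np1E; congr (_ + _)%E.
rewrite -[LHS](@ge0_integral_shift _ tau _ (fun x => `|(u x)%:E|%E))//.
rewrite (@eq_integral_dom _ _ (circle R)); last first.
  by rewrite /circle; apply/seteqP; split=> x /=; rewrite !in_itv/=; lra.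
by apply: eq_integral => x _; rewrite pu.
Qed.

(** Approximation in L_1 on two periods by a continuous function, which is uniformly continuous
    there; each of the three differences costs e/3. *)
Lemma continuous_translation u (e : R) : measurable_fun setT u -> is_periodic u ->
  (Np 1 u < +oo)%E -> 0 < e ->
  exists2 d, 0 < d & forall s, 0 <= s <= d ->
    (Np 1 (fun x => u (x + s) - u x)%R <= e%:E)%E.
Proof.
move=> mu_ pu fu e0; pose E : set R := `[0, (2 * tau)]%classic.
have mE : measurable E by exact: measurable_itv.
have iE : mu.-integrable E (EFin \o u).
  apply/integrableP; split; first by apply/measurable_EFinP; exact: measurable_funTS.
  by rewrite integral_double_circle// lte_add_pinfty.
have muE : (mu E < +oo)%E by rewrite /E lebesgue_measure_itv/=; case: ifP; rewrite ?ltry.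
have [c_ [cc _ ccvg]] := approximation_continuous_integrable mE muE iE.
have e3 : 0 < e / 3 by rewrite divr_gt0.
have [n _ /(_ n (leqnn n)) /= hn] := ccvg _ (nbhs_open_ereal_lt (f := fun=> e / 3) e3).
set c := c_ n in hn.
have mc : measurable_fun setT c by apply: continuous_measurable_fun; exact: cc.
have e3t : 0 < e / 3 / tau by rewrite divr_gt0.
have [d d0 hd] := continuous_uniform_translation 0 tau (cc n) e3t.
exists (Num.min d tau); first by rewrite lt_min d0.
move=> s /andP[s0]; rewrite le_min => /andP[sd st].
have ms (h : R -> R) : measurable_fun setT h -> measurable_fun setT (fun x : R => h (x + s)).
  by move=> mh; apply: measurableT_comp => //; exact: measurable_shift.
rewrite (@eq_Np _ _ (fun x => (u (x + s) - c (x + s)) + ((c (x + s) - c x) + (c x - u x)))); last first.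
  by move=> x; ring.
have muc : measurable_fun setT (fun x : R => u x - c x) by exact: measurable_funB.
have mcu : measurable_fun setT (fun x : R => c x - u x) by exact: measurable_funB.
have mcc : measurable_fun setT (fun x : R => c (x + s) - c x).
  by apply: measurable_funB => //; exact: ms.
apply: le_trans (NpD _ _ (ms _ muc) _) _ => //; first exact: measurable_funD.
rewrite [e%:E](_ : _ = (e / 3)%:E + ((e / 3)%:E + (e / 3)%:E))%E; last first.
  by rewrite -!EFinD; congr EFin; field.
apply: leeD; last apply: le_trans (NpD _ _ _ _) _ => //; last apply: leeD.
- rewrite Np1E; apply: le_trans (integral_translate_le _ muc) (ltW hn).
  by rewrite s0.
- rewrite [(e / 3)%:E](_ : _ = (e / 3 / tau * tau)%:E); last by rewrite divfK ?gt_eqF.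
  rewrite -integral_circle_cst Np1E; apply: ge0_le_integral => //.
  + by apply: measurable_funTS; apply: measurableT_comp => //; exact/measurable_EFinP.
  + move=> x; rewrite /circle/= in_itv/= => /andP[x0 xt].
    by rewrite lee_fin ltW// hd ?s0// x0 ltW.
- rewrite Np1E (le_trans _ (ltW hn))//.
  rewrite (@eq_integral _ _ _ mu _ (fun x => `|((fun x => u x - c x) (x + 0)%R)%:E|%E)).
    by apply: integral_translate_le; rewrite ?lexx ?ltW.
  by move=> x _; rewrite /= addr0 distrC.
Qed.

(** Serves twice: with W = 1 for the oscillation on a grid cell, and with W a kernel for the
    approximate identity. Indicators turn the set integrals into integrals over the plane. *)
Lemma circle_tonelli (D : set R) (W u : R -> R) : measurable D ->
  measurable_fun setT W -> (forall t, 0 <= W t) -> measurable_fun setT u ->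
  (\int[mu]_(x in circle R) \int[mu]_(t in D) (W t * `|u (x + t) - u x|)%:E =
   \int[mu]_(t in D) ((W t)%:E * Np 1 (fun x => u (x + t) - u x)%R))%E.
Proof.
move=> mD mW W0 mu_.
pose F (z : R * R) : \bar R := ((\1_(circle R) z.1 * \1_D z.2) * (W z.2 * `|u (z.1 + z.2) - u z.1|))%:E.
have mF : measurable_fun setT F.
  apply/measurable_EFinP; apply: measurable_funM.
    apply: measurable_funM; (apply: measurableT_comp; [exact: measurable_indic|]).
      exact: measurable_fst.
    exact: measurable_snd.
  apply: measurable_funM; first by apply: measurableT_comp => //; exact: measurable_snd.
  apply: measurableT_comp => //; apply: measurable_funB.
    apply: measurableT_comp => //.
    by apply: measurable_funD; [exact: measurable_fst|exact: measurable_snd].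
  by apply: measurableT_comp => //; exact: measurable_fst.
have F0 z : (0 <= F z)%E.
  by rewrite lee_fin !mulr_ge0.
have := @sfinite_Fubini _ _ _ _ R mu mu F F0 mF.
have -> : (\int[mu]_x \int[mu]_y F (x, y) =
    \int[mu]_(x in circle R) \int[mu]_(t in D) (W t * `|u (x + t) - u x|)%:E)%E.
  rewrite [RHS]integral_mkcond; apply: eq_integral => x _.
  rewrite patchE; case: ifPn => xC; last first.
    by rewrite integral0_eq// => y _; rewrite /F/= indicE (negbTE xC) !mul0r.
  rewrite [RHS]integral_mkcond; apply: eq_integral => y _.
  rewrite patchE /F/= !indicE xC; case: ifPn => yD; first by rewrite !mul1r.
  by rewrite mulr0 mul0r.
move=> ->; rewrite [RHS]integral_mkcond; apply: eq_integral => y _.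
rewrite patchE; case: ifPn => yD; last first.
  by rewrite integral0_eq// => x _; rewrite /F/= !indicE (negbTE yD) mulr0 mul0r.
rewrite Np1E -ge0_integralZl//; last 2 first.
- apply: measurable_funTS; apply: measurableT_comp => //; apply/measurable_EFinP.
  by apply: measurable_funB => //; apply: measurableT_comp => //; exact: measurable_shift.
- by rewrite lee_fin.
rewrite [RHS]integral_mkcond; apply: eq_integral => x _.
rewrite patchE /F/= !indicE yD; case: ifPn => xC; first by rewrite !mul1r -EFinM.
by rewrite !mul0r.
Qed.

End CircleNorm.

(** * The L_p size of a decaying kernel *)

Section KernelNorm.
Variable R : realType.
Notation mu := (@lebesgue_measure R).
Notation tau := (2 * pi : R).
Implicit Types (p x y : R) (M N : nat).

Let tau_gt0 : 0 < tau := tau_gt0 R.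
Hint Resolve tau_gt0 : core.
Let mC : measurable (circle R) := @measurable_circle R.
Hint Resolve mC : core.

(** With s = x/2 the mean value theorem gives sin s >= s cos s, so sin x >= 2 s (cos s)^2; and cos x
    >= 0 forces (cos s)^2 >= 1/2. *)
Lemma sin_ge_half x : 0 <= x <= pi / 2 -> x / 2 <= sin x.
Proof.
move=> /andP[x0 xpi]; pose s := x / 2.
have s0 : 0 <= s by rewrite divr_ge0.
have sx : s + s = x by rewrite /s; lra.
have pi0 := pi_gt0 R.
have [c] := MVT_segment s0 (fun y _ => is_derive_sin y) (continuous_subspaceT (@continuous_sin R)).
rewrite in_itv/= => /andP[c0 cs]; rewrite sin0 !subr0 => sinE.
have cos_cs : cos s <= cos c.
  rewrite leNgt; apply/negP; rewrite ltr_cos ?in_itv/=; [lra|apply/andP; split; lra|apply/andP; split; lra].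
have cs0 : 0 <= cos s by apply: cos_ge0_pihalf; apply/andP; split; lra.
have cx0 : 0 <= cos x by apply: cos_ge0_pihalf; apply/andP; split; lra.
have h1 : s * cos s <= sin s by rewrite sinE mulrC ler_wpM2r.
have : cos x = 2 * cos s ^+ 2 - 1.
  by rewrite -sx cosD -!expr2 sin2cos2; ring.
have -> : sin x = 2 * (sin s * cos s) by rewrite -sx sinD; ring.
rewrite -/s => h2.
have : s * cos s * cos s <= sin s * cos s by rewrite ler_wpM2r.
have : s * (1 / 2) <= s * (cos s ^+ 2) by rewrite ler_wpM2l//; lra.
by rewrite expr2 mulrA; lra.
Qed.

Lemma two_sub_cosE x : 2 - 2 * cos x = 4 * sin (x / 2) ^+ 2.
Proof.
have -> : cos x = cos (x / 2) ^+ 2 - sin (x / 2) ^+ 2.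
  by rewrite {1}(splitr x) cosD; ring.
by rewrite cos2sin2; ring.
Qed.

Lemma two_sub_cos_ge x : `|x| <= pi -> x ^+ 2 / 4 <= 2 - 2 * cos x.
Proof.
move=> hx; rewrite -[x ^+ 2]real_normK ?num_real// -cos_norm two_sub_cosE.
have := @sin_ge_half (`|x| / 2); set s := sin _; set t := `|x| in hx *.
have t0 : 0 <= t := normr_ge0 x.
have -> : 0 <= t / 2 <= pi / 2 by apply/andP; split; lra.
move=> /(_ isT) h; have : (t / 2 / 2) ^+ 2 <= s ^+ 2.
  by rewrite ler_pXn2r ?nnegrE//; lra.
by rewrite !expr2; lra.
Qed.

(** Periodic analogue of N / (1 + (N x)^2)^M, since 2 - 2 cos x is comparable to x^2 on a period
    centred at 0. *)
Definition kernel_weight M N x : R := N%:R / (1 + N%:R ^+ 2 * (2 - 2 * cos x)) ^+ M.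

Lemma kernel_denom_gt0 N x : 0 < 1 + N%:R ^+ 2 * (2 - 2 * cos x).
Proof. by rewrite ltr_pwDl// mulr_ge0 ?exprn_ge0// two_sub_cos_ge0. Qed.

Lemma kernel_weight_ge0 M N x : 0 <= kernel_weight M N x.
Proof. by rewrite divr_ge0// exprn_ge0// ltW// kernel_denom_gt0. Qed.

Lemma continuous_kernel_denom N : continuous (fun x : R => 1 + N%:R ^+ 2 * (2 - 2 * cos x)).
Proof.
move=> x; apply: cvgD; first exact: cvg_cst.
apply: cvgM; first exact: cvg_cst.
apply: cvgB; first exact: cvg_cst.
by apply: cvgM; [exact: cvg_cst|exact: continuous_cos].
Qed.

(** After centring the period, 2 - 2 cos x >= x^2 / 4 leaves 1 / (1 + (N x / 2)^2), whose primitive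
    (2 / N) atan (N x / 2) varies by at most 2 pi / N. *)
Lemma integral_kernel_denom N : (0 < N)%N ->
  (\int[mu]_(x in circle R) ((1 + N%:R ^+ 2 * (2 - 2 * cos x))^-1)%:E <= (tau / N%:R)%:E)%E.
Proof.
move=> N0; have N0' : 0 < N%:R :> R by rewrite ltr0n.
have pi0 := pi_gt0 R.
pose w (x : R) := (1 + N%:R ^+ 2 * (2 - 2 * cos x))^-1.
have mw : measurable_fun setT w.
  apply: continuous_measurable_fun => x; apply: cvgV; last exact: continuous_kernel_denom.
  by rewrite gt_eqF// kernel_denom_gt0.
pose q (x : R) := (1 + (N%:R / 2 * (x - pi)) ^+ 2)^-1.
have q0 x : 0 < 1 + (N%:R / 2 * (x - pi)) ^+ 2 by rewrite ltr_pwDl// sqr_ge0.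
have cq : continuous q.
  move=> x; apply: cvgV; first by rewrite gt_eqF.
  apply: cvgD; first exact: cvg_cst.
  have h : (fun x : R => N%:R / 2 * (x - pi)) @ x --> N%:R / 2 * (x - pi).
    apply: cvgM; first exact: cvg_cst.
    by apply: cvgB; [exact: cvg_id|exact: cvg_cst].
  by rewrite expr2; under eq_fun do rewrite expr2; exact: cvgM.
pose F (x : R) := 2 / N%:R * atan (N%:R / 2 * (x - pi)).
have dF x : is_derive x 1 F (q x).
  have hl : is_derive x 1 (fun x : R => N%:R / 2 * (x - pi)) (N%:R / 2 *: (1 - 0)).
    by apply: is_deriveZ.
  have h := @is_derive1_comp _ atan (fun x : R => N%:R / 2 * (x - pi)) _ _ _ (is_derive1_atan _) hl.
  have h2 := is_deriveZ (2 / N%:R) h.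
  apply: is_derive_eq h2 _; rewrite /q subr0 /GRing.scale/= mulr1.
  set t := (1 + _)^-1; rewrite [LHS](_ : _ = t * (2 / N%:R * (N%:R / 2))); last by ring.
  have -> : 2 / N%:R * (N%:R / 2) = 1 :> R by field; rewrite gt_eqF.
  by rewrite mulr1.
apply: (@le_trans _ _ (\int[mu]_(x in circle R) (q x)%:E)%E).
  rewrite -(@circle_integral_shift _ (fun x => (w x)%:E) (- pi)).
  - apply: ge0_le_integral => //.
    + by move=> x _; rewrite lee_fin invr_ge0 ltW// kernel_denom_gt0.
    + apply: measurable_funTS; apply/measurable_EFinP.
      by apply: (measurableT_comp mw); exact: measurable_shift.
    + by apply: measurable_funTS; apply/measurable_EFinP; exact: continuous_measurable_fun.
    + move=> x; rewrite /circle/= in_itv/= => /andP[x0 xt].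
      rewrite lee_fin /w /q lef_pV2 ?posrE ?kernel_denom_gt0// lerD2l exprMn.
      rewrite [_ ^+ 2 * (x - pi) ^+ 2](_ : _ = N%:R ^+ 2 * ((x - pi) ^+ 2 / 4)); last by field.
      rewrite ler_wpM2l ?exprn_ge0//; apply: two_sub_cos_ge.
      by rewrite ler_norml; apply/andP; split; lra.
  - exact/measurable_EFinP.
  - by move=> x; rewrite lee_fin invr_ge0 ltW// kernel_denom_gt0.
  - by move=> x; rewrite /w (mulr_natl pi 2) cosD2pi.
rewrite /circle (@integral_itv_bndo_bndc _ (BLeft 0) tau (fun x => (q x)%:E)); last first.
  by apply: measurable_funTS; apply/measurable_EFinP; exact: continuous_measurable_fun.
rewrite (@continuous_FTC2 _ q F)//.
- rewrite -EFinB lee_fin /F -mulrBr.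
  have hb := atan_ltpi2 (N%:R / 2 * (tau - pi)); have ha := atan_gtNpi2 (N%:R / 2 * (0 - pi) : R).
  rewrite (_ : tau / N%:R = 2 / N%:R * pi); last by field; rewrite gt_eqF.
  by rewrite ler_wpM2l ?divr_ge0//; lra.
- exact: continuous_subspaceT.
- split.
  + by move=> x _; have [] := dF x.
  + by apply: cvg_at_right_filter; exact: is_derive_continuous (dF 0).
  + by apply: cvg_at_left_filter; exact: is_derive_continuous (dF tau).
- by move=> x _; rewrite derive1E; have [] := dF x.
Qed.

(** As M p >= 1 and the denominator is at least 1, its power M p is bounded below by its first
    power, and the previous integral applies. *)
Lemma Np_kernel_weight p M N c (K : R -> R) : 0 < p -> 1 <= M%:R * p -> (0 < N)%N ->
  0 <= c -> measurable_fun setT K -> (forall x, `|K x| <= c * kernel_weight M N x) ->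
  (Np p K <= (c `^ p * (tau * N%:R `^ (p - 1)))%:E)%E.
Proof.
move=> p0 Mp N0 c0 mK Kw; have N0' : 0 < N%:R :> R by rewrite ltr0n.
have md : measurable_fun setT (fun x : R => ((1 + N%:R ^+ 2 * (2 - 2 * cos x))^-1)%:E).
  apply/measurable_EFinP; apply: continuous_measurable_fun => x.
  apply: cvgV; last exact: continuous_kernel_denom.
  by rewrite gt_eqF// kernel_denom_gt0.
apply: (@le_trans _ _ (\int[mu]_(x in circle R) ((c `^ p * N%:R `^ p)%:E * ((1 + N%:R ^+ 2 * (2 - 2 * cos x))^-1)%:E))%E).
  apply: ge0_le_integral => //.
  - exact: measurable_powR_norm.
  - by apply: measurable_funeM; exact: measurable_funTS.
  - move=> x _; rewrite -EFinM lee_fin.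
    apply: le_trans (le_powRl (ltW p0) (normr_ge0 _) (Kw x)) _.
    have d0 := kernel_denom_gt0 N x; set d := 1 + _ in d0 *.
    have d1 : 1 <= d by rewrite lerDl mulr_ge0 ?exprn_ge0// two_sub_cos_ge0.
    rewrite powRM ?kernel_weight_ge0// -mulrA ler_wpM2l ?powR_ge0//.
    rewrite /kernel_weight -/d powRM// ?invr_ge0 ?exprn_ge0 ?(ltW d0)//.
    rewrite ler_wpM2l ?powR_ge0// -[_ ^- M]powR_invn ?(ltW d0)// -powRrM -[leRHS]powR_inv1 ?(ltW d0)//.
    by rewrite ler_powR// mulNr lerN2.
rewrite ge0_integralZl//; try exact: measurable_funTS;
  try (by move=> x _; rewrite lee_fin invr_ge0 ltW// kernel_denom_gt0);
  try (by rewrite lee_fin mulr_ge0 ?powR_ge0).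
apply: le_trans (lee_wpmul2l _ (integral_kernel_denom N0)) _.
  by rewrite lee_fin mulr_ge0 ?powR_ge0.
rewrite powRB; last by rewrite (gt_eqF N0') implybT.
rewrite powRr1 ?(ltW N0')// -EFinM lee_fin le_eqVlt; apply/orP; left.
by apply/eqP; ring.
Qed.

(** On the scale 1/N the weight varies by a bounded factor, because |sin (x/2)| <= |sin ((x + s)/2)|
    + s/2. This supplies the constant [K] in the bound for iterated forward differences. *)
Lemma kernel_weight_slow M N x s H : 0 <= s -> N%:R * s <= H ->
  kernel_weight M N (x + s) <= (2 + 2 * H ^+ 2) ^+ M * kernel_weight M N x.
Proof.
move=> s0 NsH; have Ns0 : 0 <= N%:R * s by rewrite mulr_ge0.
have H0 : 0 <= H by exact: le_trans NsH.
have d0 := kernel_denom_gt0 N x; have d1 := kernel_denom_gt0 N (x + s).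
rewrite /kernel_weight mulrCA ler_wpM2l// -exprVn -exprVn -exprMn.
apply: lerXn2r; rewrite ?nnegrE ?invr_ge0 ?(ltW d1)//.
  by rewrite mulr_ge0 ?addr_ge0 ?mulr_ge0 ?sqr_ge0// invr_ge0 ltW.
rewrite -[leLHS]mul1r ler_pdivrMr// mulrAC ler_pdivlMr// mul1r.
rewrite !two_sub_cosE.
pose a := sin ((x + s) / 2); pose b := sin (x / 2).
have hab : `|b| <= `|a| + s / 2.
  have -> : b = a * cos (s / 2) - cos ((x + s) / 2) * sin (s / 2).
    by rewrite -sinB /b; congr sin; field.
  apply: le_trans (ler_normB _ _) _; rewrite !normrM lerD//.
    by rewrite ler_piMr// cos_max.
  apply: (@le_trans _ _ (1 * `|sin (s / 2)|)); first by rewrite ler_wpM2r// cos_max.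
  have s2 : 0 <= s / 2 by rewrite divr_ge0.
  have [c _] := MVT_segment s2 (fun y _ => is_derive_sin y) (continuous_subspaceT (@continuous_sin R)).
  rewrite sin0 !subr0 => ->; rewrite mul1r normrM (ger0_norm s2).
  by rewrite ler_piMl// cos_max.
have : b ^+ 2 <= 2 * a ^+ 2 + s ^+ 2 / 2.
  have -> : b ^+ 2 = `|b| ^+ 2 by rewrite real_normK ?num_real.
  have -> : a ^+ 2 = `|a| ^+ 2 by rewrite real_normK ?num_real.
  apply: (@le_trans _ _ ((`|a| + s / 2) ^+ 2)).
    by apply: lerXn2r; rewrite ?nnegrE// addr_ge0// divr_ge0.
  by have := sqr_ge0 (`|a| - s / 2); rewrite !expr2; lra.
rewrite -/a -/b => hb.
have h1 : N%:R ^+ 2 * (4 * b ^+ 2) <= 2 * (N%:R ^+ 2 * (4 * a ^+ 2)) + 2 * (N%:R * s) ^+ 2.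
  rewrite exprMn; have := ler_wpM2l (exprn_ge0 2 (ler0n R N)) hb; lra.
have h2 : (N%:R * s) ^+ 2 <= H ^+ 2 by rewrite ler_pXn2r ?nnegrE.
have h3 : 0 <= N%:R ^+ 2 * (4 * a ^+ 2) by rewrite mulr_ge0 ?sqr_ge0 // mulr_ge0 ?sqr_ge0.
have h4 : 0 <= H ^+ 2 * (N%:R ^+ 2 * (4 * a ^+ 2)) by rewrite mulr_ge0 ?sqr_ge0.
by rewrite mulrDl !mulrDr !mulr1 -mulrA; lra.
Qed.

End KernelNorm.

(** * Alternating sums, quadrature and convolution *)

Section AlternatingSums.
Variable R : realType.
Notation tau := (2 * pi : R).
Implicit Types (A G F : R -> R) (p d lam : R) (n k : nat).

Let tau_gt0 : 0 < tau := tau_gt0 R.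
Hint Resolve tau_gt0 : core.

Definition bwd d G : R -> R := fun y => G y - G (y - d).

Definition alt_sum n lam F : R :=
  \sum_(0 <= k < n) (-1) ^+ k * F (lam + k%:R * (tau / n%:R)).

Definition grid_power p n lam G : R :=
  \sum_(0 <= k < n) `|G (lam + k%:R * (tau / n%:R))| `^ p.

Definition grid_sum n lam F : R :=
  tau / n%:R * \sum_(0 <= k < n) F (lam + k%:R * (tau / n%:R)).

Lemma periodic_bwd d G : is_periodic G -> is_periodic (bwd d G).
Proof. by move=> pG x; rewrite /bwd pG addrAC pG. Qed.

Lemma periodic_iter_bwd d G n : is_periodic G -> is_periodic (iter n (bwd d) G).
Proof. by move=> pG; elim: n => //= n; exact: periodic_bwd. Qed.

Lemma periodic_fwd d A : is_periodic A -> is_periodic (fwd d A).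
Proof. by move=> pA x; rewrite /fwd pA addrAC pA. Qed.

Lemma sum_shift_period (H : nat -> R) n : H n = H 0%N ->
  \sum_(0 <= k < n) H k.+1 = \sum_(0 <= k < n) H k.
Proof.
move=> Hn; apply/eqP; rewrite -subr_eq0 -sumrB telescope_sumr//.
by rewrite Hn subrr.
Qed.

Lemma grid_step n k lam : lam + k.+1%:R * (tau / n%:R) - tau / n%:R = lam + k%:R * (tau / n%:R).
Proof. by rewrite -[k.+1]addn1 natrD; ring. Qed.

Lemma grid_last n lam : (0 < n)%N ->
  lam + n%:R * (tau / n%:R) - tau / n%:R = lam + 0%:R * (tau / n%:R) - tau / n%:R + tau.
Proof. by move=> n0; field; rewrite pnatr_eq0 -lt0n. Qed.

(** A shift by one grid step flips every sign. With n even the signs also match across the period,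
    so the shifted sum is minus the original one. *)
Lemma alt_sum_bwd n lam F : (0 < n)%N -> ~~ odd n -> is_periodic F ->
  alt_sum n lam (bwd (tau / n%:R) F) = 2 * alt_sum n lam F.
Proof.
move=> n0 on pF; rewrite /alt_sum.
pose H k := (-1) ^+ k * F (lam + k%:R * (tau / n%:R) - tau / n%:R).
have HE : \sum_(0 <= k < n) H k.+1 = \sum_(0 <= k < n) H k.
  by apply: sum_shift_period; rewrite /H grid_last// pF -signr_odd (negbTE on).
have HS : \sum_(0 <= k < n) H k.+1 = - \sum_(0 <= k < n) (-1) ^+ k * F (lam + k%:R * (tau / n%:R)).
  by rewrite -sumrN; apply: eq_bigr => k _; rewrite /H grid_step exprS mulN1r mulNr.
transitivity (\sum_(0 <= k < n) ((-1) ^+ k * F (lam + k%:R * (tau / n%:R)) - H k)).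
  by apply: eq_bigr => k _; rewrite /bwd mulrBr.
by rewrite sumrB -HE HS; ring.
Qed.

Lemma grid_power_shift p n lam G : (0 < n)%N -> is_periodic G ->
  grid_power p n lam (fun y => G (y - tau / n%:R)) = grid_power p n lam G.
Proof.
move=> n0 pG; rewrite /grid_power.
pose H k := `|G (lam + k%:R * (tau / n%:R) - tau / n%:R)| `^ p.
rewrite -(@sum_shift_period H); last by rewrite /H grid_last// pG.
by apply: eq_bigr => k _; rewrite /H grid_step.
Qed.

Lemma grid_power_ge0 p n lam G : 0 <= grid_power p n lam G.
Proof. by apply: sumr_ge0 => k _; exact: powR_ge0. Qed.

Lemma grid_power_bwd p n lam G : 0 < p -> p <= 1 -> (0 < n)%N -> is_periodic G ->
  grid_power p n lam (bwd (tau / n%:R) G) <= 2 * grid_power p n lam G.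
Proof.
move=> p0 p1 n0 pG; rewrite [leRHS](_ : _ = grid_power p n lam G + grid_power p n lam G); last by ring.
rewrite -{2}(grid_power_shift p lam n0 pG) -big_split/=.
apply: ler_sum => k _; apply: le_trans (powR_subadditive p0 p1 (normr_ge0 _) (normr_ge0 _)).
by apply: le_powRl; rewrite ?(ltW p0)// /bwd ler_normB.
Qed.

Lemma measurable_fwd d A : measurable_fun setT A -> measurable_fun setT (fwd d A).
Proof.
by move=> mA; apply: measurable_funB => //; apply: measurableT_comp => //; exact: measurable_shift.
Qed.

Lemma measurable_iter_fwd d A n : measurable_fun setT A -> measurable_fun setT (iter n (fwd d) A).
Proof. by move=> mA; elim: n => //= n; exact: measurable_fwd. Qed.

Lemma measurable_bwd d A : measurable_fun setT A -> measurable_fun setT (bwd d A).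
Proof.
by move=> mA; apply: measurable_funB => //; apply: measurableT_comp => //; exact: measurable_shift.
Qed.

Lemma measurable_iter_bwd d A n : measurable_fun setT A -> measurable_fun setT (iter n (bwd d) A).
Proof. by move=> mA; elim: n => //= n; exact: measurable_bwd. Qed.

Lemma iter_fwd_shift d A n c : iter n (fwd d) (fun x => A (x + c)) = fun x => iter n (fwd d) A (x + c).
Proof. by elim: n => //= n ->; apply/funext => x; rewrite /fwd addrAC. Qed.

Lemma measurable_alt_sum n lam A G : measurable_fun setT A ->
  measurable_fun setT (fun x : R => alt_sum n lam (fun y => A (x - y) * G y)).
Proof.
move=> mA; apply: measurable_sum => k; apply: measurable_funM => //; apply: measurable_funM => //.
by apply: measurableT_comp => //; exact: measurable_shift.
Qed.

Lemma Np_grid_le p n lam A G (c : nat -> R) (a : R) : 0 < p -> p <= 1 ->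
  measurable_fun setT A -> is_periodic A -> (forall k, `|c k| = 1) -> (Np p A <= a%:E)%E ->
  (Np p (fun x => \sum_(0 <= k < n) c k * (A (x - (lam + k%:R * (tau / n%:R))) *
     G (lam + k%:R * (tau / n%:R))))%R <= (a * grid_power p n lam G)%:E)%E.
Proof.
move=> p0 p1 mA pA c1 Aa.
have mk k : measurable_fun setT (fun x : R => A (x - (lam + k%:R * (tau / n%:R)))).
  by apply: measurableT_comp => //; exact: measurable_shift.
apply: le_trans (Np_sum _ p0 p1 _) _.
  by move=> k; apply: measurable_funM => //; apply: measurable_funM.
rewrite /grid_power mulr_sumr -sumEFin; apply: lee_sum => k _.
rewrite (eq_Np p (v := fun x => (c k * G (lam + k%:R * (tau / n%:R))) *
   A (x - (lam + k%:R * (tau / n%:R))))); last by move=> x; ring.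
rewrite NpZ// (Np_shift p (- _) mA pA) normrM c1 mul1r (mulrC a) EFinM.
by rewrite lee_wpmul2l// lee_fin powR_ge0.
Qed.

(* Summation by parts moves each difference onto either the kernel or the function. *)
Lemma Np_alt_sum p n i j lam A G a a' : 0 < p -> p <= 1 -> (0 < n)%N -> ~~ odd n ->
  measurable_fun setT A -> is_periodic A -> is_periodic G ->
  (Np p A <= a%:E)%E -> (Np p (iter i (fwd (tau / n%:R)) A) <= a'%:E)%E ->
  (Np p (fun x => alt_sum n lam (fun y => (A (x - y) * G y)%R)) <=
   (3 ^+ (i + j) * (a' * grid_power p n lam G +
      a * grid_power p n lam (iter j (bwd (tau / n%:R)) G)))%:E)%E.
Proof.
move=> p0 p1 n0 on; set d := tau / n%:R.
have ge0 u b : (Np p u <= b%:E)%E -> 0 <= b by move=> h; rewrite -lee_fin (le_trans (Np_ge0 p u)).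
have base A' G' b : measurable_fun setT A' -> is_periodic A' -> (Np p A' <= b%:E)%E ->
    (Np p (fun x => alt_sum n lam (fun y => (A' (x - y) * G' y)%R)) <= (b * grid_power p n lam G')%:E)%E.
  by move=> mA' pA' Ab; apply: Np_grid_le => // k; rewrite normrX normrN1 expr1n.
have exp3 k : 1 <= 3 ^+ k :> R by rewrite exprn_ege1// ler1n.
elim: i j A G a a' => [|i IHi] j A G a a' mA pA pG Aa Aa'.
  have a'0 := ge0 _ _ Aa'; have a0 := ge0 _ _ Aa.
  apply: le_trans (base _ _ _ mA pA Aa') _; rewrite lee_fin.
  have h1 := mulr_ge0 a'0 (grid_power_ge0 p n lam G).
  have h2 := mulr_ge0 a0 (grid_power_ge0 p n lam (iter j (bwd d) G)).
  rewrite -[leLHS]mul1r; apply: ler_pM => //; lra.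
elim: j A G a a' mA pA pG Aa Aa' => [|j IHj] A G a a' mA pA pG Aa Aa'.
  have a'0 := ge0 _ _ Aa'; have a0 := ge0 _ _ Aa.
  apply: le_trans (base _ _ _ mA pA Aa) _; rewrite lee_fin.
  have h1 := mulr_ge0 a'0 (grid_power_ge0 p n lam G).
  have h2 := mulr_ge0 a0 (grid_power_ge0 p n lam G).
  rewrite -[leLHS]mul1r; apply: ler_pM => //=; lra.
have a'0 := ge0 _ _ Aa'; have a0 := ge0 _ _ Aa.
have msh : measurable_fun setT (fun x : R => A (x + d)).
  by apply: measurableT_comp => //; exact: measurable_shift.
have psh : is_periodic (fun x => A (x + d)) by exact: is_periodic_shift.
(* Discrete Leibniz rule for the backward difference in y of A(x - y) G(y): a forward difference of
   the kernel, or a backward difference of the function against a translated kernel. *)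
have split2 x : 2 * alt_sum n lam (fun y => A (x - y) * G y) =
    - alt_sum n lam (fun y => fwd d A (x - y) * G y) +
    alt_sum n lam (fun y => (A (x - y + d)) * bwd d G y).
  rewrite -alt_sum_bwd//; last by move=> y; rewrite pG opprD addrA -(pA (x - y - tau)) subrK.
  rewrite /alt_sum -sumrN -big_split/=; apply: eq_bigr => k _.
  rewrite /bwd /fwd -/d; set y := lam + _.
  by rewrite (_ : x - (y - d) = x - y + d); ring.
apply: (@le_trans _ _ (Np p (fun x => alt_sum n lam (fun y => (fwd d A (x - y) * G y)%R))
    + Np p (fun x => alt_sum n lam (fun y => (A (x - y + d) * bwd d G y)%R)))%E).
  have m1 := @measurable_alt_sum n lam (fwd d A) G (measurable_fwd d mA).
  have m2 := @measurable_alt_sum n lam (fun x => A (x + d)) (bwd d G) msh.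
  rewrite -(NpN p (fun x => alt_sum n lam (fun y => (fwd d A (x - y) * G y)%R))).
  apply: le_trans (NpD p0 p1 _ m2); last exact: measurable_funN.
  apply: le_Np; [exact: ltW|exact: measurable_alt_sum| |].
    by apply: measurable_funD => //; exact: measurable_funN.
  (* The gain of one half from the alternating sum is given up here. *)
  move=> x; rewrite -split2 normrM ger0_norm//.
  by rewrite ler_peMl// ler1n.
have Af : (Np p (fwd d A) <= (2 * a)%:E)%E.
  rewrite (_ : 2 * a = a + a); last by ring.
  rewrite EFinD; apply: le_trans (leeD Aa Aa).
  rewrite -{1}(Np_shift p d mA pA) -(NpN p A).
  by apply: NpD => //; exact: measurable_funN.
have H1 := IHi j.+1 (fwd d A) G (2 * a) a' (measurable_fwd d mA) (periodic_fwd d pA) pG Af.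
have H2 := IHj (fun x => A (x + d)) (bwd d G) a a' msh psh (periodic_bwd d pG).
rewrite Np_shift// in H2; rewrite iter_fwd_shift Np_shift// in H2; last 2 first.
- exact: measurable_iter_fwd.
- by elim: (i.+1) => //= k; exact: periodic_fwd.
rewrite -iterSr in H1; apply: le_trans (leeD (H1 Aa') (H2 Aa Aa')) _.
rewrite -EFinD lee_fin -iterSr.
have h1 := grid_power_bwd lam p0 p1 n0 pG; rewrite -/d in h1.
set P0 := grid_power p n lam G in h1 *; set P1 := grid_power p n lam (bwd d G) in h1 *.
set Pj := grid_power p n lam (iter j.+1 (bwd d) G).
rewrite !addSn !addnS -mulrDr; set e := 3 ^+ (i + j).+1.
rewrite (_ : 3 ^+ (i + j).+2 = 3 * e); last by rewrite exprS.
have e0 : 0 <= e by rewrite exprn_ge0.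
(* Source of the 3 per step: the difference of G has at most twice the grid power of G, and the
   difference of A at most twice the bound of A; adding the other branch makes 3 in both terms. *)
have inner : a' * P0 + 2 * a * Pj + (a' * P1 + a * Pj) <= 3 * (a' * P0 + a * Pj).
  by have := ler_wpM2l a'0 h1; lra.
apply: le_trans (ler_wpM2l e0 inner) _.
by rewrite le_eqVlt; apply/orP; left; apply/eqP; ring.
Qed.

Lemma alt_sum_double n (F : nat -> R) :
  \sum_(0 <= k < n.*2) (-1) ^+ k * F k =
  2 * (\sum_(0 <= k < n) F k.*2) - \sum_(0 <= k < n.*2) F k.
Proof.
elim: n => [|n IH]; first by rewrite !big_nil; ring.
rewrite doubleS !big_nat_recr//= IH exprS -signr_odd odd_double/=.
by rewrite expr0; ring.
Qed.

(** The coarse nodes are the even nodes of the fine grid, so subtracting the two quadratures leaves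
    alternating signs. *)
Lemma grid_sum_refine n lam F : (0 < n)%N ->
  grid_sum n.*2 lam F - grid_sum n lam F = - (tau / n.*2%:R) * alt_sum n.*2 lam F.
Proof.
move=> n0; have nn : n.*2%:R = 2 * n%:R :> R by rewrite -mul2n natrM.
have n0' : n%:R != 0 :> R by rewrite pnatr_eq0 -lt0n.
rewrite /grid_sum /alt_sum (alt_sum_double n (fun k => F (lam + k%:R * (tau / n.*2%:R)))).
have -> : \sum_(0 <= k < n) F (lam + k%:R * (tau / n%:R)) =
    \sum_(0 <= k < n) F (lam + k.*2%:R * (tau / n.*2%:R)).
  apply: eq_bigr => k _; have kk : k.*2%:R = 2 * k%:R :> R by rewrite -mul2n natrM.
  by congr (F (lam + _)); rewrite nn kk; field.
set a := \sum_(_ <= _ < _) _; set b := \sum_(_ <= _ < _) _.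
by rewrite nn; field.
Qed.

End AlternatingSums.

(** * Convolution compared with offset quadrature sums *)

Section Convolution.
Variable R : realType.
Notation mu := (@lebesgue_measure R).
Notation tau := (2 * pi : R).
Implicit Types (A G F u : R -> R) (p d lam : R) (n k l : nat).

Let tau_gt0 : 0 < tau := tau_gt0 R.
Hint Resolve tau_gt0 : core.
Let mC : measurable (circle R) := @measurable_circle R.
Hint Resolve mC : core.

Lemma itv_co_split (a b c : R) : a <= b -> b <= c ->
  `[a, c[%classic = `[a, b[%classic `|` `[b, c[%classic.
Proof. by move=> ab bc; apply/seteqP; split=> x /=; rewrite !in_itv/=; lra. Qed.

Lemma itv_co_disj (a b c : R) : [disjoint `[a, b[%classic & `[b, c[%classic].
Proof. by apply/disj_setPS => x [] /=; rewrite !in_itv/=; lra. Qed.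

Lemma measurable_shiftl (c : R) : measurable_fun setT (fun s : R => c + s).
Proof. by apply: measurable_funD => //; exact: measurable_cst. Qed.

Definition conv A G x : R := \int[mu]_(y in circle R) (A (x - y) * G y).

Definition cell n : set R := `[0, tau / n%:R[%classic.

Lemma measurable_cell n : measurable (cell n).
Proof. exact: measurable_itv. Qed.
Hint Resolve measurable_cell : core.

Lemma mu_cell n : (0 < n)%N -> mu (cell n) = (tau / n%:R)%:E.
Proof.
by move=> n0; rewrite /cell lebesgue_measure_itv/= lte_fin divr_gt0 ?ltr0n// oppr0 adde0.
Qed.

Lemma integral_cell_cst n (c : R) : (0 < n)%N ->
  (\int[mu]_(s in cell n) c%:E)%E = (c * (tau / n%:R))%:E.
Proof.
by move=> n0; rewrite EFinM -(mu_cell n0); exact: (integral_cst mu (measurable_cell n) c%:E).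
Qed.

Lemma cell_integrable_cst n (c : R) : (0 < n)%N -> mu.-integrable (cell n) (EFin \o (fun=> c)).
Proof.
move=> n0; apply/integrableP; split; first exact: measurable_cst.
by have /= -> := @integral_cell_cst n `|c| n0; rewrite ltry.
Qed.

Lemma circle_partition (h : R -> \bar R) n lam : (0 < n)%N ->
  measurable_fun setT h -> (forall x, (0 <= h x)%E) -> is_periodic h ->
  (\int[mu]_(x in circle R) h x =
   \sum_(0 <= k < n) \int[mu]_(s in cell n) h (lam + k%:R * (tau / n%:R) + s)%R)%E.
Proof.
move=> n0 mh h0 ph; rewrite -(circle_integral_shift lam mh h0 ph).
set d := tau / n%:R; have d0 : 0 < d by rewrite divr_gt0 ?ltr0n.
have mhl : measurable_fun setT (fun x : R => h (x + lam)).
  by apply: measurableT_comp => //; exact: measurable_shift.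
suff H m : (\int[mu]_(x in `[0%R, (m%:R * d)%R[) h (x + lam)%R =
    \sum_(0 <= k < m) \int[mu]_(s in cell n) h (lam + k%:R * d + s)%R)%E.
  rewrite -H; apply: eq_integral_dom.
  by rewrite /circle /d mulrCA mulfV ?mulr1// pnatr_eq0 -lt0n.
elim: m => [|m IH]; first by rewrite big_nil mul0r set_itv_ge ?integral_set0// bnd_simp ltxx.
rewrite big_nat_recr//= -IH.
have md0 : 0 <= m%:R * d by rewrite mulr_ge0// ltW.
have mdS : m.+1%:R * d = m%:R * d + d by rewrite -natr1 mulrDl mul1r.
rewrite (eq_integral_dom _ (itv_co_split md0 (_ : _ <= m.+1%:R * d))); last first.
  by rewrite mdS lerDl ltW.
rewrite ge0_integral_setU//; last 2 first.
- exact: measurable_funS mhl.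
- exact: itv_co_disj.
congr (_ + _)%E.
rewrite -[LHS](@ge0_integral_shift _ (m%:R * d) _ (fun x => h (x + lam)))//.
rewrite (@eq_integral_dom _ _ (cell n)).
  by apply: eq_integral => x _; congr h; ring.
rewrite /cell -/d mdS; move: (m%:R * d) => c.
by apply/seteqP; split=> x /=; rewrite !in_itv/=; lra.
Qed.

Lemma periodic_norm u : is_periodic u -> is_periodic (fun x => `|u x|).
Proof. by move=> pu x; rewrite pu. Qed.

Lemma cell_integrable n lam u k : (k < n)%N -> measurable_fun setT u -> is_periodic u ->
  (Np 1 u < +oo)%E ->
  mu.-integrable (cell n) (EFin \o (fun s => u (lam + k%:R * (tau / n%:R) + s))).
Proof.
move=> kn mu_ pu fu; have n0 : (0 < n)%N by exact: leq_ltn_trans kn.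
have mk : measurable_fun setT (fun s : R => u (lam + k%:R * (tau / n%:R) + s)).
  apply: measurableT_comp => //; exact: measurable_shiftl.
apply/integrableP; split; first by apply/measurable_EFinP; exact: measurable_funTS.
apply: le_lt_trans fu; rewrite Np1E (@circle_partition _ n lam)//; last first.
- by move=> x; rewrite pu.
- by apply: measurableT_comp => //; exact/measurable_EFinP.
rewrite (bigD1_seq k) ?iota_uniq//= ?mem_index_iota//.
by rewrite leeDl// sume_ge0// => i _; exact: integral_ge0.
Qed.

(** The nonnegative case is applied to u + |u| and to |u|, and the results are subtracted. *)
Lemma Rcircle_partition u n lam : (0 < n)%N -> measurable_fun setT u -> is_periodic u ->
  (Np 1 u < +oo)%E ->
  \int[mu]_(x in circle R) u x =
  \sum_(0 <= k < n) \int[mu]_(s in cell n) u (lam + k%:R * (tau / n%:R) + s).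
Proof.
move=> n0.
have pos v : measurable_fun setT v -> is_periodic v -> (Np 1 v < +oo)%E -> (forall x, 0 <= v x) ->
    \int[mu]_(x in circle R) v x =
    \sum_(0 <= k < n) \int[mu]_(s in cell n) v (lam + k%:R * (tau / n%:R) + s).
  move=> mv pv fv v0; rewrite /Rintegral (@circle_partition _ n lam)//;
    try exact/measurable_EFinP; try (by move=> x; rewrite pv).
  rewrite !big_mkord sum_fine// => k _; apply: integrable_fin_num => //.
    exact: measurable_cell.
  exact: (@cell_integrable n lam v k (ltn_ord k) mv pv fv).
move=> mu_ pu fu.
have mn : measurable_fun setT (fun x => `|u x|) by exact: measurableT_comp.
have fn : (Np 1 (fun x => `|u x|%R) < +oo)%E.
  by apply: le_lt_trans fu; apply: le_Np => // x; rewrite normr_id.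
have ms : measurable_fun setT (fun x => u x + `|u x|) by exact: measurable_funD.
have ps : is_periodic (fun x => u x + `|u x|) by move=> x; rewrite pu.
have fs : (Np 1 (fun x => u x + `|u x|)%R < +oo)%E.
  apply: le_lt_trans (NpD ltr01 (lexx 1) mu_ mn) _; exact: lte_add_pinfty fu fn.
have -> : \int[mu]_(x in circle R) u x =
    \int[mu]_(x in circle R) ((u x + `|u x|) - `|u x|).
  by apply: eq_Rintegral => x _; rewrite addrK.
have is0 := proj2 (circle_integrableP ms) fs.
have in0 := proj2 (circle_integrableP mn) fn.
rewrite RintegralB; [|exact: measurable_circle|exact: is0|exact: in0].
rewrite (pos _ ms ps fs) => [|x]; last first.
  by have := ler_norm (- u x); rewrite normrN; lra.
rewrite (pos _ mn (periodic_norm pu) fn)// -sumrB.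
apply: eq_big_nat => k /andP[_ kn].
have is_ := cell_integrable lam kn ms ps fs.
have in_ := cell_integrable lam kn mn (periodic_norm pu) fn.
rewrite -RintegralB; [|exact: measurable_cell|exact: is_|exact: in_].
by apply: eq_Rintegral => x _; rewrite addrK.
Qed.

(** Measures how far one node value represents G on its cell. Pointwise it need not be small; its
    average over the circle is, by continuity of translation in L_1. *)
Definition cell_oscillation n G x : \bar R :=
  (\int[mu]_(s in cell n) `|G (x + s) - G x|%:E)%E.

Lemma measurable_cell_oscillation n G : measurable_fun setT G ->
  measurable_fun setT (cell_oscillation n G).
Proof.
move=> mG; pose f (z : R * R) : \bar R := (\1_(cell n) z.2 * `|G (z.1 + z.2) - G z.1|)%:E.
have mf : measurable_fun setT f.
  apply/measurable_EFinP; apply: measurable_funM.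
    apply: measurableT_comp; [exact: measurable_indic|exact: measurable_snd].
  apply: measurableT_comp => //; apply: measurable_funB.
    apply: measurableT_comp => //.
    by apply: measurable_funD; [exact: measurable_fst|exact: measurable_snd].
  by apply: measurableT_comp => //; exact: measurable_fst.
have f0 z : (0 <= f z)%E by rewrite lee_fin mulr_ge0.
have := @measurable_fun_fubini_tonelli_F _ _ _ _ R mu f mf f0.
congr (measurable_fun _ _); apply/funext => x; rewrite /fubini_F /cell_oscillation.
rewrite [RHS]integral_mkcond; apply: eq_integral => y _.
rewrite patchE /f/= indicE; case: ifPn => yD; first by rewrite mul1r.
by rewrite mul0r.
Qed.

Lemma measurable_Np1_translate G : measurable_fun setT G ->
  measurable_fun setT (fun s => Np 1 (fun x => G (x + s) - G x)).
Proof.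
move=> mG; pose f (z : R * R) : \bar R := (\1_(circle R) z.1 * `|G (z.1 + z.2) - G z.1|)%:E.
have mf : measurable_fun setT f.
  apply/measurable_EFinP; apply: measurable_funM.
    apply: measurableT_comp; [exact: measurable_indic|exact: measurable_fst].
  apply: measurableT_comp => //; apply: measurable_funB.
    apply: measurableT_comp => //.
    by apply: measurable_funD; [exact: measurable_fst|exact: measurable_snd].
  by apply: measurableT_comp => //; exact: measurable_fst.
have f0 z : (0 <= f z)%E by rewrite lee_fin mulr_ge0.
have := @measurable_fun_fubini_tonelli_G _ _ _ _ R mu f mf f0.
congr (measurable_fun _ _); apply/funext => s; rewrite /fubini_G Np1E.
rewrite [RHS]integral_mkcond; apply: eq_integral => x _.
rewrite patchE /f/= indicE; case: ifPn => xC; first by rewrite mul1r.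
by rewrite mul0r.
Qed.

Lemma integral_cell_oscillation n G e : (0 < n)%N -> measurable_fun setT G -> 0 <= e ->
  (forall s, 0 <= s <= tau / n%:R -> (Np 1 (fun x => G (x + s) - G x)%R <= e%:E)%E) ->
  (\int[mu]_(x in circle R) cell_oscillation n G x <= (tau / n%:R * e)%:E)%E.
Proof.
move=> n0 mG e0 Ge.
have := @circle_tonelli _ (cell n) (fun=> 1) G (measurable_cell n) (measurable_cst _)
  (fun=> ler01) mG.
under eq_integral do under eq_integral do rewrite mul1r.
move=> ->; under eq_integral do rewrite mul1e.
apply: (@le_trans _ _ (\int[mu]_(x in cell n) e%:E)%E); last first.
  by rewrite integral_cell_cst// mulrC.
apply: ge0_le_integral => //; try exact: measurable_cell.
- by move=> s _; exact: Np_ge0.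
- by apply: measurable_funTS; exact: measurable_Np1_translate.
- by move=> s; rewrite /cell/= in_itv/= => /andP[s0 sd]; rewrite Ge// s0 ltW.
Qed.

(** On each cell the error splits into the oscillation of G against the supremum of A, and the
    Lipschitz bound of A against the node value of G. *)
Lemma conv_grid_sum_le A G n lam B B' x : (0 < n)%N ->
  measurable_fun setT A -> is_periodic A -> (forall y, `|A y| <= B) ->
  (forall y s, 0 <= s -> `|A (y - s) - A y| <= B' * s) ->
  measurable_fun setT G -> is_periodic G -> (Np 1 G < +oo)%E ->
  (`|conv A G x - grid_sum n lam (fun y => A (x - y) * G y)|%:E <=
   \sum_(0 <= k < n) (B%:E * cell_oscillation n G (lam + k%:R * (tau / n%:R))%R +
     (B' * (tau / n%:R) ^+ 2)%:E * `|G (lam + k%:R * (tau / n%:R))%R|%:E))%E.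
Proof.
move=> n0 mA pA AB AB' mG pG fG.
have B0 : 0 <= B by exact: le_trans (AB 0).
have B'0 : 0 <= B' by have := AB' 0 1 ler01; rewrite mulr1; exact: le_trans.
set d := tau / n%:R; have d0 : 0 < d by rewrite divr_gt0 ?ltr0n.
pose F y := A (x - y) * G y.
have mAx : measurable_fun setT (fun y : R => A (x - y)).
  by apply: measurableT_comp => //; apply: measurable_funB => //; exact: measurable_cst.
have mF : measurable_fun setT F by exact: measurable_funM.
have pF : is_periodic F.
  by move=> y; rewrite /F pG -(pA (x - (y + tau))); congr (A _ * _); ring.
have fF : (Np 1 F < +oo)%E.
  apply: (@le_lt_trans _ _ (Np 1 (fun y => B * G y)%R)).
    apply: le_Np => //; first exact: measurable_funM.
    by move=> y; rewrite !normrM (ger0_norm B0) ler_wpM2r.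
  by rewrite NpZ// powRr1// lte_mul_pinfty.
rewrite /conv (Rcircle_partition lam n0 mF pF fF) /grid_sum mulr_sumr -sumrB -/d.
apply: (@le_trans _ _ (\sum_(0 <= k < n) `|\int[mu]_(s in cell n) F (lam + k%:R * d + s)
   - d * F (lam + k%:R * d)|%:E)%E).
  by rewrite sumEFin lee_fin ler_norm_sum.
rewrite big_nat_cond [leRHS]big_nat_cond; apply: lee_sum => k /andP[/andP[_ kn] _].
set y := lam + _.
have -> : d * F y = \int[mu]_(s in cell n) F y.
  by rewrite /Rintegral integral_cell_cst//= mulrC.
have iF := cell_integrable lam kn mF pF fF; rewrite -/d -/y in iF.
have iG := cell_integrable lam kn mG pG fG; rewrite -/d -/y in iG.
have icst (c : R) : mu.-integrable (cell n) (EFin \o (fun=> c)).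
  exact: cell_integrable_cst.
rewrite -RintegralB//; try exact: measurable_cell.
have mFs : measurable_fun setT (fun s : R => F (y + s)).
  apply: measurableT_comp => //; exact: measurable_shiftl.
have mGs : measurable_fun setT (fun s : R => G (y + s)).
  apply: measurableT_comp => //; exact: measurable_shiftl.
have iFB : mu.-integrable (cell n) (EFin \o (fun s => F (y + s) - F y)).
  by apply: (integrableB _ iF (icst (F y))); exact: measurable_cell.
rewrite EFin_normr_Rintegral; [|exact: measurable_cell|exact: iFB].
apply: le_trans (le_abse_integral _ _ _) _; first exact: measurable_cell.
  by apply: (measurable_int mu).
have mGd : measurable_fun (cell n) (fun s : R => `|G (y + s) - G y|%:E).
  apply: measurable_funTS; apply/measurable_EFinP; apply: measurableT_comp => //.
  by apply: measurable_funB.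
apply: (@le_trans _ _ (\int[mu]_(s in cell n) (B%:E * `|G (y + s) - G y|%:E
    + (B' * d * `|G y|)%:E))%E).
  apply: ge0_le_integral => //; try exact: measurable_cell.
  - by apply: measurableT_comp => //; apply: (measurable_int mu); exact: iFB.
  - by apply: emeasurable_funD => //; exact: measurable_funeM.
  - move=> s; rewrite /cell/= in_itv/= => /andP[s0 sd].
    rewrite -EFinM -EFinD lee_fin /F.
    have -> : A (x - (y + s)) * G (y + s) - A (x - y) * G y =
      A (x - (y + s)) * (G (y + s) - G y) + (A (x - y - s) - A (x - y)) * G y.
      by rewrite opprD addrA; ring.
    apply: le_trans (ler_normD _ _) _; rewrite !normrM lerD// ler_wpM2r//.
    by apply: le_trans (AB' _ _ s0) _; rewrite ler_wpM2l// ltW.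
rewrite ge0_integralD//; try exact: measurable_cell; try exact: measurable_funeM;
  try (by move=> s _; rewrite -EFinM lee_fin mulr_ge0);
  try (by move=> s _; rewrite lee_fin mulr_ge0 // mulr_ge0 // ltW).
rewrite leeD//.
  by rewrite ge0_integralZl//; exact: measurable_cell.
rewrite integral_cell_cst// -!EFinM lee_fin.
by rewrite -/d le_eqVlt; apply/orP; left; apply/eqP; ring.
Qed.

Lemma sume_cst n (x : \bar R) : (0 <= x)%E -> (\sum_(0 <= k < n) x = n%:R%:E * x)%E.
Proof.
move=> x0; elim: n => [|n IH]; first by rewrite big_nil mul0e.
by rewrite big_nat_recr//= IH -natr1 EFinD ge0_muleDl// mul1e.
Qed.

(** As the offset runs over a period, each of the n nodes sweeps the whole circle. *)
Lemma integral_grid_power p n G : measurable_fun setT G -> is_periodic G ->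
  (\int[mu]_(lam in circle R) (grid_power p n lam G)%:E = n%:R%:E * Np p G)%E.
Proof.
move=> mG pG; under eq_integral do rewrite /grid_power -sumEFin.
rewrite ge0_integral_sum//.
- rewrite (eq_bigr (fun=> Np p G)) => [|k _].
    by rewrite sume_cst// Np_ge0.
  under eq_integral do rewrite -[X in G X]addrC.
  rewrite -[RHS](Np_shift p (k%:R * (tau / n%:R)) mG pG).
  by apply: eq_integral => x _; rewrite addrC.
- move=> k; apply: measurable_powR_norm; apply: measurableT_comp => //.
  exact: measurable_shift.
Qed.

Lemma measurable_grid_power p n G : measurable_fun setT G ->
  measurable_fun setT (fun lam : R => grid_power p n lam G).
Proof.
move=> mG; apply: measurable_sum => k; apply/measurable_EFinP.
by apply: measurable_powR_norm; apply: measurableT_comp => //; exact: measurable_shift.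
Qed.

Lemma measurable_conv_grid A G n lam : measurable_fun setT A ->
  measurable_fun setT (fun x : R => grid_sum n lam (fun y => A (x - y) * G y)).
Proof.
move=> mA; apply: measurable_funM => //; apply: measurable_sum => k.
apply: measurable_funM => //; apply: measurableT_comp => //; exact: measurable_shift.
Qed.

Lemma two_pow_double l : (2 ^ l.+1)%N = (2 ^ l).*2.
Proof. by rewrite expnS mul2n. Qed.

Section DyadicGrid.
Variables (p : R) (m l0 : nat) (A G : R -> R) (a : R) (a' : nat -> R).
Hypotheses (p0 : 0 < p) (p1 : p <= 1).
Hypotheses (mA : measurable_fun setT A) (pA : is_periodic A).
Hypotheses (mG : measurable_fun setT G) (pG : is_periodic G).
Notation delta l := (tau / (2 ^ l)%N%:R).
Hypothesis Aa : (Np p A <= a%:E)%E.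
Hypothesis Aa' : forall l, (l0 < l)%N -> (Np p (iter m (fwd (delta l)) A) <= (a' l)%:E)%E.

Let a0 : 0 <= a. Proof. by rewrite -lee_fin (le_trans (Np_ge0 p A)). Qed.
Let a'0 l : (l0 < l)%N -> 0 <= a' l.
Proof. by move=> h; rewrite -lee_fin (le_trans (Np_ge0 p _) (Aa' h)). Qed.

(** The telescoped quadrature sums: the coarsest grid is estimated term by term, and each refinement
    adds one alternating sum, with up to [m] differences placed on either factor. *)
Definition dyadic_bound L lam : R :=
  delta l0 `^ p * (a * grid_power p (2 ^ l0) lam G) +
  \sum_(l0 <= l < L) delta l.+1 `^ p * (3 ^+ (m + m) *
    (a' l.+1 * grid_power p (2 ^ l.+1) lam G +
     a * grid_power p (2 ^ l.+1) lam (iter m (bwd (delta l.+1)) G))).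

Lemma Np_grid_sum_le L lam : (l0 <= L)%N ->
  (Np p (fun x => grid_sum (2 ^ L) lam (fun y => (A (x - y) * G y)%R)) <=
   (dyadic_bound L lam)%:E)%E.
Proof.
move=> l0L; rewrite -(subnKC l0L); elim: (L - l0)%N => [|k IH].
  rewrite addn0 /dyadic_bound big_geq// addr0 /grid_sum NpZ; last first.
    apply: measurable_sum => k; apply: measurable_funM => //; apply: measurableT_comp => //.
    exact: measurable_shift.
  rewrite ger0_norm ?divr_ge0 ?(ltW tau_gt0)// EFinM lee_wpmul2l ?lee_fin ?powR_ge0//.
  have := @Np_grid_le R p (2 ^ l0) lam A G (fun=> 1) a p0 p1 mA pA (fun=> normr1 _) Aa.
  by under eq_Np do under eq_bigr do rewrite mul1r.
rewrite addnS; set l := (l0 + k)%N in IH *.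
have n0 : (0 < 2 ^ l)%N by rewrite expn_gt0.
have -> : dyadic_bound l.+1 lam = dyadic_bound l lam +
    delta l.+1 `^ p * (3 ^+ (m + m) *
    (a' l.+1 * grid_power p (2 ^ l.+1) lam G +
     a * grid_power p (2 ^ l.+1) lam (iter m (bwd (delta l.+1)) G))).
  by rewrite /dyadic_bound big_nat_recr ?leq_addr//= addrA.
rewrite (eq_Np p (v := fun x => grid_sum (2 ^ l) lam (fun y => A (x - y) * G y) +
   - (delta l.+1) * alt_sum (2 ^ l.+1) lam (fun y => A (x - y) * G y))); last first.
  by move=> x; rewrite two_pow_double -grid_sum_refine// addrC subrK.
rewrite EFinD; apply: le_trans (NpD p0 p1 _ _) _.
- exact: measurable_conv_grid.
- by apply: measurable_funM => //; exact: measurable_alt_sum.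
apply: leeD => //; rewrite NpZ; last exact: measurable_alt_sum.
rewrite normrN ger0_norm ?divr_ge0 ?(ltW tau_gt0)// EFinM lee_wpmul2l ?lee_fin ?powR_ge0//.
apply: Np_alt_sum => //; first by rewrite expn_gt0.
  by rewrite two_pow_double odd_double.
by apply: Aa'; rewrite ltnS leq_addr.
Qed.

Lemma dyadic_bound_ge0 L lam : 0 <= dyadic_bound L lam.
Proof.
rewrite addr_ge0 ?mulr_ge0 ?powR_ge0 ?grid_power_ge0//.
rewrite big_nat_cond sumr_ge0// => l /andP[/andP[l0l _] _].
by rewrite mulr_ge0 ?powR_ge0// mulr_ge0 ?exprn_ge0// addr_ge0// mulr_ge0 ?grid_power_ge0// a'0.
Qed.

Lemma measurable_dyadic_bound L : measurable_fun setT (dyadic_bound L).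
Proof.
apply: measurable_funD.
  apply: measurable_funM => //; apply: measurable_funM => //; exact: measurable_grid_power.
apply: measurable_sum => l; apply: measurable_funM => //; apply: measurable_funM => //.
apply: measurable_funD; apply: measurable_funM => //; first exact: measurable_grid_power.
by apply: measurable_grid_power; exact: measurable_iter_bwd.
Qed.

Lemma integral_dyadic_bound L (g0 : R) (g : nat -> R) : (l0 <= L)%N ->
  (Np p G <= g0%:E)%E ->
  (forall l, (l0 < l)%N -> (Np p (iter m (bwd (delta l)) G) <= (g l)%:E)%E) ->
  (\int[mu]_(lam in circle R) (dyadic_bound L lam)%:E <=
   (delta l0 `^ p * (a * ((2 ^ l0)%N%:R * g0)) +
    \sum_(l0 <= l < L) delta l.+1 `^ p * (3 ^+ (m + m) *
      ((2 ^ l.+1)%N%:R * (a' l.+1 * g0 + a * g l.+1))))%:E)%E.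
Proof.
move=> l0L Gg0 Gg; rewrite -(subnKC l0L); elim: (L - l0)%N => [|k IH].
  rewrite addn0 big_geq// addr0 /dyadic_bound.
  under eq_integral do rewrite big_geq// addr0 mulrA EFinM.
  rewrite ge0_integralZl//; last 3 first.
  - by apply: measurable_funTS; apply/measurable_EFinP; exact: measurable_grid_power.
  - by move=> x _; rewrite lee_fin grid_power_ge0.
  - by rewrite lee_fin mulr_ge0 ?powR_ge0.
  rewrite integral_grid_power// [leRHS](_ : _ =
    ((delta l0 `^ p * a)%:E * ((2 ^ l0)%N%:R%:E * g0%:E))%E); last first.
    by rewrite -!EFinM mulrA.
  by rewrite lee_wpmul2l ?lee_fin ?mulr_ge0 ?powR_ge0// lee_wpmul2l ?lee_fin.
rewrite addnS; set l := (l0 + k)%N in IH *.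
have l0l : (l0 < l.+1)%N by rewrite ltnS leq_addr.
have a'l := a'0 l0l.
rewrite big_nat_recr ?leq_addr//= addrA EFinD.
pose c := delta l.+1 `^ p * 3 ^+ (m + m).
have c0 : 0 <= c by rewrite mulr_ge0 ?powR_ge0 ?exprn_ge0.
pose P lam := grid_power p (2 ^ l.+1) lam G.
pose Q lam := grid_power p (2 ^ l.+1) lam (iter m (bwd (delta l.+1)) G).
have mP : measurable_fun (circle R) (fun lam => (P lam)%:E).
  by apply: measurable_funTS; apply/measurable_EFinP; exact: measurable_grid_power.
have mQ : measurable_fun (circle R) (fun lam => (Q lam)%:E).
  apply: measurable_funTS; apply/measurable_EFinP; apply: measurable_grid_power.
  exact: measurable_iter_bwd.
have P0 lam : 0 <= P lam by exact: grid_power_ge0.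
have Q0 lam : 0 <= Q lam by exact: grid_power_ge0.
rewrite (@eq_integral _ _ _ mu _ (fun lam => (dyadic_bound l lam)%:E +
    ((c * a' l.+1)%:E * (P lam)%:E + (c * a)%:E * (Q lam)%:E))%E); last first.
  move=> lam _; rewrite -!EFinM -!EFinD /dyadic_bound big_nat_recr ?leq_addr//= addrA.
  by congr (_ + _)%:E; rewrite /P /Q /c; ring.
have cP x : (0 <= (c * a' l.+1)%:E * (P x)%:E)%E by rewrite -EFinM lee_fin mulr_ge0 // mulr_ge0.
have cQ x : (0 <= (c * a)%:E * (Q x)%:E)%E by rewrite -EFinM lee_fin mulr_ge0 // mulr_ge0.
rewrite ge0_integralD//; last 4 first.
- by move=> x _; rewrite lee_fin dyadic_bound_ge0.
- by apply: measurable_funTS; apply/measurable_EFinP; exact: measurable_dyadic_bound.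
- by move=> x _; exact: adde_ge0.
- by apply: emeasurable_funD; exact: measurable_funeM.
apply: leeD => //; rewrite ge0_integralD//; try exact: measurable_funeM.
rewrite ge0_integralZl//; last 2 first.
- by move=> x _; rewrite lee_fin.
- by rewrite lee_fin mulr_ge0.
rewrite ge0_integralZl//; last 2 first.
- by move=> x _; rewrite lee_fin.
- by rewrite lee_fin mulr_ge0.
rewrite (_ : delta l.+1 `^ p * _ = (c * a' l.+1) * ((2 ^ l.+1)%N%:R * g0) +
   (c * a) * ((2 ^ l.+1)%N%:R * g l.+1)); last by rewrite /c; ring.
have IP : (\int[mu]_(lam in circle R) (P lam)%:E <= ((2 ^ l.+1)%N%:R * g0)%:E)%E.
  by rewrite integral_grid_power// EFinM lee_wpmul2l// lee_fin.
have IQ : (\int[mu]_(lam in circle R) (Q lam)%:E <= ((2 ^ l.+1)%N%:R * g l.+1)%:E)%E.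
  rewrite integral_grid_power; [|exact: measurable_iter_bwd|exact: periodic_iter_bwd].
  by rewrite EFinM lee_wpmul2l ?lee_fin// Gg.
by rewrite EFinD; apply: leeD; rewrite [leRHS]EFinM lee_wpmul2l// lee_fin mulr_ge0.
Qed.

End DyadicGrid.

End Convolution.

(** * Averaging over the offset and refining the grid *)

Section ConvolutionEstimate.
Variable R : realType.
Notation mu := (@lebesgue_measure R).
Notation tau := (2 * pi : R).

Let tau_gt0 : 0 < tau := tau_gt0 R.
Hint Resolve tau_gt0 : core.
Let mC : measurable (circle R) := @measurable_circle R.
Hint Resolve mC : core.

Definition grid_error (B C : R) n (G : R -> R) lam : \bar R :=
  (\sum_(0 <= k < n) (B%:E * cell_oscillation n G (lam + k%:R * (tau / n%:R))%R +
     C%:E * `|G (lam + k%:R * (tau / n%:R))%R|%:E))%E.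

Lemma cell_oscillation_ge0 n (G : R -> R) x : (0 <= cell_oscillation n G x)%E.
Proof. by apply: integral_ge0 => s _; rewrite lee_fin. Qed.

Lemma periodic_cell_oscillation n (G : R -> R) : is_periodic G -> is_periodic (cell_oscillation n G).
Proof.
move=> pG x; apply: eq_integral => s _.
by rewrite pG (_ : x + tau + s = x + s + tau) ?pG//; ring.
Qed.

Lemma measurable_grid_error B C n (G : R -> R) : measurable_fun setT G ->
  measurable_fun setT (grid_error B C n G).
Proof.
move=> mG; apply: emeasurable_sum => k; apply: emeasurable_funD; apply: measurable_funeM.
  apply: measurableT_comp; first exact: measurable_cell_oscillation.
  exact: measurable_shift.
apply/measurable_EFinP; apply: measurableT_comp => //; apply: measurableT_comp => //.
exact: measurable_shift.
Qed.

Lemma grid_error_ge0 B C n (G : R -> R) lam : 0 <= B -> 0 <= C -> (0 <= grid_error B C n G lam)%E.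
Proof.
move=> B0 C0; apply: sume_ge0 => k _; apply: adde_ge0.
  by rewrite mule_ge0 ?lee_fin// cell_oscillation_ge0.
by rewrite -EFinM lee_fin mulr_ge0.
Qed.

Lemma integral_grid_error B C n (G : R -> R) e M : (0 < n)%N -> 0 <= B -> 0 <= C ->
  measurable_fun setT G -> is_periodic G -> 0 <= e ->
  (forall s, 0 <= s <= tau / n%:R -> (Np 1 (fun x => G (x + s) - G x)%R <= e%:E)%E) ->
  (Np 1 G <= M%:E)%E ->
  (\int[mu]_(lam in circle R) grid_error B C n G lam <=
   (n%:R * (B * (tau / n%:R * e) + C * M))%:E)%E.
Proof.
move=> n0 B0 C0 mG pG e0 Ge GM.
have mo := measurable_cell_oscillation n mG.
have mk (k : nat) : measurable_fun setT (fun lam : R => cell_oscillation n G (lam + k%:R * (tau / n%:R))).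
  by apply: measurableT_comp => //; exact: measurable_shift.
have mg (k : nat) : measurable_fun setT (fun lam : R => `|G (lam + k%:R * (tau / n%:R))|%:E).
  apply/measurable_EFinP; apply: measurableT_comp => //; apply: measurableT_comp => //.
  exact: measurable_shift.
have o0 x := cell_oscillation_ge0 n G x.
have t1 k x : (0 <= B%:E * cell_oscillation n G (x + k%:R * (tau / n%:R))%R)%E.
  by rewrite mule_ge0 ?lee_fin.
have t2 k x : (0 <= C%:E * `|G (x + k%:R * (tau / n%:R))%R|%:E)%E.
  by rewrite -EFinM lee_fin mulr_ge0.
rewrite /grid_error ge0_integral_sum//; last 2 first.
- by move=> k; apply: measurable_funTS; apply: emeasurable_funD; apply: measurable_funeM; [exact: mk|exact: mg].
- by move=> k x _; exact: adde_ge0.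
apply: (@le_trans _ _ (\sum_(0 <= k < n) (B * (tau / n%:R * e) + C * M)%:E)%E); last first.
  by rewrite sumEFin lee_fin big_const_nat iter_addr_0 subn0 [leRHS]mulr_natl.
apply: lee_sum => k _.
rewrite ge0_integralD//; try (by move=> x _; exact: t1); try (by move=> x _; exact: t2);
  try (by apply: measurable_funTS; apply: measurable_funeM; exact: mk);
  try (by apply: measurable_funTS; apply: measurable_funeM; exact: mg).
rewrite EFinD; apply: leeD.
  rewrite ge0_integralZl ?lee_fin//; try (by apply: measurable_funTS; exact: mk);
    try (by move=> x _; exact: o0).
  rewrite [leRHS]EFinM lee_wpmul2l ?lee_fin//.
  rewrite (@circle_integral_shift _ (cell_oscillation n G))//.
    exact: integral_cell_oscillation.
  exact: periodic_cell_oscillation.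
rewrite ge0_integralZl ?lee_fin//; try (by apply: measurable_funTS; exact: mg);
  try (by move=> x _; rewrite lee_fin).
rewrite [leRHS]EFinM lee_wpmul2l ?lee_fin//; apply: le_trans GM.
rewrite Np1E (@circle_integral_shift _ (fun x => `|G x|%:E))//.
- by apply/measurable_EFinP; apply: measurableT_comp.
- by move=> x; rewrite pG.
Qed.

Lemma small_grid (d : R) (l0 : nat) : 0 < d ->
  exists2 L, (l0 <= L)%N & tau / (2 ^ L)%N%:R <= d.
Proof.
move=> d0; have td0 : 0 <= tau / d by rewrite divr_ge0 ?ltW.
exists (maxn l0 (Num.bound (tau / d))); first exact: leq_maxl.
set L := maxn _ _; have := archi_boundP td0 => hb.
rewrite ler_pdivrMr ?ltr0n ?expn_gt0// [leRHS]mulrC -ler_pdivrMr//.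
apply: le_trans (ltW hb) _; rewrite ler_nat (leq_trans (leq_maxr l0 _))//.
by rewrite -/L ltnW// ltn_expl.
Qed.

(** For each offset the convolution is a quadrature sum plus an error. Integrating over the offset
    multiplies the left side by the period, hence W / tau. The bound on the sums is uniform in the
    level L, while the L_1 error disappears as L grows. *)
Lemma Np_conv_le (p : R) (m l0 : nat) (A G : R -> R) (a B B' g0 W : R) (a' g : nat -> R) :
  0 < p -> p <= 1 ->
  measurable_fun setT A -> is_periodic A -> (forall y, `|A y| <= B) ->
  (forall y s, 0 <= s -> `|A (y - s) - A y| <= B' * s) ->
  measurable_fun setT G -> is_periodic G -> (Np 1 G < +oo)%E ->
  measurable_fun setT (conv A G) ->
  (Np p A <= a%:E)%E ->
  (forall l, (l0 < l)%N -> (Np p (iter m (fwd (tau / (2 ^ l)%N%:R)) A) <= (a' l)%:E)%E) ->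
  (Np p G <= g0%:E)%E ->
  (forall l, (l0 < l)%N -> (Np p (iter m (bwd (tau / (2 ^ l)%N%:R)) G) <= (g l)%:E)%E) ->
  (forall L, (l0 <= L)%N ->
    (tau / (2 ^ l0)%N%:R) `^ p * (a * ((2 ^ l0)%N%:R * g0)) +
    \sum_(l0 <= l < L) (tau / (2 ^ l.+1)%N%:R) `^ p * (3 ^+ (m + m) *
      ((2 ^ l.+1)%N%:R * (a' l.+1 * g0 + a * g l.+1))) <= W) ->
  (Np p (conv A G) <= (W / tau)%:E)%E.
Proof.
move=> p0 p1 mA pA AB AB' mG pG fG mconv Aa Aa' Gg0 Gg HW.
have B0 : 0 <= B by exact: le_trans (AB 0).
have B'0 : 0 <= B' by have := AB' 0 1 ler01; rewrite mulr1; exact: le_trans.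
have [M GM] : exists M, Np 1 G = M%:E.
  by exists (fine (Np 1 G)); rewrite fineK// ge0_fin_numE ?Np_ge0.
have M0 : 0 <= M by rewrite -lee_fin -GM Np_ge0.
suff key eps e : 0 < eps -> 0 < e ->
    (tau%:E * Np p (conv A G) <= (eps `^ p * tau * tau +
      eps `^ (p - 1) * (tau * (tau * e * (B + B' * M))) + W)%:E)%E.
  rewrite -(@lee_pmul2l _ tau%:E)// ?lte_fin// -EFinM mulrCA divff ?gt_eqF// mulr1.
  apply/lee_addgt0Pr => eta eta0.
  (* Chosen so that eps^p tau^2 = eta / 2, half of the tolerance. *)
  pose eps := (eta / 2 / (tau * tau)) `^ p^-1.
  have q0 : 0 < eta / 2 / (tau * tau) by rewrite !divr_gt0// mulr_gt0.
  have eps0 : 0 < eps by rewrite powR_gt0.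
  have epsE : eps `^ p = eta / 2 / (tau * tau).
    by rewrite /eps -powRrM mulVf ?gt_eqF// powRr1 ?ltW.
  pose c := eps `^ (p - 1) * (tau * (tau * (B + B' * M))).
  have c0 : 0 <= c.
    by rewrite mulr_ge0 ?powR_ge0// mulr_ge0 ?(ltW tau_gt0)// mulr_ge0 ?(ltW tau_gt0)// addr_ge0// mulr_ge0.
  (* The other half pays for the error term c e; c + 1 avoids a division by zero. *)
  have e0 : 0 < eta / 2 / (c + 1) by rewrite !divr_gt0// ltr_wpDl.
  apply: le_trans (key _ _ eps0 e0) _; rewrite -EFinD lee_fin epsE addrC lerD2l.
  rewrite (_ : eta / 2 / (tau * tau) * tau * tau = eta / 2); last first.
    by have /negbT tn0 := gt_eqF tau_gt0; move: (tau) tn0 => t tn0; field.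
  have -> : eps `^ (p - 1) * (tau * (tau * (eta / 2 / (c + 1)) * (B + B' * M))) =
     c * (eta / 2 / (c + 1)) by rewrite /c; ring.
  have : c * (eta / 2 / (c + 1)) <= eta / 2.
    have eta2 : 0 <= eta / 2 by rewrite divr_ge0// ltW.
    by rewrite mulrCA ler_piMr// ler_pdivrMr ?ltr_wpDl// mul1r lerDl.
  lra.
move=> eps0 e0.
have [d d0 hd] := continuous_translation mG pG fG e0.
have de0 : 0 < Num.min d e by rewrite lt_min d0.
have [L l0L] := small_grid l0 de0; rewrite le_min => /andP[dLd dLe].
set n := (2 ^ L)%N in dLd dLe; have n0 : (0 < n)%N by rewrite expn_gt0.
set dn := tau / n%:R in dLd dLe; have dn0 : 0 < dn by rewrite divr_gt0 ?ltr0n.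
pose C := B' * dn ^+ 2.
have C0 : 0 <= C by rewrite mulr_ge0// sqr_ge0.
(* The offset is still fixed: only the error is converted from L_1 to L_p through [eps]. *)
have pt lam : (Np p (conv A G) <= ((eps `^ p * tau)%:E +
    (eps `^ (p - 1) * tau)%:E * grid_error B C n G lam) +
    (dyadic_bound p m l0 G a a' L lam)%:E)%E.
  pose Q x := grid_sum n lam (fun y => A (x - y) * G y).
  have mQ : measurable_fun setT Q by exact: measurable_conv_grid.
  rewrite (eq_Np p (v := fun x => (conv A G x - Q x) + Q x)); last by move=> x; rewrite subrK.
  have mD : measurable_fun setT (fun x => conv A G x - Q x) by exact: measurable_funB.
  apply: le_trans (NpD p0 p1 mD mQ) _.
  apply: leeD; last exact: (Np_grid_sum_le p0 p1 mA pA pG Aa Aa' lam l0L).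
  apply: le_trans (Np_le_eps p0 p1 eps0 mD) _; rewrite leeD2l// [(eps `^ (p - 1) * tau)%:E]EFinM.
  rewrite -muleA lee_wpmul2l ?lee_fin ?powR_ge0//.
  rewrite Np1E.
  apply: (@le_trans _ _ (\int[mu]_(x in circle R) grid_error B C n G lam)%E).
    apply: ge0_le_integral => //.
    - by apply: measurable_funTS; apply: measurableT_comp => //; exact/measurable_EFinP.
    - by move=> x _; exact: (conv_grid_sum_le lam x n0 mA pA AB AB' mG pG fG).
  rewrite (integral_cst mu mC (grid_error B C n G lam)).
  by rewrite muleC lee_wpmul2r ?grid_error_ge0// -mu_circle.
have -> : (tau%:E * Np p (conv A G) = \int[mu]_(lam in circle R) Np p (conv A G))%E.
  by rewrite muleC -mu_circle; exact/esym/(integral_cst mu mC).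
have mE : measurable_fun (circle R) (grid_error B C n G).
  by apply: measurable_funTS; exact: measurable_grid_error.
have mD : measurable_fun (circle R) (fun lam => (dyadic_bound p m l0 G a a' L lam)%:E).
  by apply: measurable_funTS; apply/measurable_EFinP; exact: measurable_dyadic_bound.
have E0 lam : (0 <= (eps `^ (p - 1) * tau)%:E * grid_error B C n G lam)%E.
  by rewrite mule_ge0 ?grid_error_ge0// lee_fin mulr_ge0 ?powR_ge0// ltW.
have c0 : 0 <= eps `^ p * tau by rewrite mulr_ge0 ?powR_ge0// ltW.
have D0 lam : (0 <= (dyadic_bound p m l0 G a a' L lam)%:E)%E.
  by rewrite lee_fin; exact: (dyadic_bound_ge0 G Aa Aa').
apply: (@le_trans _ _ (\int[mu]_(lam in circle R) (((eps `^ p * tau)%:E +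
    (eps `^ (p - 1) * tau)%:E * grid_error B C n G lam) +
    (dyadic_bound p m l0 G a a' L lam)%:E))%E).
  apply: ge0_le_integral => //.
  - by move=> lam _; exact: Np_ge0.
  - by apply: emeasurable_funD => //; apply: emeasurable_funD => //; exact: measurable_funeM.
rewrite ge0_integralD//; last 2 first.
- by move=> lam _; apply: adde_ge0 => //; rewrite lee_fin.
- by apply: emeasurable_funD => //; exact: measurable_funeM.
rewrite EFinD; apply: leeD; last first.
  apply: le_trans (integral_dyadic_bound mG pG Aa Aa' l0L Gg0 Gg) _.
  by rewrite lee_fin HW.
rewrite ge0_integralD//; try exact: measurable_funeM;
  try (by move=> lam _; rewrite lee_fin).
rewrite integral_circle_cst EFinD leeD2l//.
rewrite ge0_integralZl//; try (by move=> lam _; exact: grid_error_ge0);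
  try (by rewrite lee_fin mulr_ge0 ?powR_ge0// ltW).
apply: le_trans (lee_wpmul2l _ (integral_grid_error n0 B0 C0 mG pG (ltW e0) _ (_ : _ <= M%:E)%E)) _.
- by rewrite lee_fin mulr_ge0 ?powR_ge0// ltW.
- by move=> s /andP[s0 sd]; apply: hd; rewrite s0 (le_trans sd).
- by rewrite GM.
rewrite -EFinM lee_fin -/dn.
have nd : n%:R * dn = tau by rewrite /dn mulrCA divff ?mulr1// pnatr_eq0 -lt0n.
have -> : eps `^ (p - 1) * tau * (n%:R * (B * (dn * e) + C * M)) =
    eps `^ (p - 1) * tau * ((n%:R * dn) * (B * e + B' * dn * M)) by rewrite /C; ring.
rewrite nd; have -> : eps `^ (p - 1) * (tau * (tau * e * (B + B' * M))) =
    eps `^ (p - 1) * tau * (tau * (B * e + B' * e * M)) by ring.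
have cc0 : 0 <= eps `^ (p - 1) * tau by apply: mulr_ge0; [exact: powR_ge0|exact: ltW].
apply: (ler_wpM2l cc0); apply: (ler_wpM2l (ltW tau_gt0)).
by rewrite lerD2l ler_wpM2r// ler_wpM2l.
Qed.

End ConvolutionEstimate.

(** * Dyadic blocks *)

Section Cutoffs.
Variable R : realType.
Implicit Types (x t : R) (n k : nat).

(** The truncated powers x_+^(n + 1) are of class C^n and are the only source of cutoffs. *)
Definition pos_part x : R := Num.max x 0.

Lemma pos_part_ge0 x : 0 <= pos_part x.
Proof. by rewrite /pos_part le_max lexx orbT. Qed.

Lemma pos_part_id x : 0 <= x -> pos_part x = x.
Proof. by move=> x0; rewrite /pos_part max_l. Qed.

Lemma pos_part_eq0 x : x <= 0 -> pos_part x = 0.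
Proof. by move=> x0; rewrite /pos_part max_r. Qed.

Lemma continuous_pos_part : continuous pos_part.
Proof.
move=> x; rewrite (_ : pos_part = fun y => 2^-1 * (y + `|y|)).
  apply: cvgM; first exact: cvg_cst.
  by apply: cvgD; [exact: cvg_id|exact: norm_continuous].
apply/funext => y; have [y0|y0] := leP 0 y.
  by rewrite pos_part_id// ger0_norm//; lra.
by rewrite pos_part_eq0 ?(ltW y0)// ltr0_norm//; lra.
Qed.

Lemma continuous_pos_part_exp k : continuous (fun x => pos_part x ^+ k).
Proof.
move=> x; elim: k => [|k IH]; first exact: cvg_cst.
rewrite (_ : (fun y => _) = (fun y => pos_part y * pos_part y ^+ k)); last first.
  by apply/funext => y; rewrite exprS.
by apply: cvgM => //; exact: continuous_pos_part.
Qed.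

Lemma is_derive_pos_part_exp k x :
  is_derive x 1 (fun y => pos_part y ^+ k.+2) (k.+2%:R * pos_part x ^+ k.+1).
Proof.
have [x0|x0|->] := ltgtP x 0.
- apply: (@near_eq_is_derive _ _ _ (cst 0)).
    near=> y; rewrite pos_part_eq0 ?expr0n//= ltW//; near: y.
    by apply: lt_nbhsl.
  by rewrite pos_part_eq0 ?(ltW x0)// expr0n/= mulr0; exact: is_derive_cst.
- apply: (@near_eq_is_derive _ _ _ (fun y : R => y ^+ k.+2)).
    near=> y; rewrite pos_part_id// ltW//; near: y.
    by apply: lt_nbhsr.
  rewrite (_ : (fun y : R => y ^+ k.+2) = (id : R -> R) ^+ k.+2); last first.
    by apply/funext => y; rewrite exprfctE.
  have := @is_deriveX R _ id k.+2 x 1 1 (is_derive_id x 1).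
  move/is_derive_eq; apply.
  by rewrite pos_part_id ?(ltW x0)// /GRing.scale/= mulr1.
(* At the origin the difference quotient is itself a truncated power of one degree less, hence tends
   to 0. *)
- have h : (fun t : R => t^-1 *: (pos_part (t *: 1 + 0) ^+ k.+2 - pos_part 0 ^+ k.+2)) @ 0^' --> (0 : R).
    have c0 := @continuous_pos_part_exp k.+1 0.
    rewrite /continuous_at pos_part_id// expr0n/= in c0.
    apply: cvg_trans (near_eq_cvg _) (cvg_trans _ c0); last first.
      exact: cvg_within_filter.
    near=> t; have t0 : t != 0 by near: t; exact: nbhs_dnbhs_neq.
    rewrite [t *: 1]mulr1 addr0 [pos_part 0]pos_part_id// expr0n subr0.
    have [tp|tn] := leP 0 t.
      by rewrite pos_part_id// [_ ^+ k.+2]exprS /GRing.scale/= mulrA mulVf// mul1r.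
    by rewrite !pos_part_eq0 ?(ltW tn)// !expr0n/= scaler0.
  rewrite pos_part_id// expr0n/= mulr0; split.
    by apply/cvg_ex; exists 0.
  exact: cvg_lim h.
Unshelve. all: by end_near. Qed.

Lemma smooth_pos_part_exp n : smooth_on setT n (fun x => pos_part x ^+ n.+1).
Proof.
elim: n => [|n IH] /=; first by move=> x _; exact: continuous_pos_part_exp.
exists (fun x => n.+2%:R * pos_part x ^+ n.+1); split.
  by move=> x _; exact: is_derive_pos_part_exp.
exact: smooth_on_scale.
Qed.

(** A C^n passage from 0 on x <= 0 to 1 on x >= 1; the two truncated powers never vanish together,
    so the quotient is smooth. *)
Definition smooth_step n x : R :=
  pos_part x ^+ n.+1 / (pos_part x ^+ n.+1 + pos_part (1 - x) ^+ n.+1).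

Lemma smooth_step_denom_gt0 n x : 0 < pos_part x ^+ n.+1 + pos_part (1 - x) ^+ n.+1.
Proof.
have [x0|x0] := ltP 0 x.
  by rewrite ltr_pwDl ?exprn_ge0 ?pos_part_ge0// exprn_gt0// pos_part_id// ltW.
rewrite ltr_wpDl ?exprn_ge0 ?pos_part_ge0// exprn_gt0// pos_part_id; lra.
Qed.

Lemma smooth_smooth_step n (a b : R) : smooth_on setT n (fun x => smooth_step n (a * x + b)).
Proof.
have P c d := @smooth_on_comp _ setT n (fun x => pos_part x ^+ n.+1) (fun x => c * x + d)
  (smooth_pos_part_exp n) (smooth_on_affine _ _ _ _).
have P1 : smooth_on setT n (fun x => pos_part (1 - (a * x + b)) ^+ n.+1).
  rewrite (_ : (fun x => _) = fun x => pos_part (- a * x + (1 - b)) ^+ n.+1); first exact: P.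
  by apply/funext => x; congr (pos_part _ ^+ _); ring.
apply: smooth_on_mul; first exact: P.
apply: smooth_on_inv; last by apply: smooth_on_add; [exact: P|exact: P1].
by move=> x _; rewrite gt_eqF// smooth_step_denom_gt0.
Qed.

Lemma smooth_step_eq0 n x : x <= 0 -> smooth_step n x = 0.
Proof. by move=> x0; rewrite /smooth_step pos_part_eq0// expr0n mul0r. Qed.

Lemma smooth_step_eq1 n x : 1 <= x -> smooth_step n x = 1.
Proof.
move=> x1; have := smooth_step_denom_gt0 n x; rewrite /smooth_step.
rewrite (@pos_part_eq0 (1 - x)) ?subr_le0// expr0n addr0 => h.
by rewrite divff// gt_eqF.
Qed.

Definition bump n x : R := smooth_step n (- 2 * x + 2) * smooth_step n (2 * x + 2).

Lemma smooth_bump n (a b : R) : smooth_on setT n (fun x => bump n (a * x + b)).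
Proof.
rewrite /bump; apply: smooth_on_mul.
  rewrite (_ : (fun x => _) = fun x => smooth_step n ((- 2 * a) * x + (- 2 * b + 2))).
    exact: smooth_smooth_step.
  by apply/funext => x; congr smooth_step; ring.
rewrite (_ : (fun x => _) = fun x => smooth_step n ((2 * a) * x + (2 * b + 2))).
  exact: smooth_smooth_step.
by apply/funext => x; congr smooth_step; ring.
Qed.

Lemma bump_eq1 n x : `|x| <= 1 / 2 -> bump n x = 1.
Proof.
by rewrite ler_norml => /andP[h1 h2]; rewrite /bump !smooth_step_eq1 ?mulr1//; lra.
Qed.

Lemma bump_eq0 n x : 1 <= `|x| -> bump n x = 0.
Proof.
rewrite ler_normr => /orP[h|h]; rewrite /bump.
  by rewrite smooth_step_eq0 ?mul0r//; lra.
by rewrite [X in _ * X]smooth_step_eq0 ?mulr0//; lra.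
Qed.

Lemma bumpN n x : bump n (- x) = bump n x.
Proof. by rewrite /bump mulrC; congr (smooth_step _ _ * smooth_step _ _); ring. Qed.

(** The difference of bumps is even and lives on two rings. The last factor keeps the positive one,
    where the power x^(-alpha) of the symbol makes sense; it is 1 from x = 0.5 on, hence on all of
    that ring. *)
Definition ring_cutoff n x : R := (bump n (x / 2) - bump n x) * smooth_step n (x + 1 / 2).

Lemma smooth_ring_cutoff n : smooth_on setT n (ring_cutoff n).
Proof.
apply: smooth_on_mul.
  rewrite (_ : (fun x => _) = fun x => bump n (2^-1 * x + 0) + -1 * bump n (1 * x + 0)).
    apply: smooth_on_add; first exact: smooth_bump.
    by apply: smooth_on_scale; exact: smooth_bump.
  by apply/funext => x; rewrite !addr0 mul1r mulN1r mulrC.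
rewrite (_ : (fun x => _) = fun x => smooth_step n (1 * x + 1 / 2)).
  exact: smooth_smooth_step.
by apply/funext => x; congr smooth_step; ring.
Qed.

Lemma ring_cutoff_eq0 n x : ~ (1 / 2 <= x <= 2) -> ring_cutoff n x = 0.
Proof.
move=> h; rewrite /ring_cutoff; have [x1|x1] := leP x (- (1 / 2)).
  by rewrite smooth_step_eq0 ?mulr0//; lra.
have [x2|x2] := leP x (1 / 2).
  by rewrite !bump_eq1 ?subrr ?mul0r// ler_norml; apply/andP; split; lra.
have x3 : 2 < x by rewrite ltNge; apply/negP => x3; apply: h; rewrite (ltW x2).
by rewrite !bump_eq0 ?subrr ?mul0r//; rewrite ger0_norm; lra.
Qed.

Lemma ring_cutoffE n x : 0 <= x -> ring_cutoff n x = bump n (x / 2) - bump n x.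
Proof.
move=> x0; rewrite /ring_cutoff; have [x1|x1] := leP x (1 / 2); last first.
  by rewrite smooth_step_eq1 ?mulr1//; lra.
by rewrite !bump_eq1 ?subrr ?mul0r// ler_norml; apply/andP; split; lra.
Qed.

(* Symbol of the fractional integral on a dyadic block, with the factor of a
   difference of order 2r and step c divided out. *)
Definition block_symbol n (alpha c : R) r x : R :=
  ring_cutoff n x * (x `^ (- alpha) * ((2 - 2 * cos (c * x)) ^+ r)^-1).

Lemma block_symbol_eq0 n alpha c r x : ~ (1 / 2 <= x <= 2) -> block_symbol n alpha c r x = 0.
Proof. by move=> h; rewrite /block_symbol ring_cutoff_eq0 ?mul0r. Qed.

Lemma two_sub_cos_gt0 (y : R) : 0 < y <= pi -> 0 < 2 - 2 * cos y.
Proof.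
move=> /andP[y0 yp]; apply: lt_le_trans (two_sub_cos_ge _).
  by rewrite divr_gt0// exprn_gt0.
by rewrite gtr0_norm.
Qed.

(** On (0, 4) the argument c x stays in (0, pi], so the divided factor does not vanish. The
    singularity at 0 lies outside the support [1/2, 2]. *)
Lemma smooth_block_symbol n alpha c r : 0 < c -> 4 * c <= pi ->
  smooth_on setT n (block_symbol n alpha c r).
Proof.
move=> c0 cpi; apply: (@smooth_on_extend0 _ _ _ 0 (1 / 2) 2 4); [lra|lra| |].
  exact: block_symbol_eq0.
apply: smooth_on_mul.
  by apply: smooth_on_subset (smooth_ring_cutoff n).
apply: smooth_on_mul.
  by apply: smooth_on_subset (smooth_on_powR n (- alpha)) => x /= /andP[].
have pos x : [set x | 0 < x < 4] x -> 0 < 2 - 2 * cos (c * x).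
  move=> /= /andP[x0 x4]; apply: two_sub_cos_gt0; rewrite mulr_gt0//=.
  by apply: le_trans cpi; rewrite mulrC ler_wpM2r// ltW.
apply: smooth_on_inv.
  by move=> x /pos h; rewrite expf_neq0// gt_eqF.
apply: smooth_on_exp.
rewrite (_ : (fun x => _) = fun x => 2 + -2 * cos (c * x + 0)).
  apply: smooth_on_add; first exact: smooth_on_cst.
  apply: smooth_on_scale.
  apply: (@smooth_on_comp _ _ _ cos); last exact: smooth_on_affine.
  rewrite (_ : cos = fun x => cos (x + 0)); first exact: smooth_cosD.
  by apply/funext => x; rewrite addr0.
by apply/funext => x; rewrite addr0 mulNr.
Qed.

End Cutoffs.

(** * Derivatives, differences and L_p size of the kernels *)

Section TrigKernelFamily.
Variable R : realType.
Notation mu := (@lebesgue_measure R).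
Notation tau := (2 * pi : R).
Implicit Types (b w f : R -> R) (x th p d : R) (M N m n : nat).

Let tau_gt0 : 0 < tau := tau_gt0 R.
Hint Resolve tau_gt0 : core.

Lemma derive_bounded_scale n w f c : 0 <= c -> derive_bounded n w f ->
  derive_bounded n (fun x => c * w x) (fun x => c * f x).
Proof.
move=> c0; elim: n f => [|n IH] f /=.
  by move=> bf x; rewrite normrM ger0_norm// ler_wpM2l.
move=> [f' [df bf]]; exists (fun x => c * f' x); split; last exact: IH.
by move=> x; exact: is_deriveZ.
Qed.

Lemma is_derive_bigsum n (h h' : nat -> R -> R) x :
  (forall i, is_derive x 1 (h i) (h' i x)) ->
  is_derive x 1 (fun y => \sum_(0 <= i < n) h i y) (\sum_(0 <= i < n) h' i x).
Proof.
move=> dh; elim: n => [|n IH].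
  rewrite big_nil (_ : (fun y => _) = cst 0); first exact: is_derive_cst.
  by apply/funext => y; rewrite big_nil.
rewrite big_nat_recr//= (_ : (fun y => _) = (fun y => \sum_(0 <= i < n) h i y) + h n).
  exact: is_deriveD.
by apply/funext => y; rewrite big_nat_recr.
Qed.

(** Differentiation multiplies the symbol by y, the kernel by N, and advances the phase by pi/2.
    With the phase as a parameter the family is closed under differentiation. *)
Lemma is_derive_trig_kernel M b N th x : (0 < N)%N ->
  is_derive x 1 (trig_kernel M b N th)
    (N%:R * trig_kernel M (fun y => y * b y) N (th + pi / 2) x).
Proof.
move=> N0; rewrite /trig_kernel; set L := ((M + 3) * N)%N.
pose h (i : nat) y := b ((i%:R - L%:R) / N%:R) * cos ((i%:R - L%:R) * y + th).
pose h' (i : nat) y := b ((i%:R - L%:R) / N%:R) *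
  (cos ((i%:R - L%:R) * y + (th + pi / 2)) * (i%:R - L%:R)).
have := @is_derive_bigsum L.*2.+1 h h' x.
have -> : \sum_(0 <= i < L.*2.+1) h' i x = N%:R * \sum_(0 <= i < L.*2.+1)
    ((i%:R - L%:R) / N%:R * b ((i%:R - L%:R) / N%:R)) *
    cos ((i%:R - L%:R) * x + (th + pi / 2)).
  rewrite mulr_sumr; apply: eq_bigr => i _; rewrite /h'.
  have N0' : N%:R != 0 :> R by rewrite pnatr_eq0 -lt0n.
  by set q := b _; set e := cos _; field.
apply => i; rewrite /h /h'.
apply: is_deriveZ.
have hl : is_derive x 1 (fun y : R => (i%:R - L%:R) * y) ((i%:R - L%:R) *: 1) by apply: is_deriveZ.
have := @is_derive1_comp _ (fun y => cos (y + th)) (fun y => (i%:R - L%:R) * y) x _ _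
  (is_derive_cosD th ((i%:R - L%:R) * x)) hl.
by rewrite /GRing.scale/= mulr1.
Qed.

Lemma derive_bounded_trig_kernel M b N m th w : (0 < N)%N ->
  (forall th x, `|trig_kernel M (fun y => y ^+ m * b y) N th x| <= w x) ->
  derive_bounded m (fun x => N%:R ^+ m * w x) (trig_kernel M b N th).
Proof.
move=> N0; elim: m b th => [|m IH] b th hw /=.
  move=> x; rewrite mul1r; have := hw th x; congr (`|_| <= _).
  by apply: eq_bigr => i _; rewrite mul1r.
exists (fun x => N%:R * trig_kernel M (fun y => y * b y) N (th + pi / 2) x); split.
  by move=> x; exact: is_derive_trig_kernel.
rewrite (_ : (fun x => _ * w x) = fun x => N%:R * (N%:R ^+ m * w x)); last first.
  by apply/funext => x; rewrite exprS mulrA.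
apply: derive_bounded_scale => //; apply: IH => th' x.
have := hw th' x; congr (`|_| <= _).
by apply: eq_bigr => i _; rewrite exprSr mulrA.
Qed.

Lemma continuous_trig_kernel M b N th : (0 < N)%N -> continuous (trig_kernel M b N th).
Proof. by move=> N0 x; exact: is_derive_continuous (is_derive_trig_kernel M b th x N0). Qed.

Lemma cos_periodic_int (z : int) x th : cos (z%:~R * (x + tau) + th) = cos (z%:~R * x + th).
Proof.
have pc : is_periodic (@cos R) by move=> y; rewrite (mulr_natl pi 2) cosD2pi.
rewrite -[RHS](is_periodic_int z _ pc); congr cos; ring.
Qed.

Lemma periodic_trig_kernel M b N th : is_periodic (trig_kernel M b N th).
Proof.
move=> x; apply: eq_bigr => i _; congr (_ * _).
set L := ((M + 3) * N)%N.
have -> : i%:R - L%:R = (Posz i - Posz L)%:~R :> R by rewrite intrD mulrNz.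
exact: cos_periodic_int.
Qed.

Lemma measurable_trig_kernel M b N th : (0 < N)%N -> measurable_fun setT (trig_kernel M b N th).
Proof. by move=> N0; apply: continuous_measurable_fun; exact: continuous_trig_kernel. Qed.

Lemma trig_kernel_lipschitz M b N th B : (0 < N)%N -> (forall y, `|y * b y| <= B) ->
  forall x s, 0 <= s -> `|trig_kernel M b N th (x - s) - trig_kernel M b N th x| <=
    N%:R * ((2 * (M + 3) + 1)%:R * N%:R * B) * s.
Proof.
move=> N0 hB x s s0; have xs : x - s <= x by rewrite lerBlDr lerDl.
have [|c _] := MVT_segment xs (fun y _ => is_derive_trig_kernel M b th y N0).
  by apply: continuous_subspaceT; exact: continuous_trig_kernel.
rewrite distrC => ->; rewrite (_ : x - (x - s) = s) ?normrM; last by ring.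
rewrite (ger0_norm s0) ler_wpM2r//.
rewrite normr_nat ler_wpM2l//.
exact: trig_kernel_le.
Qed.

(** One constant serves all scales and phases. The second bound uses the decay for the symbol y^m
    b(y), whose kernel is the m-th derivative up to N^m and a phase. *)
Lemma trig_kernel_Np p M m b : 0 < p -> 1 <= M%:R * p -> smooth_on setT M.*2 b ->
  (forall y, ~ (-2 <= y <= 2) -> b y = 0) ->
  exists2 C, 0 < C & forall N th, (0 < N)%N ->
    (Np p (trig_kernel M b N th) <= (C * N%:R `^ (p - 1))%:E)%E /\
    forall d, 0 <= d -> N%:R * d <= 1 ->
      (Np p (iter m (fwd d) (trig_kernel M b N th)) <=
       (C * (((N%:R * d) ^+ m) `^ p * N%:R `^ (p - 1)))%:E)%E.
Proof.
move=> p0 Mp sb b0.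
have [C1 C1_gt0 h1] := trig_kernel_decay sb b0.
have sb' : smooth_on setT M.*2 (fun y => y ^+ m * b y).
  by apply: smooth_on_mul => //; apply: smooth_on_exp; exact: smooth_on_id.
have b0' y : ~ (-2 <= y <= 2) -> y ^+ m * b y = 0 by move=> hy; rewrite b0// mulr0.
have [C2 C2_gt0 h2] := trig_kernel_decay sb' b0'.
(* The slow variation constant for N d <= 1. *)
pose K : R := (2 + 2 * 1 ^+ 2) ^+ M.
have K0 : 0 <= K by rewrite exprn_ge0//; lra.
pose D1 := C1 `^ p * tau; pose D2 := (K ^+ m * C2) `^ p * tau.
have D1_gt0 : 0 < D1 by rewrite mulr_gt0// powR_gt0.
have D2_ge0 : 0 <= D2 by rewrite mulr_ge0 ?powR_ge0// ltW.
exists (D1 + D2); first by rewrite ltr_pwDl.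
move=> N th N0; have Np0 : 0 <= N%:R `^ (p - 1) by exact: powR_ge0.
split.
  have := Np_kernel_weight p0 Mp N0 (ltW C1_gt0) (measurable_trig_kernel M b th N0)
    (fun x => h1 N th x N0).
  move/le_trans; apply; rewrite lee_fin mulrA -/D1 ler_wpM2r//.
  by rewrite lerDl.
move=> d d0 Nd1.
have Nd0 : 0 <= N%:R * d by rewrite mulr_ge0.
have hw x : `|iter m (fwd d) (trig_kernel M b N th) x| <=
    ((N%:R * d) ^+ m * (K ^+ m * C2)) * kernel_weight M N x.
  have := @iter_fwd_le _ m (trig_kernel M b N th)
    (fun x => N%:R ^+ m * (C2 * kernel_weight M N x)) d K d0 K0 _ _ x.
  rewrite [X in _ -> _ -> _ <= X](_ : _ =
    ((N%:R * d) ^+ m * (K ^+ m * C2)) * kernel_weight M N x); last by rewrite !exprMn; ring.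
  apply.
  - move=> y s /andP[s0 sd]; rewrite [leRHS]mulrCA ler_wpM2l ?exprn_ge0//.
    rewrite [leRHS]mulrCA ler_wpM2l ?(ltW C2_gt0)//; apply: kernel_weight_slow => //.
    by apply: le_trans Nd1; rewrite ler_wpM2l.
  - by apply: derive_bounded_trig_kernel => // th' y; exact: h2.
have c0 : 0 <= (N%:R * d) ^+ m * (K ^+ m * C2).
  by rewrite mulr_ge0 ?exprn_ge0// mulr_ge0 ?exprn_ge0// ltW.
have := Np_kernel_weight p0 Mp N0 c0 _ hw.
move=> /(_ (measurable_iter_fwd d m (measurable_trig_kernel M b th N0))).
move/le_trans; apply; rewrite lee_fin.
rewrite powRM ?exprn_ge0 ?mulr_ge0 ?exprn_ge0 ?(ltW C2_gt0)//.
set P := _ `^ p; rewrite [leLHS](_ : _ = D2 * (P * N%:R `^ (p - 1))); last first.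
  by rewrite /D2; ring.
by rewrite ler_wpM2r ?mulr_ge0 ?powR_ge0// lerDr ltW.
Qed.

End TrigKernelFamily.

(** * Frequency components of a real function *)

Section Modes.
Variable R : realType.
Notation mu := (@lebesgue_measure R).
Notation tau := (2 * pi : R).
Implicit Types (b u G : R -> R) (x th : R) (M N : nat).

Let tau_gt0 : 0 < tau := tau_gt0 R.
Hint Resolve tau_gt0 : core.
Let mC : measurable (circle R) := @measurable_circle R.
Hint Resolve mC : core.

(** For an integer frequency j > 0 and phase 0 this is pi times the j-th term of the real Fourier
    series. A nonzero phase also covers conjugate terms and Weyl derivatives. *)
Definition mode (z th : R) G x : R := conv (fun t => cos (z * t + th)) G x.

Lemma integrable_bounded_mul u G (B : R) : measurable_fun setT u -> (forall x, `|u x| <= B) ->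
  measurable_fun setT G -> (Np 1 G < +oo)%E ->
  mu.-integrable (circle R) (EFin \o (fun y => u y * G y)).
Proof.
move=> mu_ uB mG fG; apply/circle_integrableP; first exact: measurable_funM.
have fB : (Np 1 (fun y => B * G y)%R < +oo)%E.
  by rewrite NpZ// powRr1// lte_mul_pinfty.
apply: le_lt_trans fB.
  apply: le_Np => //; try exact: measurable_funM.
  by move=> x; rewrite !normrM ler_wpM2r// (le_trans (uB x))// ler_norm.
Qed.

Lemma circle_integrable_scale (c : R) u : mu.-integrable (circle R) (EFin \o u) ->
  mu.-integrable (circle R) (EFin \o (fun x => c * u x)).
Proof. by move=> iu; apply: (integrableZl _ c iu); exact: measurable_circle. Qed.

Lemma circle_RintegralZ (c : R) u : mu.-integrable (circle R) (EFin \o u) ->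
  \int[mu]_(x in circle R) (c * u x) = c * \int[mu]_(x in circle R) u x.
Proof. by move=> iu; rewrite RintegralZl. Qed.

Lemma circle_RintegralD u G : mu.-integrable (circle R) (EFin \o u) ->
  mu.-integrable (circle R) (EFin \o G) ->
  \int[mu]_(x in circle R) (u x + G x) =
  \int[mu]_(x in circle R) u x + \int[mu]_(x in circle R) G x.
Proof. by move=> iu iG; rewrite RintegralD. Qed.

Lemma measurable_cos_affine (z th : R) : measurable_fun setT (fun y : R => cos (z * y + th)).
Proof.
apply: continuous_measurable_fun => y; apply: continuous_comp; last exact: continuous_cos.
by apply: cvgD; [apply: cvgM; [exact: cvg_cst|exact: cvg_id]|exact: cvg_cst].
Qed.

Lemma measurable_sin_affine (z th : R) : measurable_fun setT (fun y : R => sin (z * y + th)).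
Proof.
rewrite (_ : (fun y => _) = fun y => cos (z * y + (th - pi / 2))); first exact: measurable_cos_affine.
by apply/funext => y; rewrite addrA cosBpihalf.
Qed.

Lemma modeE (z th : R) G x : measurable_fun setT G -> (Np 1 G < +oo)%E ->
  mode z th G x =
    cos (z * x + th) * \int[mu]_(y in circle R) (cos (z * y) * G y) +
    sin (z * x + th) * \int[mu]_(y in circle R) (sin (z * y) * G y).
Proof.
move=> mG fG.
have ic := integrable_bounded_mul (measurable_cos_affine z 0) (fun y => cos_max (z * y + 0)) mG fG.
have is_ := integrable_bounded_mul (measurable_sin_affine z 0) (fun y => sin_max (z * y + 0)) mG fG.
have ec : (fun y => cos (z * y + 0) * G y) = (fun y => cos (z * y) * G y).
  by apply/funext => y; rewrite addr0.
have es : (fun y => sin (z * y + 0) * G y) = (fun y => sin (z * y) * G y).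
  by apply/funext => y; rewrite addr0.
rewrite ec in ic; rewrite es in is_.
have ic' := circle_integrable_scale (cos (z * x + th)) ic.
have is' := circle_integrable_scale (sin (z * x + th)) is_.
rewrite -(circle_RintegralZ _ ic) -(circle_RintegralZ _ is_) -(circle_RintegralD ic' is').
apply: eq_Rintegral => y _.
  rewrite (_ : z * (x - y) + th = (z * x + th) - z * y); last by ring.
  by rewrite cosB; ring.
Qed.

Lemma measurable_mode (z th : R) G : measurable_fun setT G -> (Np 1 G < +oo)%E ->
  measurable_fun setT (mode z th G).
Proof.
move=> mG fG; rewrite (_ : mode z th G = fun x =>
    cos (z * x + th) * \int[mu]_(y in circle R) (cos (z * y) * G y) +
    sin (z * x + th) * \int[mu]_(y in circle R) (sin (z * y) * G y)); last first.
  by apply/funext => x; exact: modeE.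
apply: measurable_funD; apply: measurable_funM => //.
  exact: measurable_cos_affine.
exact: measurable_sin_affine.
Qed.

Lemma conv_sum n (c : nat -> R) (e : nat -> R -> R) G x :
  (forall i, measurable_fun setT (e i)) -> (forall i y, `|e i y| <= 1) ->
  measurable_fun setT G -> (Np 1 G < +oo)%E ->
  conv (fun t => \sum_(0 <= i < n) c i * e i t) G x = \sum_(0 <= i < n) c i * conv (e i) G x.
Proof.
move=> me e1 mG fG.
have mx i : measurable_fun setT (fun y : R => e i (x - y)).
  apply: measurableT_comp => //; apply: measurable_funB => //; exact: measurable_cst.
have ii i := integrable_bounded_mul (mx i) (fun y => e1 i (x - y)) mG fG.
elim: n => [|n IH].
  rewrite big_nil /conv (@eq_Rintegral _ _ _ mu _ (fun=> 0)).
    by rewrite /Rintegral integral0_eq.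
  by move=> y _; rewrite big_nil mul0r.
rewrite big_nat_recr//= -IH /conv -(circle_RintegralZ _ (ii n)) -circle_RintegralD//.
- by apply: eq_Rintegral => y _; rewrite big_nat_recr//= mulrDl mulrA.
- apply: (integrable_bounded_mul (B := \sum_(0 <= i < n) `|c i|)) => //.
    by apply: measurable_sum => i; apply: measurable_funM.
  move=> y; apply: le_trans (ler_norm_sum _ _ _) _; apply: ler_sum => i _.
  by rewrite normrM ler_piMr.
- exact: circle_integrable_scale.
Qed.

Lemma conv_trig_kernel M b N th G x : measurable_fun setT G -> (Np 1 G < +oo)%E ->
  conv (trig_kernel M b N th) G x =
  \sum_(0 <= i < (((M + 3) * N).*2).+1)
    b ((i%:R - ((M + 3) * N)%:R) / N%:R) * mode (i%:R - ((M + 3) * N)%:R) th G x.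
Proof.
move=> mG fG; apply: (@conv_sum _ (fun i => b ((i%:R - ((M + 3) * N)%:R) / N%:R))
  (fun i t => cos ((i%:R - ((M + 3) * N)%:R) * t + th))) => //.
  by move=> i; exact: measurable_cos_affine.
by move=> i y; exact: cos_max.
Qed.

Lemma measurable_conv_trig_kernel M b N th G : measurable_fun setT G -> (Np 1 G < +oo)%E ->
  measurable_fun setT (conv (trig_kernel M b N th) G).
Proof.
move=> mG fG; rewrite (_ : conv _ _ = fun x => \sum_(0 <= i < (((M + 3) * N).*2).+1)
    b ((i%:R - ((M + 3) * N)%:R) / N%:R) * mode (i%:R - ((M + 3) * N)%:R) th G x).
  by apply: measurable_sum => i; apply: measurable_funM => //; exact: measurable_mode.
by apply/funext => x; exact: conv_trig_kernel.
Qed.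

End Modes.

(** * The bound for one dyadic block *)

Section BlockEstimate.
Variable R : realType.
Notation mu := (@lebesgue_measure R).
Notation tau := (2 * pi : R).
Implicit Types (b u g : R -> R) (x th p d h : R) (M N m n r k l : nat).

Let tau_gt0 : 0 < tau := tau_gt0 R.
Hint Resolve tau_gt0 : core.

Lemma measurable_diff2 h u : measurable_fun setT u -> measurable_fun setT (diff2 h u).
Proof.
move=> mu_; apply: measurable_funB; first apply: measurable_funB.
- exact: measurable_funM.
- by apply: measurableT_comp => //; exact: measurable_shift.
- by apply: measurableT_comp => //; exact: measurable_shift.
Qed.

Lemma measurable_iter_diff2 h u r : measurable_fun setT u -> measurable_fun setT (iter r (diff2 h) u).
Proof. by move=> mu_; elim: r => //= r; exact: measurable_diff2. Qed.

Lemma periodic_diff2 h u : is_periodic u -> is_periodic (diff2 h u).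
Proof. by move=> pu x; rewrite /diff2 pu !(addrAC x tau) !pu. Qed.

Lemma periodic_iter_diff2 h u r : is_periodic u -> is_periodic (iter r (diff2 h) u).
Proof. by move=> pu; elim: r => //= r; exact: periodic_diff2. Qed.

Lemma bwd_diff2 d h u : bwd d (diff2 h u) = diff2 h (bwd d u).
Proof. by apply/funext => x; rewrite /bwd /diff2 !(addrAC x (- d)); ring. Qed.

Lemma iter_bwd_diff2 d h u m r :
  iter m (bwd d) (iter r (diff2 h) u) = iter r (diff2 h) (iter m (bwd d) u).
Proof.
elim: r => //= r <-; elim: m (iter r (diff2 h) u) => //= m IH v.
by rewrite IH bwd_diff2.
Qed.

(** The symmetric difference is minus a translated double backward difference, and the integral is
    translation invariant. *)
Lemma Np_diff2 p h u : measurable_fun setT u -> is_periodic u ->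
  Np p (diff2 h u) = Np p (bwd h (bwd h u)).
Proof.
move=> mu_ pu; rewrite -(NpN p (diff2 h u)).
rewrite -(@Np_shift _ p (bwd h (bwd h u)) h); last 2 first.
- by do 2 apply: measurable_bwd.
- by do 2 apply: periodic_bwd.
by apply: eq_Np => x; rewrite /diff2 /bwd addrK; ring.
Qed.

Lemma Np_iter_diff2 p h u r : measurable_fun setT u -> is_periodic u ->
  Np p (iter r (diff2 h) u) = Np p (iter r.*2 (bwd h) u).
Proof.
elim: r u => [|r IH] u mu_ pu; first by [].
rewrite doubleS /=.
rewrite Np_diff2; [|exact: measurable_iter_diff2|exact: periodic_iter_diff2].
rewrite -[bwd h (bwd h (iter r _ u))]/(iter 2 (bwd h) (iter r (diff2 h) u)).
rewrite iter_bwd_diff2 IH /=; [|by do 2 apply: measurable_bwd|by do 2 apply: periodic_bwd].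
by rewrite -[bwd h (bwd h u)]/(iter 2 (bwd h) u) -iterD addn2 /=.
Qed.

Lemma Np_diff2_le p h u c : 0 < p -> p <= 1 -> measurable_fun setT u -> is_periodic u ->
  (Np p u <= c%:E)%E -> (Np p (diff2 h u) <= (4 * c)%:E)%E.
Proof.
move=> p0 p1 mu_ pu uc.
have bwd_le v c' : measurable_fun setT v -> is_periodic v -> (Np p v <= c'%:E)%E ->
    (Np p (bwd h v) <= (2 * c')%:E)%E.
  move=> mv pv vc; rewrite (_ : 2 * c' = c' + c'); last by ring.
  rewrite EFinD; apply: le_trans (leeD vc vc).
  rewrite -{2}(Np_shift p (- h) mv pv) -(NpN p (fun x => v (x - h))).
  apply: NpD => //; apply: measurable_funN; apply: measurableT_comp => //.
  exact: measurable_shift.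
rewrite Np_diff2// (_ : 4 * c = 2 * (2 * c)); last by ring.
by apply: (bwd_le); [exact: measurable_bwd|exact: periodic_bwd|exact: bwd_le].
Qed.

Lemma Np_iter_diff2_le p h u c r : 0 < p -> p <= 1 -> measurable_fun setT u -> is_periodic u ->
  (Np p u <= c%:E)%E -> (Np p (iter r (diff2 h) u) <= (4 ^+ r * c)%:E)%E.
Proof.
move=> p0 p1 mu_ pu uc; elim: r => [|r IH]; first by rewrite mul1r.
rewrite exprS -mulrA; apply: Np_diff2_le => //=.
  exact: measurable_iter_diff2.
exact: periodic_iter_diff2.
Qed.

Lemma Np1_iter_diff2_finite h u r : measurable_fun setT u -> is_periodic u ->
  (Np 1 u < +oo)%E -> (Np 1 (iter r (diff2 h) u) < +oo)%E.
Proof.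
move=> mu_ pu fu.
have E : Np 1 u = (fine (Np 1 u))%:E by rewrite fineK// ge0_fin_numE ?Np_ge0.
have := @Np_iter_diff2_le 1 h u (fine (Np 1 u)) r ltr01 (lexx _) mu_ pu.
by rewrite -E => /(_ (lexx _)) /le_lt_trans; apply; rewrite ltry.
Qed.

(** 2^(l (1 - p)): up to tau^p, the number of nodes on level l times the p-th power of the step. *)
Definition dyadic_weight p l : R := (2 ^ l)%N%:R `^ (1 - p).

Lemma dyadic_weight_ge0 p l : 0 <= dyadic_weight p l.
Proof. exact: powR_ge0. Qed.

Lemma dyadic_step_weight p l :
  (tau / (2 ^ l)%N%:R) `^ p * (2 ^ l)%N%:R = tau `^ p * dyadic_weight p l.
Proof.
have n0 : 0 < (2 ^ l)%N%:R :> R by rewrite ltr0n expn_gt0.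
rewrite powRM ?(ltW tau_gt0) ?invr_ge0 ?(ltW n0)// -mulrA; congr (_ * _).
rewrite /dyadic_weight powRB; last by rewrite (gt_eqF n0) implybT.
by rewrite powRr1 ?(ltW n0)// mulrC -powR_inv1 ?(ltW n0)// -powRrM mulN1r powRN.
Qed.

Lemma tau_le32 : tau <= 32.
Proof. by have := pihalf_lt2 R; lra. Qed.

(** Levels start at k + 5 because tau <= 2^5. Then j further levels shrink the scaled step to at
    most 2^-j; m p >= 2 gives 2^(-2j), against a growth of the weight by at most 2^j. *)
Lemma dyadic_decay p m k j : 0 < p -> p <= 1 -> 2 <= m%:R * p ->
  dyadic_weight p (k + 5 + j) * (((2 ^ k)%N%:R * (tau / (2 ^ (k + 5 + j))%N%:R)) ^+ m) `^ p
    <= dyadic_weight p (k + 5) * (1 / 2) ^+ j.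
Proof.
move=> p0 p1 mp; set n := (2 ^ j)%N%:R : R.
have n1 : 1 <= n by rewrite ler1n expn_gt0.
have n0 : 0 < n by exact: lt_le_trans ltr01 n1.
have k0 : 0 < (2 ^ k)%N%:R :> R by rewrite ltr0n expn_gt0.
have -> : dyadic_weight p (k + 5 + j) = dyadic_weight p (k + 5) * n `^ (1 - p).
  by rewrite /dyadic_weight expnD natrM powRM.
rewrite -mulrA ler_wpM2l ?dyadic_weight_ge0//.
have -> : (2 ^ k)%N%:R * (tau / (2 ^ (k + 5 + j))%N%:R) = tau / 32 / n.
  rewrite expnD natrM expnD natrM -/n (_ : (2 ^ 5)%N = 32%N)//.
  by field; rewrite !gt_eqF.
have c0 : 0 <= tau / 32 / n by rewrite !divr_ge0// ltW.
have c1 : tau / 32 / n <= n^-1.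
  rewrite -[leRHS]mul1r ler_wpM2r ?invr_ge0 ?(ltW n0)//.
  by rewrite ler_pdivrMr// mul1r tau_le32.
have ni0 : 0 < n^-1 by rewrite invr_gt0.
have ni1 : n^-1 <= 1 by rewrite invf_le1.
have h1 : ((tau / 32 / n) ^+ m) `^ p <= n^-1 ^+ 2.
  rewrite -powR_mulrn// -powRrM -(powR_mulrn 2 (ltW ni0)).
  apply: le_trans (le_powRl _ c0 c1) _; first by rewrite (le_trans _ mp).
  by apply: ger_powR; rewrite ?ni0.
have h2 : n `^ (1 - p) <= n.
  by rewrite -[leRHS]powRr1 ?(ltW n0)//; apply: ler_powR => //; lra.
apply: le_trans (ler_pM (powR_ge0 _ _) (powR_ge0 _ _) h2 h1) _.
rewrite expr2 mulrA divff ?gt_eqF// mul1r /n natrX div1r exprVn.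
by [].
Qed.

Lemma sum_half n0 L : (n0 <= L)%N -> \sum_(n0 <= l < L) (1 / 2 : R) ^+ (l.+1 - n0) <= 1.
Proof.
move=> nL; suff -> : \sum_(n0 <= l < L) (1 / 2 : R) ^+ (l.+1 - n0) = 1 - (1 / 2) ^+ (L - n0).
  by rewrite gerBl exprn_ge0.
rewrite -(subnKC nL); elim: (L - n0)%N => [|j IH]; first by rewrite addn0 big_geq// subnn subrr.
rewrite addnS big_nat_recr ?leq_addr//= IH -addnS !addKn exprS.
by set t := _ ^+ j; field.
Qed.

(** The coarsest grid has the step of the factored difference, so the grid power of G there is a
    difference norm of g. On finer grids either the kernel is differenced, with geometric decay
    against that same norm, or g is differenced at the step of the grid. *)
Lemma block_estimate p r M b : 0 < p -> p <= 1 -> 2 <= (r.*2)%:R * p -> 1 <= M%:R * p ->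
  smooth_on setT M.*2 b -> (forall y, ~ (-2 <= y <= 2) -> b y = 0) ->
  exists2 C, 0 < C & forall k th g (w : nat -> R) W,
    measurable_fun setT g -> is_periodic g -> (Np 1 g < +oo)%E ->
    (forall l, (k + 5 <= l)%N ->
      (Np p (iter r.*2 (bwd (tau / (2 ^ l)%N%:R)) g) <= (w l)%:E)%E) ->
    (forall L, \sum_(k + 5 <= l < L) dyadic_weight p l * w l <= W) ->
    (Np p (conv (trig_kernel M b (2 ^ k) th) (iter r (diff2 (tau / (2 ^ (k + 5))%N%:R)) g)) <=
      (C * ((2 ^ k)%N%:R `^ (p - 1) * W))%:E)%E.
Proof.
move=> p0 p1 rp Mp sb b0; set m := r.*2 in rp *.
have [C0 C0_gt0 hC] := trig_kernel_Np m p0 Mp sb b0.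
have le22 : -2 <= 2 :> R by lra.
have [B1 B1_gt0 hB1] := smooth_support_bounded le22 b0 (smooth_on_leq (leq0n _) sb).
have [B2 B2_gt0 hB2] : exists2 B2, 0 < B2 & derive_bounded 0 (fun=> B2) (fun y => y * b y).
  apply: (smooth_support_bounded le22); first by move=> y hy; rewrite b0// mulr0.
  by apply: smooth_on_mul; [exact: smooth_on_id|exact: smooth_on_leq (leq0n _) sb].
pose D : R := 3 ^+ (m + m).
have D0 : 0 <= D by rewrite exprn_ge0.
(* Three contributions: the coarsest grid; the geometric sum over kernel differences, at most 1; the
   differences of G, where commuting with [diff2] costs 4^r. *)
pose E : R := 1 + (D + D * 4 ^+ r).
have E_gt0 : 0 < E by rewrite ltr_pwDl// addr_ge0// mulr_ge0// exprn_ge0.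
exists (tau `^ p * C0 * E / tau).
  by rewrite !mulr_gt0 ?powR_gt0 ?invr_gt0.
move=> k th g w W mg pg fg gw HW; set N := (2 ^ k)%N.
have N0 : (0 < N)%N by rewrite expn_gt0.
have N0' : 0 < N%:R :> R by rewrite ltr0n.
set l0 := (k + 5)%N in gw HW *; set h := tau / (2 ^ l0)%N%:R.
set G := iter r (diff2 h) g; set A := trig_kernel M b N th.
have [hA hA'] := hC N th N0.
set q := N%:R `^ (p - 1) in hA hA' *.
have q0 : 0 <= q by exact: powR_ge0.
have w0 l : (l0 <= l)%N -> 0 <= w l.
  by move=> hl; rewrite -lee_fin (le_trans (Np_ge0 p _) (gw l hl)).
pose d l : R := tau / (2 ^ l)%N%:R.
have d0 l : 0 <= d l by rewrite divr_ge0// ltW.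
have Nd l : (l0 <= l)%N -> N%:R * d l <= 1.
  move=> hl; have h2 : 0 < (2 ^ l)%N%:R :> R by rewrite ltr0n expn_gt0.
  rewrite /d mulrA ler_pdivrMr// mul1r.
  apply: (@le_trans _ _ (N%:R * 32)); first by rewrite ler_wpM2l ?(ltW N0')// tau_le32.
  rewrite -natrM ler_nat /N (_ : 32%N = (2 ^ 5)%N)// -expnD leq_exp2l//.
have mG : measurable_fun setT G by exact: measurable_iter_diff2.
have pG : is_periodic G by exact: periodic_iter_diff2.
have fG : (Np 1 G < +oo)%E by exact: Np1_iter_diff2_finite.
(* The hypothesis on partial sums, read for a single level. *)
have GW : dyadic_weight p l0 * w l0 <= W.
  by have := HW l0.+1; rewrite big_nat1.
have W0 : 0 <= W by apply: le_trans GW; rewrite mulr_ge0 ?dyadic_weight_ge0 ?w0.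
rewrite (_ : _ * (q * W) = tau `^ p * C0 * E * (q * W) / tau); last by ring.
pose a' l : R := C0 * (((N%:R * d l) ^+ m) `^ p * q).
apply: (@Np_conv_le _ p m l0 A G (C0 * q) ((2 * (M + 3) + 1)%:R * N%:R * B1)
  (N%:R * ((2 * (M + 3) + 1)%:R * N%:R * B2)) (w l0) _ a' (fun l => 4 ^+ r * w l)) => //.
- exact: measurable_trig_kernel.
- exact: periodic_trig_kernel.
- by move=> y; exact: trig_kernel_le.
- exact: trig_kernel_lipschitz.
- exact: measurable_conv_trig_kernel.
- by move=> l hl; apply: hA'; [exact: d0|exact: (Nd _ (ltnW hl))].
- by rewrite Np_iter_diff2//; exact: gw.
- move=> l hl; rewrite iter_bwd_diff2; apply: Np_iter_diff2_le => //.
  + exact: measurable_iter_bwd.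
  + exact: periodic_iter_bwd.
  + by apply: gw; exact: ltnW.
move=> L l0L; set T := tau `^ p.
have T0 : 0 <= T by exact: powR_ge0.
pose X := T * C0 * q.
have X0 : 0 <= X by rewrite mulr_ge0// mulr_ge0// ltW.
apply: (@le_trans _ _ (X * (dyadic_weight p l0 * w l0) +
  (\sum_(l0 <= l < L) (X * D * W * (1 / 2) ^+ (l.+1 - l0) +
    X * D * 4 ^+ r * (dyadic_weight p l.+1 * w l.+1))))).
  rewrite lerD//.
    have dw := dyadic_step_weight p l0; rewrite -/T in dw.
    set y := (tau / (2 ^ l0)%N%:R) `^ p in dw *.
    have -> : y * (C0 * q * ((2 ^ l0)%N%:R * w l0)) = (y * (2 ^ l0)%N%:R) * (C0 * q * w l0) by ring.
    by rewrite dw le_eqVlt; apply/orP; left; apply/eqP; rewrite /X; ring.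
  rewrite !big_nat; apply: ler_sum => l /andP[l0l _].
  have dw := dyadic_step_weight p l.+1; rewrite -/T in dw.
  set y := (tau / (2 ^ l.+1)%N%:R) `^ p in dw *.
  have -> : y * (D * ((2 ^ l.+1)%N%:R * (a' l.+1 * w l0 + C0 * q * (4 ^+ r * w l.+1)))) =
     (y * (2 ^ l.+1)%N%:R) * D * (a' l.+1 * w l0 + C0 * q * (4 ^+ r * w l.+1)) by ring.
  rewrite dw.
  have e : (k + 5 + (l.+1 - l0) = l.+1)%N by rewrite subnKC// leqW.
  have hz := @dyadic_decay p m k (l.+1 - l0) p0 p1 rp; rewrite e in hz.
  pose z := ((N%:R * d l.+1) ^+ m) `^ p; pose t : R := (1 / 2) ^+ (l.+1 - l0).
  have t0 : 0 <= t by rewrite exprn_ge0.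
  have {}hz : dyadic_weight p l.+1 * z <= dyadic_weight p l0 * t by exact: hz.
  have -> : a' l.+1 = C0 * (z * q) by [].
  rewrite -/t; clearbody z t.
  have XD : 0 <= X * D by rewrite mulr_ge0.
  have u1 := ler_wpM2l XD (ler_wpM2r (w0 l0 (leqnn _)) hz).
  have u2 := ler_wpM2r t0 (ler_wpM2l XD GW).
  have e1 : T * dyadic_weight p l.+1 * D * (C0 * (z * q) * w l0 + C0 * q * (4 ^+ r * w l.+1)) =
    X * D * (dyadic_weight p l.+1 * z * w l0) + X * D * 4 ^+ r * (dyadic_weight p l.+1 * w l.+1).
    by rewrite /X; ring.
  have e2 : X * D * (dyadic_weight p l0 * t * w l0) = X * D * (dyadic_weight p l0 * w l0) * t by ring.
  by rewrite e1 lerD2r (le_trans u1)// e2.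
rewrite big_split/= -!mulr_sumr.
have s1 := ler_wpM2l (mulr_ge0 (mulr_ge0 X0 D0) W0) (sum_half l0L).
have s2 : \sum_(l0 <= l < L) dyadic_weight p l.+1 * w l.+1 <= W.
  have := HW L.+1; rewrite big_nat_recl//; apply: le_trans.
  by rewrite lerDr mulr_ge0 ?dyadic_weight_ge0// w0.
have XD : 0 <= X * D * 4 ^+ r by rewrite mulr_ge0 ?exprn_ge0// mulr_ge0.
have s3 := ler_wpM2l XD s2.
have s4 := ler_wpM2l X0 GW.
by rewrite -/T (_ : T * C0 * E * (q * W) = X * W * E) /X /E; [rewrite -/X; lra|ring].
Qed.

End BlockEstimate.

(** * De la Vallee-Poussin means and their dyadic differences *)

Section ValleePoussin.
Variable R : realType.
Notation mu := (@lebesgue_measure R).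
Notation tau := (2 * pi : R).
Implicit Types (b u f g G : R -> R) (x z th h : R) (M N n r k : nat).

Let tau_gt0 : 0 < tau := tau_gt0 R.
Hint Resolve tau_gt0 : core.
Let mC : measurable (circle R) := @measurable_circle R.
Hint Resolve mC : core.

Lemma Rcircle_shift u h : measurable_fun setT u -> is_periodic u -> (Np 1 u < +oo)%E ->
  \int[mu]_(y in circle R) u (y + h) = \int[mu]_(y in circle R) u y.
Proof.
move=> mu_ pu fu.
have ms : measurable_fun setT (fun y : R => u (y + h)).
  by apply: measurableT_comp => //; exact: measurable_shift.
have fs : (Np 1 (fun y : R => u (y + h)%R) < +oo)%E by rewrite Np_shift.
rewrite (Rcircle_partition h (ltn0Sn 0) mu_ pu fu).
rewrite (Rcircle_partition 0 (ltn0Sn 0) ms (is_periodic_shift h pu) fs).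
by rewrite !big_nat1; apply: eq_Rintegral => s _; congr u; ring.
Qed.

Lemma mode_shift (z : int) th h g x : measurable_fun setT g -> is_periodic g -> (Np 1 g < +oo)%E ->
  mode z%:~R th (fun y => g (y + h)) x = mode z%:~R (th + z%:~R * h) g x.
Proof.
move=> mg pg fg; rewrite /mode /conv.
pose F y := cos (z%:~R * (x - y) + (th + z%:~R * h)) * g y.
have mF : measurable_fun setT F.
  apply: measurable_funM => //.
  apply: (measurableT_comp (measurable_cos_affine z%:~R (th + z%:~R * h))).
  by apply: measurable_funB => //; exact: measurable_cst.
have pF : is_periodic F.
  move=> y; rewrite /F pg; congr (_ * _).
  by rewrite -(cos_periodic_int z (x - (y + tau))); congr (cos (_ * _ + _)); ring.
have fF : (Np 1 F < +oo)%E.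
  apply: le_lt_trans fg; apply: le_Np => // y.
  by rewrite normrM ler_piMl// cos_max.
rewrite -[RHS](Rcircle_shift h mF pF fF); apply: eq_Rintegral => y _.
by rewrite /F; congr (cos _ * _); ring.
Qed.

Lemma circle_integrableD u G : mu.-integrable (circle R) (EFin \o u) ->
  mu.-integrable (circle R) (EFin \o G) ->
  mu.-integrable (circle R) (EFin \o (fun x => u x + G x)).
Proof. by move=> iu iG; apply: (integrableD _ iu iG); exact: measurable_circle. Qed.

(** A translation of the function is a change of phase; the addition formulas then make each
    frequency an eigenspace. *)
Lemma mode_diff2 (z : int) th h g x : measurable_fun setT g -> is_periodic g -> (Np 1 g < +oo)%E ->
  mode z%:~R th (diff2 h g) x = (2 - 2 * cos (z%:~R * h)) * mode z%:~R th g x.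
Proof.
move=> mg pg fg.
have ms (c : R) : measurable_fun setT (fun y : R => g (y + c)).
  by apply: measurableT_comp => //; exact: measurable_shift.
have fs (c : R) : (Np 1 (fun y : R => g (y + c)%R) < +oo)%E by rewrite Np_shift.
have ii v : measurable_fun setT v -> (Np 1 v < +oo)%E ->
    mu.-integrable (circle R) (EFin \o (fun y => cos (z%:~R * (x - y) + th) * v y)).
  move=> mv fv; apply: (@integrable_bounded_mul _ (fun y => cos (z%:~R * (x - y) + th)) v 1) => //.
    apply: (measurableT_comp (measurable_cos_affine z%:~R th)).
    by apply: measurable_funB => //; exact: measurable_cst.
  by move=> y; exact: cos_max.
have -> : mode z%:~R th (diff2 h g) x = 2 * mode z%:~R th g x
    + (-1 * mode z%:~R th (fun y => g (y + h)) x + -1 * mode z%:~R th (fun y => g (y + - h)) x).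
  have i1 := ii _ mg fg; have i2 := ii _ (ms h) (fs h); have i3 := ii _ (ms (- h)) (fs (- h)).
  rewrite /mode /conv -(circle_RintegralZ 2 i1) -(circle_RintegralZ (-1) i2) -(circle_RintegralZ (-1) i3).
  have s2 := circle_integrable_scale (-1) i2; have s3 := circle_integrable_scale (-1) i3.
  rewrite -(circle_RintegralD s2 s3).
  rewrite -(circle_RintegralD (circle_integrable_scale 2 i1) (circle_integrableD s2 s3)).
  by apply: eq_Rintegral => y _; rewrite /diff2; ring.
rewrite (mode_shift z th h x mg pg fg) (mode_shift z th (- h) x mg pg fg).
rewrite !(modeE _ _ _ mg fg).
have -> : z%:~R * x + (th + z%:~R * h) = (z%:~R * x + th) + z%:~R * h by ring.
have -> : z%:~R * x + (th + z%:~R * - h) = (z%:~R * x + th) - z%:~R * h by ring.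
move: (Rintegral _ _ _) (Rintegral _ _ _) (z%:~R * x + th) (z%:~R * h) => I1 I2 X Z.
by rewrite cosD cosB sinD sinB; ring.
Qed.

Lemma mode_iter_diff2 (z : int) th h g x r : measurable_fun setT g -> is_periodic g -> (Np 1 g < +oo)%E ->
  mode z%:~R th (iter r (diff2 h) g) x = (2 - 2 * cos (z%:~R * h)) ^+ r * mode z%:~R th g x.
Proof.
move=> mg pg fg; elim: r => [|r IH]; first by rewrite mul1r.
rewrite exprS -mulrA -IH /=.
exact: (mode_diff2 z th h x (measurable_iter_diff2 h r mg) (periodic_iter_diff2 h r pg)
  (Np1_iter_diff2_finite h r mg pg fg)).
Qed.

Lemma modeN z f x : mode (- z) 0 f x = mode z 0 f x.
Proof.
rewrite /mode /conv; apply: eq_Rintegral => y _.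
by rewrite !addr0 mulNr cosN.
Qed.

Lemma sum_symmetric (F : R -> R) n :
  \sum_(0 <= i < n.*2.+1) F (i%:R - n%:R) =
  F 0 + \sum_(1 <= j < n.+1) (F j%:R + F (- j%:R)).
Proof.
have n2 : (n <= n.*2.+1)%N by rewrite -addnn leqW// leq_addr.
rewrite (big_cat_nat (leq0n n) n2)/=.
rewrite [X in _ + X]big_ltn; last by rewrite ltnS -addnn leq_addr.
rewrite subrr addrCA; congr (_ + _); rewrite big_split/= addrC; congr (_ + _).
  rewrite -[n.+1 in LHS]add1n (_ : n.*2.+1 = (n.+1 + n)%N); last by rewrite -addnn addSn.
  rewrite big_addn addnK; apply: eq_bigr => i _; congr F.
  by rewrite natrD addrK.
rewrite big_nat_rev/= add0n big_add1/=; apply: eq_big_nat => i /andP[_ ni].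
by congr F; rewrite natrB//; ring.
Qed.

(** Lets the kernels at scales N and 2 N be summed over a common range. *)
Lemma sum_extend_zero (F : nat -> R) n m : (n <= m)%N -> (forall j, (n < j)%N -> F j = 0) ->
  \sum_(1 <= j < n.+1) F j = \sum_(1 <= j < m.+1) F j.
Proof.
move=> nm F0; rewrite [RHS](@big_cat_nat _ _ _ n.+1)//= [X in _ + X]big_nat_cond.
by rewrite [X in _ + X]big1 ?addr0// => j /andP[/andP[nj _] _]; exact: F0.
Qed.

Lemma conv_bump_kernel M n N f x J : (0 < N)%N -> ((M + 3) * N <= J)%N ->
  measurable_fun setT f -> (Np 1 f < +oo)%E ->
  conv (trig_kernel M (bump n) N 0) f x =
  mode 0 0 f x + \sum_(1 <= j < J.+1) 2 * bump n (j%:R / N%:R) * mode j%:R 0 f x.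
Proof.
move=> N0 LJ mf ff; rewrite conv_trig_kernel//.
have N0' : 0 < N%:R :> R by rewrite ltr0n.
rewrite (sum_symmetric (fun t => bump n (t / N%:R) * mode t 0 f x)).
rewrite mul0r bump_eq1 ?normr0// mul1r; congr (_ + _).
rewrite -(sum_extend_zero LJ) => [|j hj].
  by apply: eq_bigr => j _; rewrite mulNr bumpN modeN; ring.
rewrite bump_eq0 ?mulr0 ?mul0r// ger0_norm ?divr_ge0//.
by rewrite ler_pdivlMr// mul1r ler_nat; nia.
Qed.

Lemma conv_ring_kernel M b N th G x J : (0 < N)%N -> ((M + 3) * N <= J)%N ->
  (forall y, ~ (1 / 2 <= y <= 2) -> b y = 0) ->
  measurable_fun setT G -> (Np 1 G < +oo)%E ->
  conv (trig_kernel M b N th) G x = \sum_(1 <= j < J.+1) b (j%:R / N%:R) * mode j%:R th G x.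
Proof.
move=> N0 LJ b0 mG fG; rewrite conv_trig_kernel//.
have N0' : 0 < N%:R :> R by rewrite ltr0n.
rewrite (sum_symmetric (fun t => b (t / N%:R) * mode t th G x)).
rewrite mul0r b0 ?mul0r ?add0r; last by lra.
rewrite -(sum_extend_zero LJ) => [|j hj].
  apply: eq_bigr => j _; have jN : 0 <= j%:R / N%:R :> R by rewrite divr_ge0.
  have -> : b (- j%:R / N%:R) = 0 by apply: b0; rewrite mulNr; lra.
  by rewrite mul0r addr0.
rewrite b0 ?mul0r//; apply/negP; rewrite negb_and -!ltNge; apply/orP; right.
by rewrite ltr_pdivlMr// -natrM ltr_nat; nia.
Qed.

(** The bump is 1 at frequency 0, so division by tau reproduces constants. Regularity 2M is what M
    summations by parts consume. *)
Definition vallee M N f x : R := tau^-1 * conv (trig_kernel M (bump M.*2) N 0) f x.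

(* f is, up to a constant, the fractional integral of order alpha of g. *)
Definition mode_integral (alpha : R) f g := forall (j : nat) x, (0 < j)%N ->
  mode j%:R 0 f x = j%:R `^ (- alpha) * mode j%:R (- (alpha * pi / 2)) g x.

(** Compared frequency by frequency: the two bumps leave the ring cutoff, and the eigenvalue of D^r
    cancels the divided factor of the symbol. The frequencies j and -j are merged, hence the 2. *)
Lemma vallee_block M N r alpha h f g x : (0 < N)%N -> 0 < N%:R * h -> 4 * (N%:R * h) <= pi ->
  measurable_fun setT f -> (Np 1 f < +oo)%E ->
  measurable_fun setT g -> is_periodic g -> (Np 1 g < +oo)%E ->
  mode_integral alpha f g ->
  vallee M (2 * N) f x - vallee M N f x =
  (2 / tau * N%:R `^ (- alpha)) *
    conv (trig_kernel M (block_symbol M.*2 alpha (N%:R * h) r) N (- (alpha * pi / 2)))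
      (iter r (diff2 h) g) x.
Proof.
move=> N0 h0 hpi mf ff mg pg fg fgE.
have N0' : 0 < N%:R :> R by rewrite ltr0n.
have Nn0 : N%:R != 0 :> R by rewrite gt_eqF.
pose J := ((M + 3) * (2 * N))%N.
have LJ : ((M + 3) * N <= J)%N by rewrite /J; nia.
rewrite /vallee (@conv_bump_kernel M _ (2 * N) f x J)//; last by rewrite muln_gt0.
rewrite (@conv_bump_kernel M _ N f x J)//.
rewrite (conv_ring_kernel _ x N0 LJ (@block_symbol_eq0 _ _ _ _ _)
  (measurable_iter_diff2 h r mg) (Np1_iter_diff2_finite h r mg pg fg)).
rewrite -mulrBr opprD addrACA subrr add0r -sumrB mulr_sumr mulr_sumr.
apply: eq_big_nat => j /andP[j0 _].
have j0' : 0 < j%:R :> R by rewrite ltr0n.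
have x0 : 0 <= j%:R / N%:R :> R by rewrite divr_ge0.
have := mode_iter_diff2 j (- (alpha * pi / 2)) h x r mg pg fg; rewrite -!pmulrn => ->.
rewrite /block_symbol (_ : N%:R * h * (j%:R / N%:R) = j%:R * h); last by field.
rewrite fgE//.
have -> : bump M.*2 (j%:R / (2 * N)%:R) = bump M.*2 (j%:R / N%:R / 2) :> R.
  by congr bump; rewrite natrM; field.
have -> : (j%:R / N%:R) `^ (- alpha) = j%:R `^ (- alpha) / N%:R `^ (- alpha) :> R.
  by rewrite powRM ?invr_ge0// -powR_inv1// powRAC powR_inv1// powR_ge0.
have pN : N%:R `^ (- alpha) != 0 :> R by rewrite gt_eqF// powR_gt0.
(* Off the ring the two bumps agree and both sides are 0. *)
rewrite ring_cutoffE//; have [xs|xs] := pselect (1 / 2 <= (j%:R / N%:R : R) <= 2); last first.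
  have := ring_cutoff_eq0 M.*2 xs; rewrite ring_cutoffE// => /subr0_eq ->.
  by ring.
(* On the ring the eigenvalue 2 - 2 cos (j h) is positive and may be cancelled. *)
have jh : 0 < j%:R * h <= pi.
  move/andP: xs => [x1 x2].
  have -> : j%:R * h = j%:R / N%:R * (N%:R * h) by field.
  rewrite mulr_gt0 ?divr_gt0//=; apply: le_trans hpi.
  rewrite ler_wpM2r ?(ltW h0)//; lra.
have := two_sub_cos_gt0 jh; move: (2 - 2 * cos _) => s s0.
have sr : s ^+ r != 0 by rewrite expf_neq0// gt_eqF.
by move: (tau^-1) => q; field; rewrite sr pN.
Qed.

End ValleePoussin.

(** * The estimate for real functions *)

Section ApproximateIdentity.
Variable R : realType.
Notation mu := (@lebesgue_measure R).
Notation tau := (2 * pi : R).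
Implicit Types (f g : R -> R) (x : R) (M N n k : nat).

Let tau_gt0 : 0 < tau := tau_gt0 R.
Hint Resolve tau_gt0 : core.
Let mC : measurable (circle R) := @measurable_circle R.
Hint Resolve mC : core.

Lemma Np1_one : Np 1 (fun _ : R => 1 : R) = tau%:E.
Proof.
rewrite /Np (@eq_integral _ _ _ mu _ (fun=> 1%:E)) ?integral_circle_cst ?mul1r//.
by move=> x _; rewrite normr1 powR1.
Qed.

(** A shift by pi / j leaves a constant unchanged but reverses the sign of its j-th mode. *)
Lemma mode_one (j : nat) x : (0 < j)%N -> mode j%:R 0 (fun _ : R => 1 : R) x = 0.
Proof.
move=> j0; have j0' : j%:R != 0 :> R by rewrite pnatr_eq0 -lt0n.
have m1 : measurable_fun setT (fun _ : R => 1 : R) by exact: measurable_cst.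
have p1 : is_periodic (fun _ : R => 1 : R) by [].
have f1 : (Np 1 (fun _ : R => 1%R : R) < +oo)%E by rewrite Np1_one ltry.
have := mode_shift j 0 (pi / j%:R) x m1 p1 f1; rewrite -pmulrn.
rewrite (_ : j%:R * (pi / j%:R) = pi); last by field.
rewrite !(modeE _ _ _ m1 f1) add0r addr0 sinDpi cosDpi !mulNr => h.
by apply/eqP; rewrite -[_ == 0](mulrn_eq0 _ 2) mulr2n {1}h -opprD addNr.
Qed.

Lemma integral_bump_kernel M n N x : (0 < N)%N ->
  \int[mu]_(y in circle R) trig_kernel M (bump n) N 0 (x - y) = tau.
Proof.
move=> N0; have m1 : measurable_fun setT (fun _ : R => 1 : R) by exact: measurable_cst.
have f1 : (Np 1 (fun _ : R => 1%R : R) < +oo)%E by rewrite Np1_one ltry.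
have := @conv_bump_kernel R M n N _ x ((M + 3) * N) N0 (leqnn _) m1 f1.
rewrite big_nat_cond big1 => [|j /andP[/andP[j0 _] _]]; last by rewrite mode_one ?mulr0.
rewrite addr0 => h.
transitivity (conv (trig_kernel M (bump n) N 0) (fun=> 1) x).
  by apply: eq_Rintegral => y _; rewrite mulr1.
rewrite h /mode /conv (@eq_Rintegral _ _ _ mu _ (fun=> 1)).
  by rewrite /Rintegral integral_circle_cst /= mul1r.
by move=> y _; rewrite mul0r addr0 cos0 mulr1.
Qed.

Lemma periodic_opp (u : R -> R) : is_periodic u -> is_periodic (fun t => u (- t)).
Proof. by move=> pu t; rewrite opprD -(pu (- t - tau)) subrK. Qed.

(** The kernel has integral tau, so f(x) may be put under the integral; a translation then recentres
    it at x. *)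
Lemma vallee_sub_le M N f x : (0 < N)%N ->
  measurable_fun setT f -> is_periodic f -> (Np 1 f < +oo)%E ->
  (`|f x - vallee M N f x|%:E <= (tau^-1)%:E *
    \int[mu]_(t in circle R)
      (`|trig_kernel M (bump M.*2) N 0 (- t)| * `|f (x + t) - f x|)%:E)%E.
Proof.
move=> N0 mf pf ff; set V := trig_kernel M (bump M.*2) N 0.
have mV : measurable_fun setT V by exact: measurable_trig_kernel.
have pV : is_periodic V by exact: periodic_trig_kernel.
have mVx : measurable_fun setT (fun y : R => V (x - y)).
  by apply: measurableT_comp => //; apply: measurable_funB => //; exact: measurable_cst.
have VB y : `|V y| <= (2 * (M + 3) + 1)%:R * N%:R * 1.
  apply: trig_kernel_le => // z; rewrite /bump /smooth_step normrM.
  have h t : `|pos_part t ^+ M.*2.+1 / (pos_part t ^+ M.*2.+1 + pos_part (1 - t) ^+ M.*2.+1)| <= 1 :> R.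
    have d0 := smooth_step_denom_gt0 M.*2 t.
    rewrite ger0_norm ?divr_ge0 ?exprn_ge0 ?pos_part_ge0 ?(ltW d0)//.
    by rewrite ler_pdivrMr// mul1r lerDl exprn_ge0// pos_part_ge0.
  by rewrite mulr_ile1.
have iVf := integrable_bounded_mul mVx (fun y => VB (x - y)) mf ff.
have f1 : (Np 1 (fun _ : R => 1%R : R) < +oo)%E by rewrite Np1_one ltry.
have iV := integrable_bounded_mul mVx (fun y => VB (x - y)) (measurable_cst (1 : R)) f1.
have tau0 : tau != 0 by rewrite gt_eqF.
have E : f x - vallee M N f x =
    tau^-1 * \int[mu]_(y in circle R) (f x * (V (x - y) * 1) + -1 * (V (x - y) * f y)).
  rewrite (circle_RintegralD (circle_integrable_scale (f x) iV) (circle_integrable_scale (-1) iVf)).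
  rewrite (circle_RintegralZ _ iV) (circle_RintegralZ _ iVf).
  rewrite (@eq_Rintegral _ _ _ mu _ (fun y => V (x - y)) (fun y => V (x - y) * 1)).
    rewrite integral_bump_kernel// /vallee /conv -/V mulN1r mulrBr mulrCA mulVf// mulr1.
    by [].
  by move=> y _; rewrite mulr1.
have iD := circle_integrableD (circle_integrable_scale (f x) iV) (circle_integrable_scale (-1) iVf).
rewrite E normrM ger0_norm ?invr_ge0 ?(ltW tau_gt0)// EFinM.
apply: lee_wpmul2l; first by rewrite lee_fin invr_ge0 ltW.
pose F t := (`|V (- t)| * `|f (x + t) - f x|)%:E.
have mF : measurable_fun setT F.
  apply/measurable_EFinP; apply: measurable_funM.
    by apply: measurableT_comp => //; apply: measurableT_comp.
  apply: measurableT_comp => //; apply: measurable_funB => //; apply: measurableT_comp => //.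
  exact: measurable_shiftl.
have pF : is_periodic F.
  move=> t; rewrite /F (periodic_opp pV) addrA pf//.
have F0 t : (0 <= F t)%E by rewrite lee_fin mulr_ge0.
rewrite -(circle_integral_shift (- x) mF F0 pF).
rewrite EFin_normr_Rintegral; [|exact: measurable_circle|exact: iD].
apply: le_trans (le_abse_integral _ _ _) _; first exact: measurable_circle.
  by apply: (measurable_int mu); exact: iD.
rewrite le_eqVlt; apply/orP; left; apply/eqP; apply: eq_integral => y _.
rewrite /F /= (_ : x + (y - x) = y); last by ring.
rewrite (_ : - (y - x) = x - y); last by ring.
by rewrite -normrM -[in RHS]normrN; congr (_%:E); congr (`|_|); ring.
Qed.

Lemma measurable_vallee M N f : measurable_fun setT f -> (Np 1 f < +oo)%E ->
  measurable_fun setT (vallee M N f).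
Proof.
move=> mf ff; rewrite (_ : vallee M N f = fun x => tau^-1 * conv (trig_kernel M (bump M.*2) N 0) f x).
  apply: measurable_funM; first exact: measurable_cst.
  exact: measurable_conv_trig_kernel.
by apply/funext => x.
Qed.

(** Approximate identity: for t near 0 modulo the period, translation is continuous in L_1;
    elsewhere the kernel is O(1/N). *)
Lemma vallee_cvg M f (e : R) : (0 < M)%N ->
  measurable_fun setT f -> is_periodic f -> (Np 1 f < +oo)%E -> 0 < e ->
  exists N0, forall N, (N0 <= N)%N -> (0 < N)%N ->
    (Np 1 (fun x => f x - vallee M N f x)%R <= e%:E)%E.
Proof.
move=> M0 mf pf ff e0.
have sb : smooth_on setT M.*2 (bump M.*2 : R -> R).
  rewrite (_ : bump M.*2 = fun x : R => bump M.*2 (1 * x + 0)); first exact: smooth_bump.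
  by apply/funext => x; rewrite mul1r addr0.
have b0 (y : R) : ~ (-2 <= y <= 2) -> bump M.*2 y = 0.
  by move=> h; apply: bump_eq0; rewrite leNgt ltr_norml; apply/negP; lra.
have [C C0 hC] := trig_kernel_decay sb b0.
pose A := fine (Np 1 f).
have fA : Np 1 f = A%:E by rewrite /A fineK// ge0_fin_numE ?Np_ge0.
have A0 : 0 <= A by rewrite -lee_fin -fA Np_ge0.
(* The kernel has L_1 norm at most C tau, so this translation error contributes e / 2 after
   normalisation. *)
have e1 : 0 < e / 2 / C by rewrite !divr_gt0.
have [d d0 hd] := continuous_translation mf pf ff e1.
pose d1 := Num.min d pi.
have pi0 := pi_gt0 R.
have d10 : 0 < d1 by rewrite lt_min d0.
have d1d : d1 <= d by rewrite ge_min lexx.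
have d1pi : d1 <= pi by rewrite ge_min lexx orbT.
(* Lower bound of 2 - 2 cos t at distance at least d1 from the multiples of the period. *)
pose eta := d1 ^+ 2 / 4.
have eta0 : 0 < eta by rewrite divr_gt0// exprn_gt0.
pose q := 2 * A * C / eta.
have q0 : 0 <= q by rewrite divr_ge0 ?(ltW eta0)// mulr_ge0 ?(ltW C0)// mulr_ge0.
exists (Num.bound (q / (e / 2))) => N hN N0.
have N0' : 0 < N%:R :> R by rewrite ltr0n.
pose V : R -> R := trig_kernel M (bump M.*2) N 0.
have mV : measurable_fun setT V by exact: measurable_trig_kernel.
pose W t := `|V (- t)|.
have mW : measurable_fun setT W.
  by apply: measurableT_comp => //; apply: measurableT_comp.
have W0 t : 0 <= W t by exact: normr_ge0.
pose om t := Np 1 (fun x => f (x + t) - f x)%R.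
have om_le t : (om t <= (2 * A)%:E)%E.
  have ms : measurable_fun setT (fun x : R => f (x + t)).
    by apply: measurableT_comp => //; exact: measurable_shift.
  apply: le_trans (NpD ltr01 (lexx 1) ms (measurable_funN mf)) _.
  by rewrite NpN (Np_shift 1 t mf pf) fA -EFinD lee_fin; lra.
have om_opp s : om (- s) = om s.
  have ms : measurable_fun setT (fun x : R => f (x - s) - f x).
    by apply: measurable_funB => //; apply: measurableT_comp => //; exact: measurable_shift.
  have ps : is_periodic (fun x => f (x - s) - f x).
    by move=> x; rewrite pf addrAC pf.
  rewrite /om -(Np_shift 1 s ms ps) -NpN.
  by apply: eq_Np => x; rewrite addrK opprB.
have om_tau s : om (tau - s) = om (- s).
  by apply: eq_Np => x; rewrite addrA (addrAC x) pf.
have mom : measurable_fun (circle R) om.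
  by apply: measurable_funTS; exact: measurable_Np1_translate.
have NW : (Np 1 W <= (C * tau)%:E)%E.
  have Mp : 1 <= M%:R * 1 :> R by rewrite mulr1 ler1n.
  have hW x : `|W x| <= C * kernel_weight M N x.
    rewrite /W normr_id; apply: le_trans (hC N 0 (- x) N0) _.
    by rewrite /kernel_weight cosN.
  have := Np_kernel_weight ltr01 Mp N0 (ltW C0) mW hW.
  by rewrite powRr1 ?(ltW C0)// subrr powRr0 mulr1.
(* The period is [0, tau), so its neighbourhood of 0 consists of two pieces, one at each end; on the
   second the shift is replaced by tau - t. *)
have key t : circle R t ->
    ((W t)%:E * om t <= (e / 2 / C)%:E * (W t)%:E + (q / N%:R)%:E)%E.
  rewrite /circle/= in_itv/= => /andP[t0 tt].
  have Wt0 : 0 <= W t by exact: normr_ge0.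
  have near (s : R) : om t = om s -> 0 <= s <= d ->
      ((W t)%:E * om t <= (e / 2 / C)%:E * (W t)%:E + (q / N%:R)%:E)%E.
    move=> -> sd; apply: (@le_trans _ _ ((e / 2 / C)%:E * (W t)%:E)%E).
      by rewrite muleC lee_wpmul2r ?lee_fin// hd.
    by rewrite leeDl// lee_fin divr_ge0.
  have [td|td] := leP t d1; first by apply: (near t) => //; rewrite t0 (le_trans td).
  have [td2|td2] := leP (tau - d1) t.
    apply: (near (tau - t)); last by apply/andP; split; lra.
    by rewrite (om_tau t) (om_opp t).
  have cos_le : eta <= 2 - 2 * cos t.
    have [tp|tp] := leP t pi.
      apply: le_trans (two_sub_cos_ge _); last by rewrite ger0_norm.
      by rewrite /eta ler_pM2r ?invr_gt0// ler_pXn2r ?nnegrE ?(ltW d10)// ltW.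
    have -> : cos t = cos (tau - t).
      by rewrite -(cosN (tau - t)) opprB -[RHS](cosD2pi (t - tau)) (mulr_natl pi 2) subrK.
    have ht : `|tau - t| <= pi by rewrite ger0_norm; lra.
    apply: le_trans (two_sub_cos_ge ht).
    by rewrite /eta ler_pM2r ?invr_gt0// ler_pXn2r ?nnegrE//; lra.
  (* One power of the denominator is enough here, and M > 0 provides it. *)
  have WC : W t <= C / (N%:R * eta).
    apply: le_trans (hC N 0 (- t) N0) _; rewrite cosN ler_wpM2l ?(ltW C0)//.
    set u := N%:R ^+ 2 * _.
    have u0 : N%:R ^+ 2 * eta <= u by rewrite ler_wpM2l// sqr_ge0.
    have u1 : 0 < N%:R ^+ 2 * eta by rewrite mulr_gt0// exprn_gt0.
    have u2 : 0 < 1 + u by rewrite ltr_wpDr// ltW// (lt_le_trans u1).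
    rewrite ler_pdivrMr ?exprn_gt0//.
    apply: (@le_trans _ _ ((N%:R * eta)^-1 * (N%:R ^+ 2 * eta))).
      rewrite le_eqVlt; apply/orP; left; apply/eqP.
      by field; rewrite !gt_eqF.
    have Ne0 : 0 <= (N%:R * eta)^-1 by rewrite invr_ge0 ltW// mulr_gt0.
    apply: (ler_wpM2l Ne0); apply: (@le_trans _ _ (1 + u)); first by lra.
    by rewrite ler_eXnr// lerDl; lra.
  apply: (@le_trans _ _ (q / N%:R)%:E); last first.
    by rewrite leeDr// -EFinM lee_fin mulr_ge0// ltW.
  apply: le_trans (lee_wpmul2l _ (om_le t)) _; first by rewrite lee_fin.
  rewrite -EFinM lee_fin; apply: (@le_trans _ _ (C / (N%:R * eta) * (2 * A))).
    by rewrite ler_wpM2r// mulr_ge0.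
  rewrite le_eqVlt; apply/orP; left; apply/eqP; rewrite /q.
  by field; rewrite !gt_eqF.
have mD : measurable_fun setT (fun x => f x - vallee M N f x).
  by apply: measurable_funB => //; exact: measurable_vallee.
rewrite Np1E.
pose H x : \bar R := (\int[mu]_(t in circle R) (W t * `|f (x + t) - f x|)%:E)%E.
have H0 x : (0 <= H x)%E by apply: integral_ge0 => t _; rewrite lee_fin (mulr_ge0 (W0 t)).
have mH : measurable_fun (circle R) H.
  apply: measurable_funTS.
  pose K (z : R * R) : \bar R := (\1_(circle R) z.2 * (W z.2 * `|f (z.1 + z.2) - f z.1|))%:E.
  have mK : measurable_fun setT K.
    apply/measurable_EFinP; apply: measurable_funM.
      apply: measurableT_comp; [exact: measurable_indic|exact: measurable_snd].
    apply: measurable_funM; first by apply: measurableT_comp => //; exact: measurable_snd.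
    apply: measurableT_comp => //; apply: measurable_funB.
      apply: measurableT_comp => //.
      by apply: measurable_funD; [exact: measurable_fst|exact: measurable_snd].
    by apply: measurableT_comp => //; exact: measurable_fst.
  have K0 z : (0 <= K z)%E by rewrite lee_fin (mulr_ge0 _ (mulr_ge0 (W0 _) _)).
  have := @measurable_fun_fubini_tonelli_F _ _ _ _ R mu K mK K0.
  congr (measurable_fun _ _); apply/funext => x; rewrite /fubini_F /H.
  rewrite [RHS]integral_mkcond; apply: eq_integral => y _.
  rewrite patchE /K/= indicE; case: ifPn => yD; first by rewrite mul1r.
  by rewrite mul0r.
apply: (@le_trans _ _ (\int[mu]_(x in circle R) ((tau^-1)%:E * H x))%E).
  apply: ge0_le_integral => //.
  - by apply: measurable_funTS; apply: measurableT_comp => //; exact/measurable_EFinP.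
  - exact: measurable_funeM.
  - by move=> x _; exact: vallee_sub_le.
rewrite ge0_integralZl//; last by rewrite lee_fin invr_ge0 ltW.
have -> := circle_tonelli mC mW W0 mf.
apply: (@le_trans _ _ ((tau^-1)%:E * (\int[mu]_(t in circle R)
    ((e / 2 / C)%:E * (W t)%:E + (q / N%:R)%:E)))%E).
  apply: lee_wpmul2l; first by rewrite lee_fin invr_ge0 ltW.
  apply: ge0_le_integral => //.
  - by move=> t _; rewrite mule_ge0 ?lee_fin// Np_ge0.
  - by apply: emeasurable_funM => //; apply: measurable_funTS; exact/measurable_EFinP.
  - apply: emeasurable_funD => //; apply: measurable_funeM.
    by apply: measurable_funTS; exact/measurable_EFinP.
have mWC : measurable_fun (circle R) (fun t => (W t)%:E).
  by apply: measurable_funTS; exact/measurable_EFinP.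
rewrite ge0_integralD//; last 3 first.
- by move=> t _; rewrite -EFinM lee_fin mulr_ge0 ?(ltW e1)// normr_ge0.
- exact: measurable_funeM.
- by move=> t _; rewrite lee_fin divr_ge0.
rewrite ge0_integralZl//; last 2 first.
- by move=> t _; rewrite lee_fin normr_ge0.
- by rewrite lee_fin ltW.
rewrite integral_circle_cst.
have -> : (\int[mu]_(t in circle R) (W t)%:E = Np 1 W)%E.
  by apply: eq_integral => t _; rewrite powRr1// normr_id.
apply: (@le_trans _ _ ((tau^-1)%:E * ((e / 2 / C)%:E * (C * tau)%:E + (q / N%:R * tau)%:E))%E).
  apply: lee_wpmul2l; first by rewrite lee_fin invr_ge0 ltW.
  by rewrite leeD2r// lee_wpmul2l// lee_fin ltW.
rewrite -(EFinM (e / 2 / C)) -EFinD -EFinM lee_fin.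
have -> : tau^-1 * (e / 2 / C * (C * tau) + q / N%:R * tau) = e / 2 + q / N%:R.
  have /negbT tn0 := gt_eqF tau_gt0; have /negbT Cn0 := gt_eqF C0; have /negbT Nn0 := gt_eqF N0'.
  by move: (tau) tn0 => t tn0; field; rewrite tn0 Cn0 Nn0.
suff : q / N%:R <= e / 2 by lra.
rewrite ler_pdivrMr// -ler_pdivrMl ?divr_gt0// mulrC.
have qe : 0 <= q / (e / 2) by rewrite divr_ge0// ltW// divr_gt0.
apply: le_trans (ltW (archi_boundP qe)) _; by rewrite ler_nat.
Qed.

End ApproximateIdentity.

(** * Summing the blocks *)

Section RealEstimate.
Variable R : realType.
Notation mu := (@lebesgue_measure R).
Notation tau := (2 * pi : R).
Implicit Types (f g : R -> R) (x : R) (M N n k : nat).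

Let tau_gt0 : 0 < tau := tau_gt0 R.
Hint Resolve tau_gt0 : core.

Lemma vallee_cvg_Np p M f (e : R) : 0 < p -> p <= 1 -> (0 < M)%N ->
  measurable_fun setT f -> is_periodic f -> (Np 1 f < +oo)%E -> 0 < e ->
  exists N0, forall N, (N0 <= N)%N -> (0 < N)%N ->
    (Np p (fun x => f x - vallee M N f x)%R <= e%:E)%E.
Proof.
move=> p0 p1 M0 mf pf ff e0.
pose t : R := e / 2 / tau.
have t0 : 0 < t by rewrite !divr_gt0.
pose eta := t `^ p^-1.
have eta0 : 0 < eta by exact: powR_gt0.
pose v := eta `^ (p - 1).
have v0 : 0 < v by exact: powR_gt0.
have e1 : 0 < e / 2 / v by rewrite !divr_gt0.
have [N0 hN0] := vallee_cvg M0 mf pf ff e1.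
exists N0 => N hN N_gt0.
have mD : measurable_fun setT (fun x => f x - vallee M N f x).
  by apply: measurable_funB => //; exact: measurable_vallee.
apply: le_trans (Np_le_eps p0 p1 eta0 mD) _.
apply: (@le_trans _ _ ((eta `^ p * tau)%:E + v%:E * (e / 2 / v)%:E)%E).
  apply: leeD => //; apply: lee_wpmul2l; first by rewrite lee_fin ltW.
  exact: hN0.
rewrite -(EFinM v) -EFinD lee_fin /eta -powRrM mulVf ?gt_eqF// powRr1 ?(ltW t0)//.
have -> : v * (e / 2 / v) = e / 2 by move/negbT: (gt_eqF v0) => vn; field.
have -> : t * tau = e / 2.
  by rewrite /t; move/negbT: (gt_eqF tau_gt0); move: tau => T Tn; field.
by lra.
Qed.

Lemma sum_geometric_le (q : R) k0 K : 0 <= q -> q < 1 ->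
  \sum_(k0 <= k < K) q ^+ k <= q ^+ k0 / (1 - q).
Proof.
move=> q0 q1; have q1' : 0 < 1 - q by lra.
rewrite ler_pdivlMr//.
have [kK|Kk] := leqP k0 K; last first.
  by rewrite big_geq ?mul0r ?exprn_ge0// ltnW.
have -> : (\sum_(k0 <= k < K) q ^+ k) * (1 - q) = q ^+ k0 - q ^+ K.
  rewrite mulr_suml (eq_bigr (fun k => - q ^+ k.+1 - - q ^+ k)) => [|k _].
    by rewrite (telescope_sumr (fun k => - q ^+ k))//; ring.
  by rewrite exprS; ring.
by rewrite gerBl exprn_ge0.
Qed.

(** The k-th block has size 2^(-k alpha p) 2^(k (p - 1)) W, a geometric sequence. The telescoping
    sum stops at a finite level, and the rest tends to 0 in L_p. *)
Lemma vallee_estimate (p alpha : R) M r : 0 < p -> p < 1 -> 0 < alpha -> (0 < M)%N ->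
  1 <= M%:R * p -> 2 <= (r.*2)%:R * p ->
  exists2 C, 0 < C & forall f g k0 (w : nat -> R) W,
    measurable_fun setT f -> is_periodic f -> (Np 1 f < +oo)%E ->
    measurable_fun setT g -> is_periodic g -> (Np 1 g < +oo)%E ->
    mode_integral alpha f g ->
    (forall l, (k0 + 5 <= l)%N ->
      (Np p (iter r.*2 (bwd (tau / (2 ^ l)%N%:R)) g) <= (w l)%:E)%E) ->
    (forall L, \sum_(k0 + 5 <= l < L) dyadic_weight p l * w l <= W) ->
    (Np p (fun x => f x - vallee M (2 ^ k0) f x)%R <=
      (C * (2 ^ k0)%N%:R `^ (- (alpha * p + 1 - p)) * W)%:E)%E.
Proof.
move=> p0 p1 a0 M0 Mp rp; have p1' := ltW p1.
(* The scaled step 2^k tau / 2^(k + 5) does not depend on k, so one symbol and one constant serve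
   all blocks. *)
pose c : R := tau / 32.
have pi0 := pi_gt0 R.
have c0 : 0 < c by rewrite divr_gt0.
have cpi : 4 * c <= pi by rewrite /c; lra.
pose b : R -> R := block_symbol M.*2 alpha c r.
have sb : smooth_on setT M.*2 b by exact: smooth_block_symbol.
have b0 (y : R) : ~ (-2 <= y <= 2) -> b y = 0.
  by move=> h; apply: block_symbol_eq0 => /andP[h1 h2]; apply: h; apply/andP; split; lra.
have [C C0 hC] := block_estimate p0 p1' rp Mp sb b0.
pose s := alpha * p + 1 - p.
have s0 : 0 < s by rewrite /s -addrA ltr_pwDl ?subr_ge0// mulr_gt0.
pose q : R := 2 `^ (- s).
have q0 : 0 <= q by exact: powR_ge0.
have q1 : q < 1.
  have : 1 `^ s < 2 `^ s by apply: (gt0_ltr_powR s0); rewrite ?nnegrE//; lra.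
  by rewrite powR1 /q powRN invf_lt1 ?powR_gt0.
have qE k : (2 ^ k)%N%:R `^ (- s) = q ^+ k.
  by rewrite natrX -(powR_mulrn k (ler0n R 2)) -(powR_mulrn k q0) -!powRrM mulrC.
pose D := (2 / tau) `^ p * C.
have D0 : 0 < D by rewrite mulr_gt0// powR_gt0// divr_gt0.
have q1' : 0 < 1 - q by lra.
exists (D / (1 - q)); first by rewrite divr_gt0.
move=> f g k0 w W mf pf ff mg pg fg fgE hw hW.
have W0 : 0 <= W by have := hW 0; rewrite big_geq.
have wge l : (k0 + 5 <= l)%N -> 0 <= w l.
  by move=> /hw; rewrite -lee_fin; apply: le_trans; exact: Np_ge0.
have mv N : measurable_fun setT (vallee M N f) by exact: measurable_vallee.
have hblock k : (k0 <= k)%N ->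
    (Np p (fun x => vallee M (2 ^ k.+1) f x - vallee M (2 ^ k) f x)%R <= (D * q ^+ k * W)%:E)%E.
  move=> k0k; have N0 : (0 < 2 ^ k)%N by rewrite expn_gt0.
  have N0' : 0 < (2 ^ k)%N%:R :> R by rewrite ltr0n.
  have hc : (2 ^ k)%N%:R * (tau / (2 ^ (k + 5))%N%:R) = c.
    rewrite expnD natrM /c; have /negbT := gt_eqF N0'; move: ((2 ^ k)%N%:R : R) => T Tn.
    by rewrite (_ : (2 ^ 5)%N%:R = 32 :> R)//; field.
  pose A := conv (trig_kernel M b (2 ^ k) (- (alpha * pi / 2)))
      (iter r (diff2 (tau / (2 ^ (k + 5))%N%:R)) g).
  have mA : measurable_fun setT A.
    apply: measurable_conv_trig_kernel; first exact: measurable_iter_diff2.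
    exact: Np1_iter_diff2_finite.
  have E x : vallee M (2 ^ k.+1) f x - vallee M (2 ^ k) f x =
      (2 / tau * (2 ^ k)%N%:R `^ (- alpha)) * A x.
    rewrite expnS (@vallee_block R M (2 ^ k) r alpha (tau / (2 ^ (k + 5))%N%:R) f g x)//.
    - by rewrite hc.
    - by rewrite hc.
    - by rewrite hc.
  rewrite (eq_Np _ E) (NpZ _ _ mA).
  have hA : (Np p A <= (C * ((2 ^ k)%N%:R `^ (p - 1) * W))%:E)%E.
    apply: (hC k (- (alpha * pi / 2)) g w W mg pg fg) => [l kl|L].
      by apply: hw; apply: leq_trans kl; rewrite leq_add2r.
    have [kL|Lk] := leqP (k + 5) L; last by rewrite big_geq// ltnW.
    apply: le_trans (hW L); rewrite [leRHS](@big_cat_nat _ _ _ (k + 5))//=; last first.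
      by rewrite leq_add2r.
    rewrite lerDr big_nat_cond sumr_ge0// => l /andP[/andP[lk _] _].
    by rewrite mulr_ge0 ?dyadic_weight_ge0// wge.
  apply: le_trans (lee_wpmul2l _ hA) _; first by rewrite lee_fin powR_ge0.
  have T0 : 0 <= 2 / tau by rewrite divr_ge0// ltW.
  have N1 : 0 <= (2 ^ k)%N%:R `^ (- alpha) :> R by exact: powR_ge0.
  rewrite -EFinM lee_fin (ger0_norm (mulr_ge0 T0 N1)) (powRM _ T0 N1).
  have -> : q ^+ k = ((2 ^ k)%N%:R `^ (- alpha)) `^ p * (2 ^ k)%N%:R `^ (p - 1).
    rewrite -qE -powRrM -powRD; last by rewrite (gt_eqF N0') implybT.
    by congr (_ `^ _); rewrite /s; ring.
  by rewrite /D le_eqVlt; apply/orP; left; apply/eqP; ring.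
have htel K : (k0 <= K)%N ->
    (Np p (fun x => vallee M (2 ^ K) f x - vallee M (2 ^ k0) f x)%R <=
      (D / (1 - q) * q ^+ k0 * W)%:E)%E.
  move=> kK; have E x : vallee M (2 ^ K) f x - vallee M (2 ^ k0) f x =
      \sum_(k0 <= k < K) (vallee M (2 ^ k.+1) f x - vallee M (2 ^ k) f x).
    by rewrite (telescope_sumr (fun k => vallee M (2 ^ k) f x)).
  rewrite (eq_Np _ E).
  apply: le_trans (Np_sum _ p0 p1' (fun k => measurable_funB (mv _) (mv _))) _.
  apply: (@le_trans _ _ (\sum_(k0 <= k < K) (D * q ^+ k * W)%:E)%E).
    rewrite big_nat_cond [leRHS]big_nat_cond; apply: lee_sum => k /andP[/andP[kk _] _].
    exact: hblock.
  rewrite sumEFin lee_fin -mulr_suml -mulr_sumr ler_wpM2r// -mulrA ler_wpM2l ?(ltW D0)//.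
  by rewrite mulrC; exact: sum_geometric_le.
rewrite -/s qE; apply/lee_addgt0Pr => e e0.
have [N0 hN0] := vallee_cvg_Np p0 p1' M0 mf pf ff e0.
pose K := maxn k0 N0.
have E x : f x - vallee M (2 ^ k0) f x =
    (vallee M (2 ^ K) f x - vallee M (2 ^ k0) f x) + (f x - vallee M (2 ^ K) f x).
  by ring.
have m1 : measurable_fun setT (fun x => vallee M (2 ^ K) f x - vallee M (2 ^ k0) f x).
  exact: (measurable_funB (mv _) (mv _)).
have m2 : measurable_fun setT (fun x => f x - vallee M (2 ^ K) f x).
  exact: (measurable_funB mf (mv _)).
rewrite (eq_Np _ E); apply: le_trans (NpD p0 p1' m1 m2) _.
apply: leeD; first by apply: htel; exact: leq_maxl.
apply: hN0; last by rewrite expn_gt0.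
by apply: leq_trans (leq_maxr k0 N0) _; apply: ltnW; exact: ltn_expl.
Qed.

End RealEstimate.

(** * Fractional differences *)

Section FractionalDifference.
Variable R : realType.
Notation mu := (@lebesgue_measure R).
Notation tau := (2 * pi : R).
Implicit Types (f g : R -> R) (x d : R) (M N n k : nat).

Lemma summable_tail (a : nat -> R) A : (forall n, \sum_(0 <= i < n) `|a i| <= A) ->
  exists t : nat -> R, [/\ forall n, 0 <= t n <= A, forall n N, (n <= N)%N -> t N <= t n,
    forall n N, (n <= N)%N -> \sum_(n <= i < N) `|a i| <= t n &
    forall e, 0 < e -> exists n0, forall n, (n0 <= n)%N -> t n <= e].
Proof.
move=> hA; pose S n := \sum_(0 <= i < n) `|a i|.
have ndS : nondecreasing_seq S.
  apply/nondecreasing_seqP => n; rewrite /S big_nat_recr//=.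
  by rewrite lerDl.
have ubS : has_ubound (range S) by exists A => _ [n _ <-]; exact: hA.
have cS : cvgn S by exact: nondecreasing_is_cvgn.
have Sle n : S n <= limn S by exact: nondecreasing_cvgn_le.
exists (fun n => limn S - S n); split.
- move=> n; rewrite subr_ge0 Sle/=.
  have S0 : 0 <= S n by exact: sumr_ge0.
  suff : limn S <= A by lra.
  by apply: limr_le => //; apply: nearW => k; exact: hA.
- by move=> n N nN; rewrite lerB// ndS.
- move=> n N nN; have := Sle N; rewrite /S (@big_cat_nat _ _ _ n 0 N)//=; lra.
- move=> e e0; have /cvgrPdist_le/(_ _ e0)[n0 _ h] := cS.
  by exists n0 => n /h; apply: le_trans; exact: ler_norm.
Qed.

Lemma triangle_sum (F : nat -> nat -> R) N :
  \sum_(0 <= k < N) \sum_(0 <= i < k.+1) F i (k - i)%N =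
  \sum_(0 <= i < N) \sum_(0 <= j < N - i) F i j.
Proof.
elim: N => [|N IH]; first by rewrite !big_nil.
rewrite big_nat_recr//= IH [RHS]big_nat_recr//= subSnn big_nat1.
rewrite [X in _ + X]big_nat_recr//= subnn addrA; congr (_ + _).
rewrite -big_split/=; apply: eq_big_nat => i /andP[_ iN].
rewrite subSn; last exact: ltnW.
by rewrite big_nat_recr.
Qed.

Lemma bounded_series (a v : nat -> R) (t : nat -> R) B :
  (forall n N, (n <= N)%N -> \sum_(n <= i < N) `|a i| <= t n) ->
  (forall e, 0 < e -> exists n0, forall n, (n0 <= n)%N -> t n <= e) ->
  0 <= B -> (forall i, `|v i| <= B) ->
  cvgn (series (fun i => a i * v i)) /\
  forall n, `|limn (series (fun i => a i * v i)) - \sum_(0 <= i < n) a i * v i| <= B * t n.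
Proof.
move=> ht t0 B0 vB.
have hd n N : (n <= N)%N ->
    `|\sum_(0 <= i < N) a i * v i - \sum_(0 <= i < n) a i * v i| <= B * t n.
  move=> nN; rewrite (@big_cat_nat _ _ _ n 0 N)//= addrAC subrr add0r.
  apply: le_trans (ler_norm_sum _ _ _) _.
  apply: (@le_trans _ _ (B * \sum_(n <= i < N) `|a i|)); last by rewrite ler_wpM2l// ht.
  rewrite mulr_sumr; apply: ler_sum => i _.
  by rewrite normrM mulrC ler_wpM2r.
have cs : cvgn (series (fun i => a i * v i)).
  apply: normed_cvg; suff : cvgn (fun n => \sum_(0 <= i < n) `|a i * v i|) by [].
  apply: nondecreasing_is_cvgn.
    by apply/nondecreasing_seqP => n; rewrite big_nat_recr//= lerDl.
  exists (B * t 0%N) => _ [n _ <-].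
  apply: (@le_trans _ _ (B * \sum_(0 <= i < n) `|a i|)); last by rewrite ler_wpM2l// ht.
  rewrite mulr_sumr; apply: ler_sum => i _.
  by rewrite normrM mulrC ler_wpM2r.
split=> // n.
have c2 : (fun N => `|series (fun i => a i * v i) N - \sum_(0 <= i < n) a i * v i|) @ \oo -->
    `|limn (series (fun i => a i * v i)) - \sum_(0 <= i < n) a i * v i|.
  by apply: cvg_norm; apply: cvgB => //; exact: cvg_cst.
rewrite -(cvg_lim _ c2)//; apply: limr_le; first by apply/cvg_ex; eexists; exact: c2.
by exists n => // N nN; exact: hd.
Qed.

(** The composition of two difference series with absolutely summable coefficients, applied to a
    bounded orbit, is approximated by the partial sums of the Cauchy product. Only some large N is
    needed, so no limit of the product is formed. *)
Lemma cauchy_shift (a b u : nat -> R) A Bb B n0 (e : R) :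
  (forall n, \sum_(0 <= i < n) `|a i| <= A) -> (forall n, \sum_(0 <= i < n) `|b i| <= Bb) ->
  (forall i, `|u i| <= B) -> 0 < e ->
  exists2 N, (n0 <= N)%N &
    `|\sum_(0 <= i < N) b i * limn (series (fun j => a j * u (i + j)%N)) -
      \sum_(0 <= k < N) (\sum_(0 <= i < k.+1) b i * a (k - i)%N) * u k| <= e.
Proof.
move=> hA hB uB e0.
have B0 : 0 <= B by exact: le_trans (uB 0%N).
have [ta [ta0 ta_dec ta_sum ta_cvg]] := summable_tail hA.
have [tb [tb0 tb_dec tb_sum tb_cvg]] := summable_tail hB.
have A0 : 0 <= A by have /andP[h1 h2] := ta0 0%N; exact: le_trans h2.
have Bb0 : 0 <= Bb by have /andP[h1 h2] := tb0 0%N; exact: le_trans h2.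
pose e1 := e / (B + 1) / (A + Bb + 1).
have e10 : 0 < e1 by rewrite !divr_gt0// ?ltr_wpDl// addr_ge0.
have [na hna] := ta_cvg _ e10; have [nb hnb] := tb_cvg _ e10.
(* The truncation is at 2n: for i < n at least n terms of the inner series are kept, and for i >= n
   the coefficient b is in its tail. *)
pose n := maxn n0 (maxn na nb).
have [n0n nan nbn] : [/\ n0 <= n, na <= n & nb <= n]%N by rewrite /n; split; lia.
exists n.*2; first by rewrite -addnn; lia.
have E : \sum_(0 <= k < n.*2) (\sum_(0 <= i < k.+1) b i * a (k - i)%N) * u k =
    \sum_(0 <= i < n.*2) b i * \sum_(0 <= j < n.*2 - i) a j * u (i + j)%N.
  transitivity (\sum_(0 <= i < n.*2) \sum_(0 <= j < n.*2 - i) b i * (a j * u (i + j)%N)).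
    rewrite -(triangle_sum (fun i j => b i * (a j * u (i + j)%N))).
    apply: eq_bigr => k _; rewrite mulr_suml; apply: eq_big_nat => i /andP[_ ik].
    by rewrite subnKC// mulrA.
  by apply: eq_bigr => i _; rewrite mulr_sumr.
rewrite E -sumrB.
apply: (@le_trans _ _ (\sum_(0 <= i < n.*2) `|b i| * (B * ta (n.*2 - i)%N))).
  apply: le_trans (ler_norm_sum _ _ _) _; apply: ler_sum => i _.
  rewrite -mulrBr normrM ler_wpM2l//.
  by have [_] := bounded_series (v := fun j => u (i + j)%N) ta_sum ta_cvg B0 (fun j => uB _).
rewrite (@big_cat_nat _ _ _ n)//=; last by rewrite -addnn leq_addr.
apply: (@le_trans _ _ (Bb * (B * e1) + e1 * (B * A))).
  apply: lerD.
    apply: (@le_trans _ _ ((\sum_(0 <= i < n) `|b i|) * (B * e1))).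
      rewrite mulr_suml; apply: ler_sum_nat => i /andP[_ iN].
      rewrite ler_wpM2l// ler_wpM2l// hna//; rewrite -addnn; lia.
    by rewrite ler_wpM2r// mulr_ge0// ltW.
  apply: (@le_trans _ _ ((\sum_(n <= i < n.*2) `|b i|) * (B * A))).
    rewrite mulr_suml; apply: ler_sum => i _.
    by rewrite ler_wpM2l// ler_wpM2l//; have /andP[] := ta0 (n.*2 - i)%N.
  rewrite ler_wpM2r ?mulr_ge0//; apply: le_trans (hnb _ nbn); apply: tb_sum.
  by rewrite -addnn leq_addr.
have -> : Bb * (B * e1) + e1 * (B * A) = e * ((B / (B + 1)) * ((A + Bb) / (A + Bb + 1))).
  rewrite /e1; field; apply/andP; split; rewrite gt_eqF// ltr_wpDl// addr_ge0//.
rewrite ler_piMr ?(ltW e0)// mulr_ile1 ?divr_ge0 ?addr_ge0//.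
  by rewrite ler_pdivrMr ?ltr_wpDl// mul1r lerDl.
by rewrite ler_pdivrMr ?ltr_wpDl ?addr_ge0// mul1r lerDl.
Qed.

Lemma gbinom0 (a : R) : gbinom a 0 = 1.
Proof. by rewrite /gbinom big_ord0 fact0 divr1. Qed.

Lemma gbinomS (a : R) k : k.+1%:R * gbinom a k.+1 = (a - k%:R) * gbinom a k.
Proof.
rewrite /gbinom big_ord_recr/= factS natrM.
have k0 : k.+1%:R != 0 :> R by rewrite pnatr_eq0.
have f0 : (k`!)%:R != 0 :> R by rewrite pnatr_eq0 -lt0n fact_gt0.
by move: (\prod_(j < k) _) (k.+1%:R : R) k0 (a - k%:R) => P t t0 z; field; rewrite t0 f0.
Qed.

(** The recurrence determines the sequence; binomial numbers and Vandermonde sums are identified by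
    checking it. *)
Lemma gbinom_unique (a : R) (z : nat -> R) : z 0%N = 1 ->
  (forall k, k.+1%:R * z k.+1 = (a - k%:R) * z k) -> forall k, z k = gbinom a k.
Proof.
move=> z0 zS; elim=> [|k IH]; first by rewrite gbinom0.
have k0 : k.+1%:R != 0 :> R by rewrite pnatr_eq0.
by apply: (mulfI k0); rewrite zS gbinomS IH.
Qed.

Lemma gbinom_nat (m k : nat) : gbinom m%:R k = 'C(m, k)%:R :> R.
Proof.
apply/esym; apply: (gbinom_unique (z := fun k => 'C(m, k)%:R)) => [|{}k]; first by rewrite bin0.
rewrite -natrM mul_bin_left natrM.
have [km|mk] := leqP k m; first by rewrite natrB.
by rewrite bin_small// !mulr0.
Qed.

(** Vandermonde's identity. Writing k + 1 = i + (k + 1 - i) lets the recurrence act on either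
    factor, and (c - i) + (b - (k - i)) = c + b - k. *)
Lemma gbinom_convolution (c b : R) k :
  \sum_(0 <= i < k.+1) gbinom c i * gbinom b (k - i)%N = gbinom (c + b) k.
Proof.
move: k; apply: (gbinom_unique (z := fun k => \sum_(0 <= i < k.+1) gbinom c i * gbinom b (k - i)%N)).
  by rewrite big_nat1 !gbinom0 mulr1.
move=> k; rewrite mulr_sumr.
transitivity (\sum_(0 <= i < k.+2) ((i%:R * gbinom c i) * gbinom b (k.+1 - i)%N) +
  \sum_(0 <= i < k.+2) (gbinom c i * ((k.+1 - i)%N%:R * gbinom b (k.+1 - i)%N))).
  rewrite -big_split/=; apply: eq_big_nat => i /andP[_ ik].
  by rewrite natrB//; ring.
rewrite big_nat_recl// mul0r mul0r add0r [X in _ + X]big_nat_recr//= subnn mul0r mulr0 addr0.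
rewrite -big_split/= mulr_sumr; apply: eq_big_nat => i /andP[_ ik].
rewrite subSS gbinomS subSn// gbinomS natrB//.
by ring.
Qed.

Lemma iter_bwdE d g N m x : (m < N)%N ->
  iter m (bwd d) g x = \sum_(0 <= k < N) ('C(m, k)%:R * (-1) ^+ k) * g (x - k%:R * d).
Proof.
elim: m N x => [|m IH] N x mN.
  case: N mN => // N _; rewrite big_nat_recl//= big1_seq => [|i _].
    by rewrite addr0 bin0 mul0r subr0 !mul1r.
  by rewrite bin_small// mul0r mul0r.
case: N mN => // N mN; rewrite iterS /bwd (IH N.+1 x) ?leqW// (IH N (x - d))//.
rewrite big_nat_recl// [in RHS]big_nat_recl// !bin0 -addrA; congr (_ + _).
rewrite -sumrB; apply: eq_bigr => k _.
rewrite binS natrD (_ : x - d - k%:R * d = x - k.+1%:R * d); last by rewrite -natr1; ring.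
by rewrite exprS; ring.
Qed.

(** For i >= b the recurrence gives b |C(b, i)| = i |C(b, i)| - (i + 1) |C(b, i + 1)|, which
    telescopes. *)
Lemma gbinom_summable (b : R) : 0 < b ->
  exists A, forall n, \sum_(0 <= i < n) `|gbinom b i| <= A.
Proof.
move=> b0; pose n0 := Num.bound b.
have bn0 : b < n0%:R by apply: archi_boundP; exact: ltW.
have hS i : (n0 <= i)%N ->
    `|gbinom b i| = - (b^-1 * i.+1%:R * `|gbinom b i.+1|) - - (b^-1 * i%:R * `|gbinom b i|).
  move=> ni; have bi : b <= i%:R by rewrite (le_trans (ltW bn0))// ler_nat.
  have : i.+1%:R * `|gbinom b i.+1| = (i%:R - b) * `|gbinom b i|.
    rewrite -[i.+1%:R in LHS]ger0_norm// -normrM gbinomS normrM -[`|b - _|]normrN opprB.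
    by rewrite (@ger0_norm _ (i%:R - b))// subr_ge0.
  rewrite -(mulrA b^-1 i.+1%:R) => ->.
  by move/negbT: (gt_eqF b0) => bn; field.
have P n : 0 <= \sum_(0 <= i < n) `|gbinom b i| by exact: sumr_ge0.
exists (\sum_(0 <= i < n0) `|gbinom b i| + b^-1 * n0%:R * `|gbinom b n0|) => n.
have Q j : 0 <= b^-1 * j%:R * `|gbinom b j| by rewrite !mulr_ge0 ?invr_ge0// ltW.
have [nn|nn] := leqP n n0.
  by rewrite [X in _ <= X + _](@big_cat_nat _ _ _ n)//= -addrA lerDl addr_ge0// sumr_ge0.
rewrite (@big_cat_nat _ _ _ n0)//= ?(ltnW nn)// lerD2l.
rewrite (eq_big_nat _ _ (F2 := fun i =>
  - (b^-1 * i.+1%:R * `|gbinom b i.+1|) - - (b^-1 * i%:R * `|gbinom b i|))); last first.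
  by move=> i /andP[ni _]; exact: hS.
rewrite (telescope_sumr (fun i => - (b^-1 * i%:R * `|gbinom b i|))); last exact: ltnW.
by have := Q n; lra.
Qed.

(** |C(c, i)| i^k is eventually nonincreasing: the ratio (i - c) / (i + 1) of the coefficients is at
    most (i / (i + 1))^k, by Bernoulli's inequality and k <= c. *)
Lemma gbinom_decay (c : R) k : 0 < c -> k%:R <= c ->
  exists2 K, 0 < K & forall i, (0 < i)%N -> `|gbinom c i| <= K / i%:R ^+ k.
Proof.
move=> c0 kc; pose n0 := Num.bound c.
have cn0 : c < n0%:R by apply: archi_boundP; exact: ltW.
have n0_gt0 : (0 < n0)%N by rewrite -(@ltr_nat R) (lt_trans c0).
pose w i : R := `|gbinom c i| * i%:R ^+ k.
have w0 i : 0 <= w i by rewrite mulr_ge0// exprn_ge0.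
have wS i : (n0 <= i)%N -> w i.+1 <= w i.
  move=> ni; have ci : c <= i%:R by rewrite (le_trans (ltW cn0))// ler_nat.
  have i0 : (0 < i)%N by exact: leq_trans ni.
  have i1 : 0 < i.+1%:R :> R by rewrite ltr0n.
  have -> : w i.+1 = (i%:R - c) / i.+1%:R * i.+1%:R ^+ k * `|gbinom c i|.
    have : i.+1%:R * `|gbinom c i.+1| = (i%:R - c) * `|gbinom c i|.
      rewrite -[i.+1%:R in LHS]ger0_norm// -normrM gbinomS normrM -[`|c - _|]normrN opprB.
      by rewrite (@ger0_norm _ (i%:R - c))// subr_ge0.
    rewrite /w => h; apply: (mulfI (lt0r_neq0 i1)); rewrite mulrA h.
    by move/negbT: (gt_eqF i1) => i1n; field.
  rewrite /w [leRHS]mulrC ler_wpM2r//.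
  have bern j : 1 - j%:R / i.+1%:R <= (i%:R / i.+1%:R) ^+ j :> R.
    elim: j => [|j IH]; first by rewrite mul0r subr0 expr0.
    have q0 : 0 <= i%:R / i.+1%:R :> R by rewrite divr_ge0.
    rewrite exprS; apply: le_trans (ler_wpM2l q0 IH).
    rewrite -subr_ge0; have -> : i%:R / i.+1%:R * (1 - j%:R / i.+1%:R) - (1 - j.+1%:R / i.+1%:R) =
        j%:R / i.+1%:R ^+ 2 :> R.
      by rewrite -(natr1 j) -(natr1 i) in i1 *; move/negbT: (gt_eqF i1) => h; field.
    by rewrite divr_ge0// exprn_ge0.
  have -> : i%:R ^+ k = i.+1%:R ^+ k * (i%:R / i.+1%:R) ^+ k :> R.
    by rewrite -exprMn mulrCA mulfV ?mulr1// gt_eqF.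
  rewrite mulrC ler_wpM2l ?exprn_ge0//; apply: le_trans (bern k).
  rewrite ler_pdivrMr// mulrBl mul1r mulfVK ?gt_eqF//.
  by rewrite -natr1; lra.
pose K := 1 + \sum_(0 <= i < n0.+1) w i.
have K0 : 0 < K by rewrite ltr_wpDr// sumr_ge0.
exists K => // i i0; rewrite ler_pdivlMr ?exprn_gt0 ?ltr0n//.
have hK j : (j < n0.+1)%N -> w j <= K.
  move=> jn; have jn' : (j <= n0.+1)%N by exact: ltnW.
  rewrite /K (@big_cat_nat _ _ _ j 0 n0.+1 _ _ (leq0n j) jn')/= [X in _ + (_ + X)]big_ltn//.
  have h1 : 0 <= \sum_(0 <= i < j) w i by exact: sumr_ge0.
  have h2 : 0 <= \sum_(j.+1 <= i < n0.+1) w i by exact: sumr_ge0.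
  by lra.
have [iN|Ni] := ltnP i n0.+1; first exact: hK.
rewrite -/(w i); apply: le_trans (hK n0 (ltnSn _)).
rewrite -(subnKC (ltnW Ni)); elim: (i - n0)%N => [|j IH]; first by rewrite addn0.
by rewrite addnS; apply: le_trans IH; apply: wS; exact: leq_addr.
Qed.

(** With k p >= 2 the p-th powers decay like i^-2, and the sum of i^-2 up to n is at most 2 -
    1/n. *)
Lemma gbinom_powR_summable (p c : R) k : 0 < p -> 0 < c -> k%:R <= c -> 2 <= k%:R * p ->
  exists2 S, 0 < S & forall n, \sum_(0 <= i < n) `|gbinom c i| `^ p <= S.
Proof.
move=> p0 c0 kc kp; have [K K0 hK] := gbinom_decay c0 kc.
have h i : (0 < i)%N -> `|gbinom c i| `^ p <= K `^ p / i%:R ^+ 2.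
  move=> i0; have i1 : 1 <= i%:R :> R by rewrite ler1n.
  have i2 : 0 <= i%:R :> R by [].
  apply: (@le_trans _ _ ((K / i%:R ^+ k) `^ p)).
    by apply: ge0_ler_powR; rewrite ?nnegrE ?divr_ge0 ?exprn_ge0 ?(ltW p0) ?(ltW K0)//; exact: hK.
  have v0 : 0 <= (i%:R ^+ k)^-1 :> R by rewrite invr_ge0 exprn_ge0.
  rewrite (powRM _ (ltW K0) v0) ler_wpM2l ?powR_ge0//.
  rewrite -(powR_mulrn k i2) -powRN -(powR_mulrn 2 i2) -powRN -powRrM ler_powR//.
  by rewrite mulNr lerN2.
have Kp : 0 < K `^ p by exact: powR_gt0.
pose c1 := `|gbinom c 0| `^ p; have c10 : 0 <= c1 by exact: powR_ge0.
exists (c1 + 2 * K `^ p); first by rewrite ltr_wpDl// mulr_gt0.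
have P n : \sum_(0 <= i < n.+2) `|gbinom c i| `^ p <= c1 + K `^ p * (2 - n.+1%:R^-1).
  elim: n => [|n IH].
    rewrite big_nat_recr//= big_nat1 lerD2l invr1 (_ : 2 - 1 = 1) ?mulr1; last by ring.
    by apply: le_trans (h 1%N isT) _; rewrite expr1n invr1 mulr1.
  rewrite big_nat_recr//=; apply: (le_trans (lerD IH (h n.+2 isT))).
  rewrite -addrA lerD2l -mulrDr ler_wpM2l ?(ltW Kp)//.
  have n1 : 0 < n.+1%:R :> R by rewrite ltr0n.
  rewrite -(natr1 n.+1); move: (n.+1%:R : R) n1 => t t0.
  have t1 : 0 < t + 1 by rewrite addr_gt0.
  rewrite -subr_ge0 (_ : _ - _ = (t * (t + 1) ^+ 2)^-1); last first.
    by field; rewrite !gt_eqF.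
  by rewrite invr_ge0 mulr_ge0 ?exprn_ge0// ltW.
case=> [|[|n]].
- by rewrite big_nil addr_ge0// mulr_ge0// ltW.
- by rewrite big_nat1 lerDl mulr_ge0// ltW.
apply: le_trans (P n) _; rewrite lerD2l mulrC ler_wpM2r ?(ltW Kp)//.
by rewrite gerBl invr_ge0.
Qed.

Lemma powR_norm_sum_le (p : R) (c : nat -> R) n : 0 < p -> p <= 1 ->
  `|\sum_(0 <= i < n) c i| `^ p <= \sum_(0 <= i < n) `|c i| `^ p.
Proof.
move=> p0 p1; elim: n => [|n IH]; first by rewrite !big_nil normr0 powR0 ?gt_eqF.
rewrite !big_nat_recr//=; apply: le_trans (lerD IH (lexx _)).
apply: le_trans (powR_subadditive p0 p1 (normr_ge0 _) (normr_ge0 _)).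
by apply: le_powRl; [exact: ltW|exact: normr_ge0|exact: ler_normD].
Qed.

(** The fractional difference on real functions; its coefficients are real, so it acts separately on
    real and imaginary parts. *)
Definition rdiff (b d : R) g x : R :=
  limn (series (fun v => gbinom b v * (-1) ^+ v * g (x - v%:R * d))).

(* The step divides the period, so the orbit of x is finite and the series of
   fractional differences converges at every point. *)
Lemma dyadic_orbit_bounded g l x : is_periodic g ->
  exists B, forall v : nat, `|g (x - v%:R * (tau / (2 ^ l)%N%:R))| <= B.
Proof.
move=> pg; set d := tau / _; set L := (2 ^ l)%N.
have L0 : (0 < L)%N by rewrite expn_gt0.
have dL : L%:R * d = tau.
  by rewrite /d -/L mulrC divfK// pnatr_eq0 -lt0n.
exists (\sum_(i < L) `|g (x - i%:R * d)|) => v.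
have -> : g (x - v%:R * d) = g (x - (v %% L)%N%:R * d).
  rewrite {1}(divn_eq v L) natrD natrM mulrDl -mulrA dL opprD addrA addrAC.
  rewrite -[LHS](is_periodic_nat (v %/ L)%N _ pg); congr g; ring.
have vL : (v %% L < L)%N by rewrite ltn_mod.
by rewrite (bigD1 (Ordinal vL))//= lerDl sumr_ge0.
Qed.

Lemma gbinom_sign_summable (b : R) : 0 < b ->
  exists A, forall n, \sum_(0 <= i < n) `|gbinom b i * (-1) ^+ i| <= A.
Proof.
move=> /gbinom_summable[A hA]; exists A => n; apply: le_trans (hA n).
by apply: ler_sum => i _; rewrite normrM normrX normrN1 expr1n mulr1.
Qed.

Lemma rdiff_cvg (b : R) g l x : 0 < b -> is_periodic g ->
  cvgn (series (fun v => gbinom b v * (-1) ^+ v * g (x - v%:R * (tau / (2 ^ l)%N%:R)))).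
Proof.
move=> b0 pg; have [A hA] := gbinom_sign_summable b0.
have [t [_ _ ts tc]] := summable_tail hA.
have [B hB] := dyadic_orbit_bounded l x pg.
have B0 : 0 <= B by exact: le_trans (hB 0%N).
by have [] := bounded_series ts tc B0 hB.
Qed.

Lemma measurable_backshift d g : measurable_fun setT g ->
  measurable_fun setT (fun x : R => g (x - d)).
Proof. by move=> mg; apply: measurableT_comp => //; exact: measurable_shift. Qed.

Lemma measurable_rdiff (b : R) g l : 0 < b -> measurable_fun setT g -> is_periodic g ->
  measurable_fun setT (rdiff b (tau / (2 ^ l)%N%:R) g).
Proof.
move=> b0 mg pg.
apply: (measurable_fun_cvg (h := fun n x =>
  series (fun v => gbinom b v * (-1) ^+ v * g (x - v%:R * (tau / (2 ^ l)%N%:R))) n)).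
  move=> n; rewrite /series/=; apply: measurable_sum => i.
  by apply: measurable_funM => //; exact: measurable_backshift.
by move=> x _; exact: rdiff_cvg.
Qed.

Lemma periodic_rdiff (b d : R) g : is_periodic g -> is_periodic (rdiff b d g).
Proof.
move=> pg x; rewrite /rdiff; congr (limn (series _)); apply/funext => v.
by rewrite addrAC pg.
Qed.

Lemma integral_powR_shift (p a c : R) (h : R -> R) : 0 <= c ->
  measurable_fun setT h -> is_periodic h ->
  (\int[mu]_(x in circle R) (c%:E * (`|h (x - a)%R| `^ p)%:E) = c%:E * Np p h)%E.
Proof.
move=> c0 mh ph; have ms : measurable_fun setT (fun x : R => h (x - a)).
  exact: measurable_backshift.
rewrite -(Np_shift p (- a) mh ph) ge0_integralZl => [//| | | |].
- exact: measurable_circle.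
- exact: measurable_powR_norm.
- by move=> x _; rewrite lee_fin powR_ge0.
- by rewrite lee_fin.
Qed.

(** The complementary order c = m - b is at least k, so its coefficients are p-summable. The p-th
    power of the series is bounded term by term, and each translate has the same integral. *)
Lemma Np_iter_bwd_le (p b : R) m k : 0 < p -> p <= 1 -> 0 < b ->
  2 <= k%:R * p -> b + k%:R <= m%:R ->
  exists2 C, 0 < C & forall g l, measurable_fun setT g -> is_periodic g ->
    (Np p (iter m (bwd (tau / (2 ^ l)%N%:R)) g) <=
      C%:E * Np p (rdiff b (tau / (2 ^ l)%N%:R) g))%E.
Proof.
move=> p0 p1 b0 kp bk; pose c := m%:R - b.
have kc : k%:R <= c by rewrite /c; lra.
have k0 : (0 < k)%N by rewrite lt0n; apply/eqP => k0; move: kp; rewrite k0 mul0r; lra.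
have c0 : 0 < c by apply: lt_le_trans kc; rewrite ltr0n.
have [S S0 hS] := gbinom_powR_summable p0 c0 kc kp.
have [A hA] := gbinom_sign_summable b0.
have [Bb hBb] := gbinom_sign_summable c0.
exists S => // g l mg pg; set d := tau / _.
pose h := rdiff b d g.
have mh : measurable_fun setT h by exact: measurable_rdiff.
have ph : is_periodic h by exact: periodic_rdiff.
have mhs (i : nat) : measurable_fun setT (fun x : R => h (x - i%:R * d)).
  exact: measurable_backshift.
pose F (i : nat) x : \bar R := ((`|gbinom c i| `^ p)%:E * (`|h (x - i%:R * d)| `^ p)%:E)%E.
have F0 i x : (0 <= F i x)%E by rewrite mule_ge0 ?lee_fin ?powR_ge0.
have mF i : measurable_fun (circle R) (F i).
  by apply: measurable_funeM; exact: measurable_powR_norm.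
(* Truncations reproduce the integer difference up to eta, and eta^p = e is an arbitrary
   tolerance. *)
have pt x : ((`|iter m (bwd d) g x| `^ p)%:E <= \sum_(0 <= i <oo) F i x)%E.
  apply/lee_addgt0Pr => e e0; pose eta := e `^ p^-1.
  have eta0 : 0 < eta by exact: powR_gt0.
  have [B hB] := dyadic_orbit_bounded l x pg; rewrite -/d in hB.
  have [N mN] := cauchy_shift m.+1 hA hBb hB eta0.
  have -> : \sum_(0 <= k0 < N)
      (\sum_(0 <= i < k0.+1) gbinom c i * (-1) ^+ i * (gbinom b (k0 - i)%N * (-1) ^+ (k0 - i))) *
      g (x - k0%:R * d) = iter m (bwd d) g x.
    rewrite (iter_bwdE _ _ _ mN); apply: eq_bigr => j _; congr (_ * _).
    rewrite -gbinom_nat (_ : m%:R = c + b); last by rewrite /c subrK.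
    rewrite -gbinom_convolution mulr_suml; apply: eq_big_nat => i /andP[_ ij].
    have -> : (-1) ^+ j = (-1) ^+ i * (-1) ^+ (j - i) :> R by rewrite -exprD subnKC.
    by ring.
  have -> : \sum_(0 <= i < N) gbinom c i * (-1) ^+ i *
        limn (series (fun j => gbinom b j * (-1) ^+ j * g (x - (i + j)%N%:R * d))) =
      \sum_(0 <= i < N) gbinom c i * (-1) ^+ i * h (x - i%:R * d).
    apply: eq_bigr => i _; congr (_ * _); congr (limn (series _)); apply/funext => j.
    by rewrite natrD mulrDl opprD addrA.
  set D := \sum_(0 <= i < N) _ => De.
  apply: (@le_trans _ _ (\sum_(0 <= i < N) F i x + e%:E)%E); last first.
    by rewrite leeD2r//; apply: nneseries_lim_ge => i _ _; exact: F0.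
  apply: (@le_trans _ _ (`|D| `^ p + eta `^ p)%:E).
    rewrite lee_fin; apply: le_trans (powR_subadditive p0 p1 (normr_ge0 _) (ltW eta0)).
    apply: le_powRl; [exact: ltW|exact: normr_ge0|].
    have := ler_normB D (D - iter m (bwd d) g x); rewrite opprB addrC subrK.
    by move=> /le_trans; apply; rewrite lerD2l.
  rewrite EFinD /eta -powRrM mulVf ?gt_eqF// powRr1 ?(ltW e0)// leeD2r//.
  apply: (@le_trans _ _ (\sum_(0 <= i < N) `|gbinom c i * (-1) ^+ i * h (x - i%:R * d)| `^ p)%:E).
    by rewrite lee_fin; exact: powR_norm_sum_le.
  rewrite -sumEFin; apply: lee_sum => i _.
  rewrite /F -EFinM lee_fin -powRM ?normr_ge0//.
  by rewrite !normrM normrX normrN1 expr1n mulr1.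
apply: (@le_trans _ _ (\int[mu]_(x in circle R) \sum_(0 <= i <oo) F i x)%E).
  apply: ge0_le_integral => //.
  - exact: measurable_circle.
  - by apply: measurable_powR_norm; exact: measurable_iter_bwd.
  - exact: (ge0_emeasurable_sum (fun i x _ _ => F0 i x) (fun i (_ : xpredT i) => mF i)).
rewrite integral_nneseries//; last exact: measurable_circle.
have IF i : (\int[mu]_(x in circle R) F i x = (`|gbinom c i| `^ p)%:E * Np p h)%E.
  exact: (integral_powR_shift p (i%:R * d) (powR_ge0 _ _) mh ph).
rewrite (eq_eseriesr (fun i _ => IF i)); apply: lime_le.
  by apply: is_cvg_nneseries => i _ _; rewrite mule_ge0 ?lee_fin ?powR_ge0 ?Np_ge0.
apply: nearW => n; rewrite -ge0_sume_distrl; last by move=> i _; rewrite lee_fin powR_ge0.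
by rewrite sumEFin lee_wpmul2r ?Np_ge0// lee_fin.
Qed.

End FractionalDifference.

(** * Complex functions *)

Section ComplexFunctions.
Local Open Scope complex_scope.
Variable R : realType.
Notation mu := (@lebesgue_measure R).
Notation tau := (2 * pi : R).
Implicit Types (f g T : R -> R[i]) (x d p : R) (M N n k : nat).

Let tau_gt0 : 0 < tau := tau_gt0 R.
Hint Resolve tau_gt0 : core.
Let mC : measurable (circle R) := @measurable_circle R.
Hint Resolve mC : core.

Definition re_fun f x : R := complex.Re (f x).
Definition im_fun f x : R := complex.Im (f x).

Lemma normcE (z : R[i]) :
  Normc.normc z = Num.sqrt (complex.Re z ^+ 2 + complex.Im z ^+ 2).
Proof. by case: z. Qed.

Lemma normc_ge0 (z : R[i]) : 0 <= Normc.normc z.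
Proof. by rewrite normcE sqrtr_ge0. Qed.

Lemma Re_le_normc (z : R[i]) : `|complex.Re z| <= Normc.normc z.
Proof. by rewrite normcE -sqrtr_sqr ler_wsqrtr// lerDl sqr_ge0. Qed.

Lemma Im_le_normc (z : R[i]) : `|complex.Im z| <= Normc.normc z.
Proof. by rewrite normcE -sqrtr_sqr ler_wsqrtr// lerDr sqr_ge0. Qed.

Lemma normc_le_Re_Im (z : R[i]) : Normc.normc z <= `|complex.Re z| + `|complex.Im z|.
Proof.
have s0 : 0 <= `|complex.Re z| + `|complex.Im z| by rewrite addr_ge0.
rewrite normcE -[leRHS]ger0_norm// -sqrtr_sqr ler_wsqrtr//.
have ab0 := mulr_ge0 (normr_ge0 (complex.Re z)) (normr_ge0 (complex.Im z)).
by rewrite sqrrD !real_normK ?num_real// mulr2n; lra.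
Qed.

(** The complex counterpart of [Np], comparable to the sum over the two parts. *)
Definition cint p f : \bar R := (\int[mu]_(x in circle R) (Normc.normc (f x) `^ p)%:E)%E.

Lemma cint_ge0 p f : (0 <= cint p f)%E.
Proof. by apply: integral_ge0 => x _; rewrite lee_fin powR_ge0. Qed.

Lemma measurable_normc_powR p f (D : set R) : cmeasurable f ->
  measurable_fun D (fun x => (Normc.normc (f x) `^ p)%:E).
Proof.
move=> [mr mi]; apply: measurable_funTS; apply/measurable_EFinP.
rewrite (_ : (fun x => _) =
  fun x => ((complex.Re (f x) ^+ 2 + complex.Im (f x) ^+ 2) `^ 2^-1) `^ p).
  apply: (measurableT_comp (measurable_powR p)).
  apply: (measurableT_comp (measurable_powR _)).
  by apply: measurable_funD; exact: measurable_funX.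
by apply/funext => x; rewrite powR12_sqrt ?addr_ge0 ?sqr_ge0// -normcE.
Qed.

Lemma Np_re_le p f : 0 <= p -> cmeasurable f -> (Np p (re_fun f) <= cint p f)%E.
Proof.
move=> p0 mf; apply: ge0_le_integral => //.
- by apply: measurable_powR_norm; case: mf.
- exact: measurable_normc_powR.
- by move=> x _; rewrite lee_fin le_powRl// Re_le_normc.
Qed.

Lemma Np_im_le p f : 0 <= p -> cmeasurable f -> (Np p (im_fun f) <= cint p f)%E.
Proof.
move=> p0 mf; apply: ge0_le_integral => //.
- by apply: measurable_powR_norm; case: mf.
- exact: measurable_normc_powR.
- by move=> x _; rewrite lee_fin le_powRl// Im_le_normc.
Qed.

Lemma cint_le p f : 0 < p -> p <= 1 -> cmeasurable f ->
  (cint p f <= Np p (re_fun f) + Np p (im_fun f))%E.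
Proof.
move=> p0 p1 mf; have [mr mi] := mf; rewrite /Np -ge0_integralD//;
  try (by move=> x _; rewrite lee_fin powR_ge0); try exact: measurable_powR_norm.
apply: ge0_le_integral => //.
- by move=> x _; rewrite lee_fin powR_ge0.
- exact: measurable_normc_powR.
- by apply: emeasurable_funD; exact: measurable_powR_norm.
- move=> x _; rewrite -EFinD lee_fin.
  apply: le_trans (powR_subadditive p0 p1 (normr_ge0 _) (normr_ge0 _)).
  by apply: le_powRl; [exact: ltW|exact: normc_ge0|exact: normc_le_Re_Im].
Qed.

Lemma pnormE p f : pnorm p f = (((tau^-1)%:E * cint p f) `^ p^-1)%E.
Proof. by []. Qed.

Lemma pnorm_powR p f : 0 < p -> (pnorm p f `^ p = (tau^-1)%:E * cint p f)%E.
Proof.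
move=> p0; rewrite pnormE -poweRrM mulVf ?gt_eqF// poweRe1//.
by rewrite mule_ge0 ?cint_ge0// lee_fin invr_ge0 ltW.
Qed.

Lemma cint_pnorm p f : 0 < p -> (cint p f = tau%:E * pnorm p f `^ p)%E.
Proof. by move=> p0; rewrite pnorm_powR// muleA -EFinM divff ?mul1e// gt_eqF. Qed.

Lemma Lp1_parts f : Lp 1 f ->
  [/\ measurable_fun setT (re_fun f), is_periodic (re_fun f) & (Np 1 (re_fun f) < +oo)%E] /\
  [/\ measurable_fun setT (im_fun f), is_periodic (im_fun f) & (Np 1 (im_fun f) < +oo)%E].
Proof.
move=> [mf pf ff]; have c_fin : (cint 1 f < +oo)%E.
  rewrite cint_pnorm//; apply: lte_mul_pinfty => //; first by rewrite lee_fin ltW.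
  by rewrite poweRe1// poweR_ge0.
have [mr mi] := mf; split; split.
- exact: mr.
- by move=> x; rewrite /re_fun pf.
- exact: le_lt_trans (Np_re_le ler01 mf) c_fin.
- exact: mi.
- by move=> x; rewrite /im_fun pf.
- exact: le_lt_trans (Np_im_le ler01 mf) c_fin.
Qed.

Lemma re_fdiff a d f x : re_fun (fdiff a d f) x = rdiff a d (re_fun f) x.
Proof.
rewrite /re_fun /fdiff /rdiff /cseries/=; congr (limn (series _)); apply/funext => v.
by case: (f _) => r i /=; rewrite mul0r subr0.
Qed.

Lemma im_fdiff a d f x : im_fun (fdiff a d f) x = rdiff a d (im_fun f) x.
Proof.
rewrite /im_fun /fdiff /rdiff /cseries/=; congr (limn (series _)); apply/funext => v.
by case: (f _) => r i /=; rewrite mul0r addr0.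
Qed.

Lemma Np_rdiff_le p b f l : 0 < p -> 0 < b ->
  measurable_fun setT (re_fun f) -> is_periodic (re_fun f) ->
  measurable_fun setT (im_fun f) -> is_periodic (im_fun f) ->
  let D := fdiff b (tau / (2 ^ l)%N%:R) f in
  ((Np p (rdiff b (tau / (2 ^ l)%N%:R) (re_fun f)) <= tau%:E * pnorm p D `^ p) /\
   (Np p (rdiff b (tau / (2 ^ l)%N%:R) (im_fun f)) <= tau%:E * pnorm p D `^ p))%E.
Proof.
move=> p0 b0 mr pr mi pi_ D.
have Er : re_fun D = rdiff b (tau / (2 ^ l)%N%:R) (re_fun f).
  by apply/funext => x; exact: re_fdiff.
have Ei : im_fun D = rdiff b (tau / (2 ^ l)%N%:R) (im_fun f).
  by apply/funext => x; exact: im_fdiff.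
have mD : cmeasurable D.
  by split; [rewrite -/(re_fun D) Er|rewrite -/(im_fun D) Ei]; exact: measurable_rdiff.
rewrite -Er -Ei -(cint_pnorm _ p0).
split; [exact: (Np_re_le (ltW p0) mD)|exact: (Np_im_le (ltW p0) mD)].
Qed.

Lemma trigpoly_add n T1 T2 : trigpoly n T1 -> trigpoly n T2 ->
  trigpoly n (fun x => T1 x + T2 x).
Proof.
move=> [c1 ->] [c2 ->]; exists (fun j => c1 j + c2 j); apply/funext => x.
by rewrite -big_split/=; apply: eq_bigr => j _; rewrite (mulrDl (c1 j)).
Qed.

Lemma trigpoly_sum n (F : nat -> R -> R[i]) N : (forall j, (j < N)%N -> trigpoly n (F j)) ->
  trigpoly n (fun x => \sum_(0 <= j < N) F j x).
Proof.
elim: N => [|N IH] hF.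
  exists (fun=> 0); apply/funext => x; rewrite big_nil big1// => j _.
  by rewrite mul0r.
rewrite (_ : (fun x => _) = fun x => \sum_(0 <= j < N) F j x + F N x).
  by apply: trigpoly_add; [apply: IH => j jN; apply: hF; exact: ltnW|exact: hF].
by apply/funext => x; rewrite big_nat_recr.
Qed.

Lemma trigpoly_expi n (i : 'I_(2 * n).+1) (z : R[i]) :
  trigpoly n (fun x => z * expi ((i%:R - n%:R) * x)).
Proof.
exists (fun j => if j == i then z else 0); apply/funext => x.
rewrite (bigD1 i)//= eqxx big1 ?addr0// => j /negbTE ->.
by rewrite mul0r.
Qed.

(** The frequencies j and -j sit at the indices n + j and n - j. Their coefficients come from
    Euler's formulas and add up when j = 0. *)
Lemma trigpoly_cos_sin n j (a b a' b' : R) : (j <= n)%N ->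
  trigpoly n (fun x => (a * cos (j%:R * x) + b * sin (j%:R * x)) +i*
                       (a' * cos (j%:R * x) + b' * sin (j%:R * x))).
Proof.
move=> jn.
have h1 : (n + j < (2 * n).+1)%N by lia.
have h2 : (n - j < (2 * n).+1)%N by lia.
rewrite (_ : (fun x => _) = fun x =>
    (((a + b') / 2) +i* ((a' - b) / 2)) * expi (((Ordinal h1)%:R - n%:R) * x) +
    (((a - b') / 2) +i* ((a' + b) / 2)) * expi (((Ordinal h2)%:R - n%:R) * x)).
  by apply: trigpoly_add; exact: trigpoly_expi.
apply/funext => x /=.
have -> : (n + j)%N%:R - n%:R = j%:R :> R by rewrite natrD; ring.
have -> : (n - j)%N%:R - n%:R = - j%:R :> R by rewrite natrB//; ring.
rewrite /expi mulNr cosN sinN; move: (cos _) (sin _) => C S.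
apply/eqP; rewrite eq_complex /=; apply/andP; split; apply/eqP; by field.
Qed.

Lemma sum_complex (u v : nat -> R) N :
  \sum_(0 <= j < N) (u j +i* v j) = (\sum_(0 <= j < N) u j) +i* (\sum_(0 <= j < N) v j).
Proof.
elim: N => [|N IH]; first by rewrite !big_nil.
by rewrite !big_nat_recr//= IH.
Qed.

(** The bump vanishes from j = N on, so only frequencies below N remain although the kernel window
    is wider. *)
Lemma vallee_cos_sin M N (u : R -> R) : (0 < N)%N -> measurable_fun setT u ->
  (Np 1 u < +oo)%E -> exists a b : nat -> R, forall x,
    vallee M N u x = \sum_(0 <= j < N) (a j * cos (j%:R * x) + b j * sin (j%:R * x)).
Proof.
move=> N0 mu_ fu.
have N0' : 0 < N%:R :> R by rewrite ltr0n.
pose c j := \int[mu]_(y in circle R) (cos (j%:R * y) * u y).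
pose s j := \int[mu]_(y in circle R) (sin (j%:R * y) * u y).
pose w j : R := if j == 0%N then tau^-1 else tau^-1 * (2 * bump M.*2 (j%:R / N%:R)).
exists (fun j => w j * c j), (fun j => w j * s j) => x.
have E j : mode j%:R 0 u x = cos (j%:R * x) * c j + sin (j%:R * x) * s j.
  by rewrite (modeE _ _ _ mu_ fu) addr0.
pose J := ((M + 3) * N)%N; have NJ : (N <= J.+1)%N by rewrite /J; nia.
rewrite /vallee (@conv_bump_kernel R M M.*2 N u x J N0 (leqnn _) mu_ fu).
rewrite (@big_cat_nat _ _ _ N 1 J.+1)//= [X in _ + (_ + X)]big_nat_cond.
rewrite [X in _ + (_ + X)]big1 => [|j /andP[/andP[Nj _] _]]; last first.
  rewrite bump_eq0 ?mulr0 ?mul0r// ger0_norm ?divr_ge0//.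
  by rewrite ler_pdivlMr// mul1r ler_nat.
rewrite addr0 (E 0%N) mulrDr mulr_sumr [RHS]big_ltn//; congr (_ + _).
  by rewrite /w eqxx; ring.
apply: eq_big_nat => -[//|j] _; rewrite E /w /=; ring.
Qed.

Lemma vallee_trigpoly M N n (u v : R -> R) : (0 < N)%N -> (N <= n)%N ->
  measurable_fun setT u -> (Np 1 u < +oo)%E -> measurable_fun setT v -> (Np 1 v < +oo)%E ->
  trigpoly n (fun x => vallee M N u x +i* vallee M N v x).
Proof.
move=> N0 Nn mu_ fu mv fv.
have [a [b hu]] := vallee_cos_sin M N0 mu_ fu.
have [a' [b' hv]] := vallee_cos_sin M N0 mv fv.
rewrite (_ : (fun x => _) = fun x => \sum_(0 <= j < N)
    ((a j * cos (j%:R * x) + b j * sin (j%:R * x)) +i*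
     (a' j * cos (j%:R * x) + b' j * sin (j%:R * x)))).
  by apply: trigpoly_sum => j jN; apply: trigpoly_cos_sin; apply: leq_trans Nn; exact: ltnW.
by apply/funext => x; rewrite sum_complex hu hv.
Qed.

End ComplexFunctions.

(** * The Weyl derivative on cosine and sine coefficients *)

Section WeylModes.
Variable R : realType.
Local Open Scope complex_scope.
Notation mu := (@lebesgue_measure R).
Notation tau := (2 * pi : R).
Implicit Types (f g : R -> R[i]) (u v : R -> R).

Let tau_gt0 : 0 < tau := tau_gt0 R.
Hint Resolve tau_gt0 : core.
Let mC : measurable (circle R) := @measurable_circle R.
Hint Resolve mC : core.

Definition cos_coeff (z : R) u : R := \int[mu]_(y in circle R) (cos (z * y) * u y).
Definition sin_coeff (z : R) u : R := \int[mu]_(y in circle R) (sin (z * y) * u y).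

Lemma integrable_cos_mul (z : R) u : measurable_fun setT u -> (Np 1 u < +oo)%E ->
  mu.-integrable (circle R) (EFin \o (fun y => cos (z * y) * u y)).
Proof.
move=> mu_ fu; rewrite (_ : (fun y => _) = fun y => cos (z * y + 0) * u y).
  exact: (integrable_bounded_mul (measurable_cos_affine z 0) (fun y => cos_max (z * y + 0)) mu_ fu).
by apply/funext => y; rewrite addr0.
Qed.

Lemma integrable_sin_mul (z : R) u : measurable_fun setT u -> (Np 1 u < +oo)%E ->
  mu.-integrable (circle R) (EFin \o (fun y => sin (z * y) * u y)).
Proof.
move=> mu_ fu; rewrite (_ : (fun y => _) = fun y => sin (z * y + 0) * u y).
  exact: (integrable_bounded_mul (measurable_sin_affine z 0) (fun y => sin_max (z * y + 0)) mu_ fu).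
by apply/funext => y; rewrite addr0.
Qed.

Lemma cos_coeffN (z : R) u : cos_coeff (- z) u = cos_coeff z u.
Proof. by apply: eq_Rintegral => y _; rewrite mulNr cosN. Qed.

Lemma sin_coeffN (z : R) u : measurable_fun setT u -> (Np 1 u < +oo)%E ->
  sin_coeff (- z) u = - sin_coeff z u.
Proof.
move=> mu_ fu; rewrite -[RHS]mulN1r /sin_coeff -(circle_RintegralZ _ (integrable_sin_mul z mu_ fu)).
by apply: eq_Rintegral => y _; rewrite mulNr sinN; ring.
Qed.

Lemma fourierE f (k : int) : Lp 1 f ->
  fourier f k =
  (tau^-1 * (cos_coeff k%:~R (re_fun f) + sin_coeff k%:~R (im_fun f))) +i*
  (tau^-1 * (cos_coeff k%:~R (im_fun f) - sin_coeff k%:~R (re_fun f))).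
Proof.
move=> /Lp1_parts[[mr _ fr] [mi _ fi]]; rewrite /fourier /cintegral.
set z : R := k%:~R.
have -> : \int[mu]_(x in circle R) complex.Re (f x * expi (- (z * x))) =
    cos_coeff z (re_fun f) + sin_coeff z (im_fun f).
  rewrite /cos_coeff /sin_coeff.
  rewrite -(circle_RintegralD (integrable_cos_mul z mr fr) (integrable_sin_mul z mi fi)).
  apply: eq_Rintegral => x _; rewrite /re_fun /im_fun /expi cosN sinN.
  by case: (f x) => a b /=; ring.
have -> : \int[mu]_(x in circle R) complex.Im (f x * expi (- (z * x))) =
    cos_coeff z (im_fun f) - sin_coeff z (re_fun f).
  rewrite -[X in _ = _ + X]mulN1r /cos_coeff /sin_coeff -(circle_RintegralZ _ (integrable_sin_mul z mr fr)).
  rewrite -(circle_RintegralD (integrable_cos_mul z mi fi)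
     (circle_integrable_scale (-1) (integrable_sin_mul z mr fr))).
  apply: eq_Rintegral => x _; rewrite /re_fun /im_fun /expi cosN sinN.
  by case: (f x) => a b /=; ring.
apply/eqP; rewrite eq_complex /=; apply/andP; split; apply/eqP; ring.
Qed.

(* The coefficients at k and -k determine the cosine and sine coefficients of
   the real and imaginary parts. *)
Lemma weyl_coeffs alpha f g j : Lp 1 f -> Lp 1 g -> weyl_derivative alpha f g -> (0 < j)%N ->
  let th := alpha * pi / 2 in let q := j%:R `^ alpha : R in
  [/\ cos_coeff j%:R (re_fun g) =
        q * (cos th * cos_coeff j%:R (re_fun f) + sin th * sin_coeff j%:R (re_fun f)),
      sin_coeff j%:R (re_fun g) =
        q * (cos th * sin_coeff j%:R (re_fun f) - sin th * cos_coeff j%:R (re_fun f)),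
      cos_coeff j%:R (im_fun g) =
        q * (cos th * cos_coeff j%:R (im_fun f) + sin th * sin_coeff j%:R (im_fun f)) &
      sin_coeff j%:R (im_fun g) =
        q * (cos th * sin_coeff j%:R (im_fun f) - sin th * cos_coeff j%:R (im_fun f))].
Proof.
move=> Lf Lg [_ hw] j0 th q.
have [[mrf _ frf] [mif _ fif]] := Lp1_parts Lf.
have [[mrg _ frg] [mig _ fig]] := Lp1_parts Lg.
have jn0 : (j%:Z != 0)%R by rewrite -lt0n in j0 *.
have jN0 : (- j%:Z != 0)%R by rewrite oppr_eq0.
have tn0 : tau^-1 != 0 by rewrite invr_eq0 gt_eqF.
have ikp : ik_pow alpha j%:Z = (q * cos th) +i* (q * sin th).
  rewrite /ik_pow /expi -pmulrn ger0_norm// gtr0_sgz ?ltz_nat// mulr1.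
  by apply/eqP; rewrite eq_complex /= !mul0r subr0 addr0 !eqxx.
have ikn : ik_pow alpha (- j%:Z) = (q * cos th) +i* (- (q * sin th)).
  rewrite /ik_pow /expi mulrNz normrN -pmulrn ger0_norm// sgzN gtr0_sgz ?ltz_nat//.
  rewrite mulrN1 cosN sinN.
  by apply/eqP; rewrite eq_complex /= !mul0r subr0 addr0 mulrN !eqxx.
have := hw _ jn0; have := hw _ jN0; rewrite ikp ikn !fourierE// mulrNz -pmulrn.
rewrite !cos_coeffN !sin_coeffN//.
move: (cos_coeff j%:R (re_fun f)) (sin_coeff j%:R (re_fun f)) => c1 s1.
move: (cos_coeff j%:R (im_fun f)) (sin_coeff j%:R (im_fun f)) => c2 s2.
move: (cos_coeff j%:R (re_fun g)) (sin_coeff j%:R (re_fun g)) => d1 r1.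
move: (cos_coeff j%:R (im_fun g)) (sin_coeff j%:R (im_fun g)) => d2 r2.
clear ikp ikn; move: (cos th) (sin th) q (tau^-1) tn0 => C S Q t tn0.
move=> /eqP; rewrite eq_complex /= => /andP[/eqP n1 /eqP n2].
move=> /eqP; rewrite eq_complex /= => /andP[/eqP p1 /eqP p2].
have n1' : d1 - r2 = Q * C * (c1 - s2) + Q * S * (c2 + s1).
  by apply: (mulfI tn0); rewrite n1; ring.
have n2' : d2 + r1 = Q * C * (c2 + s1) - Q * S * (c1 - s2).
  by rewrite -[r1]opprK; apply: (mulfI tn0); rewrite n2; ring.
have p1' : d1 + r2 = Q * C * (c1 + s2) - Q * S * (c2 - s1).
  by apply: (mulfI tn0); rewrite p1; ring.
have p2' : d2 - r1 = Q * C * (c2 - s1) + Q * S * (c1 + s2).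
  by apply: (mulfI tn0); rewrite p2; ring.
by split; lra.
Qed.

(** The pair of coefficients is rotated by th and scaled by j^alpha; the phase -th of the mode
    undoes the rotation, through cos^2 + sin^2 = 1. *)
Lemma mode_integral_coeffs (alpha : R) u v :
  measurable_fun setT u -> (Np 1 u < +oo)%E -> measurable_fun setT v -> (Np 1 v < +oo)%E ->
  (forall j : nat, (0 < j)%N -> let th := alpha * pi / 2 in
     cos_coeff j%:R v = j%:R `^ alpha * (cos th * cos_coeff j%:R u + sin th * sin_coeff j%:R u) /\
     sin_coeff j%:R v = j%:R `^ alpha * (cos th * sin_coeff j%:R u - sin th * cos_coeff j%:R u)) ->
  mode_integral alpha u v.
Proof.
move=> mu_ fu mv fv h j x j0; have [hc hs] := h j j0.
rewrite (modeE _ _ _ mu_ fu) (modeE _ _ _ mv fv) addr0.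
rewrite -/(cos_coeff _ _) -/(cos_coeff _ _) -/(sin_coeff _ _) -/(sin_coeff _ _) hc hs.
rewrite cosB sinB powRN.
have Q0 : j%:R `^ alpha != 0 :> R by rewrite gt_eqF// powR_gt0// ltr0n.
have CS := cos2Dsin2 (alpha * pi / 2).
move: (j%:R `^ alpha) Q0 (cos (alpha * pi / 2)) (sin (alpha * pi / 2)) CS => Q Q0 C S CS.
move: (cos_coeff _ u) (sin_coeff _ u) (cos (j%:R * x)) (sin (j%:R * x)) => c s A B.
transitivity ((Q^-1 * Q) * ((C ^+ 2 + S ^+ 2) * (A * c + B * s))).
  by rewrite CS mulVf// !mul1r.
ring.
Qed.

Lemma weyl_mode_integral alpha f g : Lp 1 f -> Lp 1 g -> weyl_derivative alpha f g ->
  mode_integral alpha (re_fun f) (re_fun g) /\ mode_integral alpha (im_fun f) (im_fun g).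
Proof.
move=> Lf Lg hw.
have [[mrf _ frf] [mif _ fif]] := Lp1_parts Lf.
have [[mrg _ frg] [mig _ fig]] := Lp1_parts Lg.
split; apply: mode_integral_coeffs => // j j0 th.
- by have [h1 h2 _ _] := weyl_coeffs Lf Lg hw j0.
- by have [_ _ h1 h2] := weyl_coeffs Lf Lg hw j0.
Qed.

End WeylModes.

(** * Dyadic sums as lower sums of the integral *)

Section DyadicIntegral.
Variable R : realType.
Notation mu := (@lebesgue_measure R).
Notation tau := (2 * pi : R).

Let tau_gt0 : 0 < tau := tau_gt0 R.
Hint Resolve tau_gt0 : core.

(** Preimages of rays are intervals. The modulus is a supremum over uncountably many steps, so its
    measurability is drawn from monotonicity. *)
Lemma nondecreasing_emeasurable (m : R -> \bar R) :
  (forall s t, s <= t -> (m s <= m t)%E) -> measurable_fun setT m.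
Proof.
move=> hm _; apply: (measurability _ (ErealGenCInfty.measurableE R)) => //.
move=> _ [_ [r ->] <-]; apply: measurableI => //; apply: is_interval_measurable => s t/=.
rewrite !in_itv/= !andbT => ms _ u /andP[su _].
by rewrite in_itv/= andbT (le_trans ms)// hm.
Qed.

(** With D = tau / 2^l, on ]D, 2D[ one has m(t) >= Q(l) and t^(p - 2) >= (2D)^(p - 2). The length D
    turns the latter into 2^(p - 2) D^(p - 1), the coefficient in the sum. The intervals are
    disjoint; they are open at D because the modulus admits only steps strictly below t. *)
Lemma dyadic_sum_le_integral (p s : R) (m : R -> \bar R) (Q : nat -> \bar R) l0 L :
  0 < p -> p < 1 -> (forall s t, s <= t -> (m s <= m t)%E) -> (forall l, (0 <= Q l)%E) ->
  (forall l t, tau / (2 ^ l)%N%:R < t -> (Q l <= m t)%E) ->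
  2 * (tau / (2 ^ l0)%N%:R) <= s ->
  (\sum_(l0 <= l < L) (2 `^ (p - 2) * tau `^ (p - 1) * dyadic_weight p l)%:E * Q l `^ p <=
   \int[mu]_(t in `]0%R, s[) (m t `^ p * ((t `^ (2 - p))^-1)%:E))%E.
Proof.
move=> p0 p1 hm Q0 hQ hs.
pose D l : R := tau / (2 ^ l)%N%:R.
have n0 l : 0 < (2 ^ l)%N%:R :> R by rewrite ltr0n expn_gt0.
have D0 l : 0 < D l by rewrite divr_gt0.
have DS l : 2 * D l.+1 = D l.
  by rewrite /D expnS natrM; field; rewrite gt_eqF.
pose F t := (m t `^ p * ((t `^ (2 - p))^-1)%:E)%E.
have F0 t : (0 <= F t)%E by rewrite mule_ge0 ?poweR_ge0// lee_fin invr_ge0 powR_ge0.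
have mF (E : set R) : measurable_fun E F.
  apply: measurable_funTS; apply: emeasurable_funM.
    apply: (measurableT_comp (measurable_poweR p)).
    exact: nondecreasing_emeasurable.
  apply/measurable_EFinP; rewrite (_ : (fun x => _) = fun x => x `^ (- (2 - p))).
    exact: measurable_powR.
  by apply/funext => x; rewrite powRN.
have piece l : ((2 `^ (p - 2) * tau `^ (p - 1) * dyadic_weight p l)%:E * Q l `^ p <=
    \int[mu]_(t in `](D l), (2 * D l)%R[) F t)%E.
  have DD : D l < 2 * D l by have := D0 l; lra.
  pose K := (Q l `^ p * (((2 * D l) `^ (2 - p))^-1)%:E)%E.
  have K0 : (0 <= K)%E by rewrite mule_ge0 ?poweR_ge0// lee_fin invr_ge0 powR_ge0.
  apply: (@le_trans _ _ (\int[mu]_(t in `]D l, (2 * D l)%R[) (cst K) t)%E).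
    rewrite integral_cst//= lebesgue_measure_itv/= lte_fin DD /K -muleA -EFinB -EFinM muleC.
    rewrite lee_wpmul2l ?poweR_ge0// lee_fin (_ : 2 * D l - D l = D l); last by ring.
    rewrite -powRN opprB (powRM _ (ler0n _ 2) (ltW (D0 l))) -mulrA -mulrA.
    rewrite ler_wpM2l ?powR_ge0// le_eqVlt; apply/orP; left; apply/eqP.
    have -> : D l `^ (p - 2) * D l = D l `^ (p - 1).
      rewrite -{2}(powRr1 (ltW (D0 l))) -powRD; last by rewrite (gt_eqF (D0 l)) implybT.
      by congr (_ `^ _); ring.
    have n1 : 0 <= (2 ^ l)%N%:R^-1 :> R by rewrite invr_ge0 ltW.
    rewrite /D (powRM _ (ltW tau_gt0) n1); congr (_ * _).
    by rewrite /dyadic_weight -powR_inv1 ?ltW// -powRrM; congr (_ `^ _); ring.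
  apply: ge0_le_integral => //.
    exact: mF.
  move=> t; rewrite /= in_itv/= => /andP[Dt tD].
  have t0 : 0 < t by exact: lt_trans (D0 l) Dt.
  apply: lee_pmul; rewrite ?poweR_ge0//.
  - by rewrite lee_fin invr_ge0 powR_ge0.
  - have Ql := hQ l t Dt; have mt := le_trans (Q0 l) Ql.
    by apply: gt0_ler_poweR; rewrite ?in_itv/= ?andbT ?leey ?Q0 ?mt// ltW.
  - rewrite lee_fin lef_pV2 ?posrE ?powR_gt0//; last exact: lt_trans tD.
    by apply: le_powRl; [lra|exact: ltW|exact: ltW].
(* The intervals for l0 <= l < L lie in ]2 D(L), 2 D(l0)[; the maximum makes this empty for short
   sums. *)
apply: (@le_trans _ _ (\int[mu]_(t in `](2 * D (maxn l0 L))%R, (2 * D l0)%R[) F t)%E); last first.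
  apply: ge0_subset_integral => //; first exact: mF.
  move=> t/=; rewrite !in_itv/= => /andP[h1 h2].
  apply/andP; split; last exact: lt_le_trans hs.
  by apply: lt_trans h1; rewrite mulr_gt0.
elim: L => [|L IH].
  by rewrite big_geq//; exact: integral_ge0.
have [Ll|lL] := ltnP L l0.
  by rewrite big_geq//; exact: integral_ge0.
rewrite (maxn_idPr lL) in IH.
rewrite (maxn_idPr (leqW lL)) big_nat_recr//= DS.
have D2 : 2 * D L <= 2 * D l0.
  rewrite ler_wpM2l// /D ler_wpM2l ?(ltW tau_gt0)// lef_pV2 ?posrE//.
  by rewrite ler_nat leq_exp2l.
apply: (@le_trans _ _ (\int[mu]_(t in `](D L), (2 * D L)%R[ `|` `](2 * D L)%R, (2 * D l0)%R[) F t)%E).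
  rewrite ge0_integral_setU//; first by rewrite addeC leeD.
    exact: mF.
  apply/disj_setPS => t []/=; rewrite !in_itv/= => /andP[_ h1] /andP[h2 _].
  by have := lt_trans h1 h2; rewrite ltxx.
apply: ge0_subset_integral => //.
- by apply: measurableU.
- exact: mF.
move=> t []/=; rewrite !in_itv/= => /andP[h1 h2]; apply/andP; split => //.
  exact: lt_le_trans D2.
by apply: lt_trans h1; have := D0 L; lra.
Qed.

End DyadicIntegral.

(** * The modulus of smoothness and the change from a dyadic scale to n *)

Section Modulus.
Variable R : realType.
Notation tau := (2 * pi : R).
Implicit Types (f g : R -> R[i]) (p : R).

Lemma le_modulus (b p : R) g (s t : R) : s <= t -> (modulus b p g s <= modulus b p g t)%E.
Proof.
move=> st; apply: le_ereal_sup => _ [d /= ds <-]; exists d => //=.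
exact: lt_le_trans st.
Qed.

Lemma pnorm_fdiff_le_modulus (b p d t : R) g : 0 <= d -> d < t ->
  (pnorm p (fdiff b d g) <= modulus b p g t)%E.
Proof.
by move=> d0 dt; apply: ereal_sup_ubound; exists d => //=; rewrite ger0_norm.
Qed.

Lemma pnorm_sub_le p f (u v : R -> R) (A : \bar R) : 0 < p -> p <= 1 ->
  measurable_fun setT (re_fun f) -> measurable_fun setT (im_fun f) ->
  measurable_fun setT u -> measurable_fun setT v ->
  (Np p (fun x => re_fun f x - u x)%R <= A)%E ->
  (Np p (fun x => im_fun f x - v x)%R <= A)%E ->
  (pnorm p (f \- (fun x => u x +i* v x)%C)%R <= ((tau^-1)%:E * (A + A)) `^ p^-1)%E.
Proof.
move=> p0 p1 mr mi mu_ mv hr hi.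
set F := _ \- _.
have Er : re_fun F = fun x => re_fun f x - u x.
  by apply/funext => x; rewrite /re_fun /F /=; case: (f x).
have Ei : im_fun F = fun x => im_fun f x - v x.
  by apply/funext => x; rewrite /im_fun /F /=; case: (f x).
have mF : cmeasurable F.
  split; [rewrite -/(re_fun F) Er|rewrite -/(im_fun F) Ei]; exact: measurable_funB.
have t0 : (0 <= (tau^-1)%:E)%E by rewrite lee_fin invr_ge0 ltW// tau_gt0.
have h : (cint p F <= A + A)%E.
  by apply: le_trans (cint_le p0 p1 mF) _; rewrite Er Ei; exact: leeD hr hi.
have A0 : (0 <= A + A)%E by exact: le_trans (cint_ge0 _ _) h.
rewrite pnormE; apply: gt0_ler_poweR.
- by rewrite invr_ge0 ltW.
- by rewrite in_itv/= leey andbT mule_ge0 ?cint_ge0.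
- by rewrite in_itv/= leey andbT mule_ge0.
- exact: lee_wpmul2l.
Qed.

(** Replacing the dyadic scale N by n <= 2 N costs 2^sg once the p-th root is taken. *)
Lemma powR_dyadic_comparison (C3 N n s sg p i : R) : 0 < p -> 0 <= C3 -> 0 < N -> 0 < n ->
  n <= 2 * N -> 0 <= sg -> s = sg * p -> 0 <= i ->
  (C3 * (N `^ (- s) * i)) `^ p^-1 <= C3 `^ p^-1 * 2 `^ sg / n `^ sg * i `^ p^-1.
Proof.
move=> p0 C30 N0 n0 nN sg0 -> i0.
have Ns : 0 <= N `^ (- (sg * p)) by exact: powR_ge0.
rewrite (powRM _ C30 (mulr_ge0 Ns i0)) (powRM _ Ns i0) -powRrM mulNr mulfK ?gt_eqF//.
rewrite mulrA ler_wpM2r ?powR_ge0// -mulrA ler_wpM2l ?powR_ge0//.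
rewrite powRN ler_pdivlMr ?powR_gt0// ler_pdivrMl ?powR_gt0// mulrC.
by rewrite -(powRM _ (ler0n _ 2) (ltW N0)); apply: le_powRl => //; exact: ltW.
Qed.

End Modulus.

(** * Choice of orders and constants, and assembly *)

Theorem theorem2p8 (R : realType) (p alpha beta : R)
    (p_gt0 : 0 < p) (p_lt1 : p < 1) (alpha_gt0 : 0 < alpha)
    (hbeta : (exists m : nat, (0 < m)%N /\ beta = m%:R) \/
             p^-1 - 1 < beta) :
  exists C : R, 0 < C /\
    forall (f g : R -> R[i]) (n : nat),
      Lp 1 f -> Lp 1 g -> weyl_derivative alpha f g -> (0 < n)%N ->
      (best_approx n p f <=
       (C / n%:R `^ (alpha + p^-1 - 1))%:E *
       (\int[lebesgue_measure]_(t in `]0%R, (n%:R^-1)%R[)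
          (modulus beta p g t `^ p * ((t `^ (2 - p))^-1)%:E)) `^ p^-1)%E.
Proof.
have p1' := ltW p_lt1; have t0 := tau_gt0 R.
have b0 : 0 < beta.
  case: hbeta => [[m [m0 ->]]|]; first by rewrite ltr0n.
  by apply: lt_trans; rewrite subr_gt0 invf_gt1.
have bound_mul (x : R) : 0 <= x -> x <= (Num.bound (x / p))%:R * p.
  by move=> x0; rewrite -ler_pdivrMr// ltW// archi_boundP// divr_ge0// ltW.
(* M p >= 1 makes the kernel weight integrable to the power p; k p >= 2 makes the fractional
   coefficients p-summable. *)
pose M := Num.bound (1 / p); pose k := Num.bound (2 / p).
have Mp : 1 <= M%:R * p by exact: bound_mul.
have kp : 2 <= k%:R * p by exact: bound_mul.
have M0 : (0 < M)%N by rewrite lt0n; apply/eqP => h; move: Mp; rewrite h mul0r; lra.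
(* The order 2r must exceed beta by at least k. *)
pose r := Num.bound (beta + k%:R).
have rb : beta + k%:R <= (r.*2)%:R.
  have h : 0 <= beta + k%:R by rewrite addr_ge0// ltW.
  by apply: le_trans (ltW (archi_boundP h)) _; rewrite ler_nat -addnn leq_addr.
have rp : 2 <= (r.*2)%:R * p.
  apply: le_trans kp _; rewrite ler_wpM2r ?(ltW p_gt0)//.
  by apply: le_trans rb; rewrite lerDr ltW.
have [C1 C10 hC1] := vallee_estimate p_gt0 p_lt1 alpha_gt0 M0 Mp rp.
have [C2 C20 hC2] := Np_iter_bwd_le p_gt0 p1' b0 kp rb.
pose c0 : R := 2 `^ (p - 2) * (2 * pi) `^ (p - 1).
have c00 : 0 < c0 by rewrite mulr_gt0// powR_gt0.
(* The normalisation 1/tau, the two real parts, the block constant, and the passage from the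
   integral to difference norms. *)
pose C3 := (2 * pi)^-1 * (2 * C1 * (C2 * (2 * pi) / c0)).
have C30 : 0 < C3.
  have h1 : 0 < C2 * (2 * pi) / c0 := divr_gt0 (mulr_gt0 C20 t0) c00.
  have h2 : 0 < (2 * pi : R)^-1 by rewrite invr_gt0.
  exact: mulr_gt0 h2 (mulr_gt0 (mulr_gt0 (ltr0n _ 2) C10) h1).
pose sg := alpha + p^-1 - 1.
have sg0 : 0 < sg by rewrite /sg -addrA addr_gt0// subr_gt0 invf_gt1.
exists (C3 `^ p^-1 * 2 `^ sg); split; first by rewrite mulr_gt0 ?powR_gt0.
move=> f g n Lf Lg hw n0; rewrite -/sg.
set I := (\int[_]_(t in _) _)%E.
have n0' : 0 < n%:R :> R by rewrite ltr0n.
have I0 : (0 <= I)%E.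
  apply: integral_ge0 => t _; rewrite mule_ge0 ?poweR_ge0//.
  by rewrite lee_fin invr_ge0 powR_ge0.
(* An infinite integral makes the right side infinite, since its factor is positive. *)
have [If|] := ltP I +oo%E; last first.
  rewrite leye_eq => /eqP ->; rewrite poweRyr ?gt_eqF ?invr_gt0//.
  by rewrite gt0_muley ?leey// lte_fin divr_gt0// ?mulr_gt0 ?powR_gt0.
have IE : I = (fine I)%:E by rewrite fineK// ge0_fin_numE.
set i := fine I in IE.
have i0 : 0 <= i by rewrite -lee_fin -IE.
(* 2^k0 <= n < 2^(k0 + 1): the mean at scale 2^k0 has order at most n, and the two scales differ by
   a factor below 2. *)
pose k0 := trunc_log 2 n.
have Nn : (2 ^ k0 <= n)%N by exact: trunc_logP.
have nN : (n < 2 ^ k0.+1)%N by exact: trunc_log_ltn.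
have N0 : (0 < 2 ^ k0)%N by rewrite expn_gt0.
have N0' : 0 < (2 ^ k0)%N%:R :> R by rewrite ltr0n.
have nN' : n%:R <= 2 * (2 ^ k0)%N%:R :> R.
  by rewrite -natrM -expnS ler_nat ltnW.
pose P l := pnorm p (fdiff beta (2 * pi / (2 ^ l)%N%:R) g).
have d0 l : 0 <= 2 * pi / (2 ^ l)%N%:R :> R by rewrite divr_ge0// ltW.
have hsum L : (\sum_(k0 + 5 <= l < L) (c0 * dyadic_weight p l)%:E * P l `^ p <= I)%E.
  apply: (dyadic_sum_le_integral _ p_gt0 p_lt1 (le_modulus beta p g)).
  - by move=> l; exact: poweR_ge0.
  - by move=> l t; exact: pnorm_fdiff_le_modulus.
  (* The intervals must lie below 1/n. As n <= 2 * 2^k0, the offset 5 of the levels reduces this to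
     pi / 4 <= 1. *)
  - rewrite expnD natrM -[leRHS]mul1r ler_pdivlMr// mulrAC.
    have h32 := tau_le32 R; have h4 := pihalf_lt2 R.
    apply: (@le_trans _ _ (2 * (2 * pi / ((2 ^ k0)%N%:R * (2 ^ 5)%N%:R)) * (2 * (2 ^ k0)%N%:R))).
      by rewrite mulrAC ler_wpM2l// mulr_ge0// divr_ge0 ?(ltW t0)// mulr_ge0.
    rewrite (_ : (2 ^ 5)%N%:R = 32 :> R)//.
    rewrite [leLHS](_ : _ = pi / 4); last by field; rewrite gt_eqF.
    by lra.
have dw0 l : 0 < dyadic_weight p l :> R by rewrite powR_gt0// ltr0n expn_gt0.
have cdw0 l : 0 < c0 * dyadic_weight p l by rewrite mulr_gt0.
(* A finite integral bounds each term of the sum, and the coefficients are positive; so [fine] loses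
   nothing on these levels. *)
have PE l : (k0 + 5 <= l)%N -> (P l `^ p = (fine (P l `^ p))%:E)%E.
  move=> kl; rewrite fineK// ge0_fin_numE ?poweR_ge0// ltNge leye_eq.
  apply/negP => /eqP Py; have h := hsum l.+1; rewrite (big_nat_recr _ _ _ kl) in h.
  have S0 : (0 <= \sum_(k0 + 5 <= j < l) (c0 * dyadic_weight p j)%:E * P j `^ p)%E.
    apply: sume_ge0 => j _; apply: mule_ge0; last exact: poweR_ge0.
    by rewrite lee_fin ltW.
  have : ((c0 * dyadic_weight p l)%:E * P l `^ p <= I)%E.
    exact: (le_trans (leeDr _ S0) h).
  rewrite Py gt0_muley; last by rewrite lte_fin.
  by rewrite leye_eq => /eqP Iy; move: If; rewrite Iy ltxx.
pose w l := C2 * (2 * pi) * fine (P l `^ p).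
pose W := C2 * (2 * pi) / c0 * i.
have hW L : \sum_(k0 + 5 <= l < L) dyadic_weight p l * w l <= W.
  have := hsum L; rewrite big_nat_cond (eq_bigr (fun l =>
    (c0 * dyadic_weight p l * fine (P l `^ p))%:E)); last first.
    by move=> l /andP[/andP[kl _] _]; rewrite {1}PE.
  rewrite -big_nat_cond sumEFin IE lee_fin => h.
  have C2t : 0 <= C2 * (2 * pi) / c0 := divr_ge0 (mulr_ge0 (ltW C20) (ltW t0)) (ltW c00).
  apply: le_trans (ler_wpM2l C2t h); rewrite mulr_sumr.
  rewrite le_eqVlt; apply/orP; left; apply/eqP; apply: eq_bigr => l _; rewrite /w.
  by have /negbT := gt_eqF c00; move: (c0) => c cn; field.
have [[mrf prf frf] [mif pif fif]] := Lp1_parts Lf.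
have [[mrg prg frg] [mig pig fig]] := Lp1_parts Lg.
have [hmr hmi] := weyl_mode_integral Lf Lg hw.
have hPl l (u : R -> R) : (k0 + 5 <= l)%N -> measurable_fun setT u -> is_periodic u ->
    (Np p (rdiff beta (2 * pi / (2 ^ l)%N%:R) u) <= (2 * pi)%:E * P l `^ p)%E ->
    (Np p (iter r.*2 (bwd (2 * pi / (2 ^ l)%N%:R)) u) <= (w l)%:E)%E.
  move=> kl mu_ pu hu; apply: le_trans (hC2 u l mu_ pu) _.
  have C2E : (0 <= C2%:E)%E by rewrite lee_fin ltW.
  apply: le_trans (lee_wpmul2l C2E hu) _.
  by rewrite PE// -!EFinM lee_fin mulrA.
have hr := hC1 _ _ k0 w W mrf prf frf mrg prg frg hmr
  (fun l kl => hPl l _ kl mrg prg (Np_rdiff_le l p_gt0 b0 mrg prg mig pig).1) hW.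
have hi := hC1 _ _ k0 w W mif pif fif mig pig fig hmi
  (fun l kl => hPl l _ kl mig pig (Np_rdiff_le l p_gt0 b0 mrg prg mig pig).2) hW.
have mvr : measurable_fun setT (vallee M (2 ^ k0) (re_fun f)) by exact: measurable_vallee.
have mvi : measurable_fun setT (vallee M (2 ^ k0) (im_fun f)) by exact: measurable_vallee.
pose T x : R[i] := (vallee M (2 ^ k0) (re_fun f) x +i* vallee M (2 ^ k0) (im_fun f) x)%C.
have hT : (best_approx n p f <= pnorm p (f \- T)%R)%E.
  apply: ereal_inf_lbound; exists T => //; exact: vallee_trigpoly.
apply: (le_trans hT).
apply: le_trans (pnorm_sub_le p_gt0 p1' mrf mif mvr mvi hr hi) _.
rewrite IE -EFinD -EFinM !poweR_EFin -EFinM lee_fin.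
set s := alpha * p + 1 - p.
rewrite [X in X `^ _](_ : _ = C3 * ((2 ^ k0)%N%:R `^ (- s) * i)); last first.
  by rewrite /C3 /W; ring.
apply: powR_dyadic_comparison => //; try exact: ltW.
by rewrite /sg /s; field; rewrite gt_eqF.
Qed.
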